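(* Let $k$ be a field of characteristic $0$, let $G$ be a finite connected graph with vertex set $I$, let $A$ be the adjacency matrix of $G$, let $\Pi^0$ be the preprojective algebra of $G$ over $k$, and let $H(t)$ be its matrix Hilbert series. (a) If $A$ is not of ADET type, then $H(t)=(1-At+t^2)^{-1}$. Moreover, in this case the algebra $\Pi^0$ is Koszul. (b) If $A$ is of ADET type, then $H(t)=(1+Pt^h)(1-At+t^2)^{-1}$, where $h$ is the Coxeter number of $A$ and $P$ is the permutation matrix corresponding to an involution of $I$.
   Context: Graphs are non-oriented; multiple edges and self-loops are allowed. $I$ is the vertex set and $H$ the edge set of $G$. The adjacency matrix $A$ is the symmetric $I\times I$ matrix with $A_{ij}$ the number of edges between $i$ and $j$; a self-loop at $i$ contributes $1$ to $A_{ii}$. The path algebra $kG$ is the $k$-vector space spanned by all paths in $G$ (each edge may be traversed in either direction; a self-loop gives a single path of length one), with multiplication $\cdot$ given by concatenation. Let $e_i$ be the trivial path at $i$. For $i\in I$ and $a\in H$, let $\theta_i^a\in kG$ be the path of length two from $i$ to $i$ going along $a$ and back along the same edge $a$ if $i$ is an end-vertex of $a$, and $\theta_i^a=0$ otherwise. Put $\theta=\sum_{i\in I,\,a\in H}\theta_i^a$. The preprojective algebra is $\Pi^0=kG/(\theta)$, the quotient by the two-sided ideal generated by $\theta$. It is graded by path length; $\Pi^0(n)$ is the $n$-th graded component. For $i,j\in I$ let $\Pi^0_{ij}(n)=e_i\cdot\Pi^0(n)\cdot e_j$ (paths going from $j$ to $i$) and $H_{ij}(n)=\dim_k\Pi^0_{ij}(n)$.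 The matrix Hilbert series $H(t)$ is the $I\times I$ matrix with entries $H_{ij}(t)=\sum_{n\ge 0}H_{ij}(n)t^n$. Koszulness is that of a graded algebra over its semisimple degree-zero part $k^I$. ADET type: $G$ is a simply laced Dynkin graph $A_n$ ($n\ge1$), $D_n$ ($n\ge 4$), $E_6,E_7,E_8$, or $T_n$ ($n\geq 1$), where $T_n$ is the graph on $n$ vertices consisting of a line (a graph of type $A_n$) with one self-loop attached at one of its end-vertices ($T_1$ is one vertex with one self-loop). Coxeter numbers: $n+1$ for $A_n$, $2n-2$ for $D_n$, $12,18,30$ for $E_6,E_7,E_8$, and $2n+1$ for $T_n$. An involution of $I$ is a permutation of $I$ whose square is the identity (the identity is allowed). *)

(* Defs.v *)
From HB Require Import structures.
From mathcomp Require Import all_boot all_order all_algebra perm.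
From mathcomp Require Import finmap boolp classical_sets.
From mathcomp Require Import monalg.

Set Implicit Arguments.
Unset Strict Implicit.
Unset Printing Implicit Defensive.

Import GRing.Theory.
Local Open Scope ring_scope.

(* A non-oriented multigraph: each edge has a set of one (self-loop) or two
   end-vertices. *)
Record graph := Graph {
  vert : finType;
  edge : finType;
  ends : edge -> {set vert};
  ends_card : forall a, (0 < #|ends a| <= 2)%N }.

Section GraphTheory.
Variable G : graph.
Implicit Types (i j : vert G) (a : edge G) (s : seq (edge G * vert G)).

(* Since [set i; i] = [set i], a self-loop at i counts once in A_ii. *)
Definition nedges i j : nat := #|[set a | ends a == [set i; j]]|.

Definition adjmx : 'M[int]_#|vert G| :=
  \matrix_(u, v) (nedges (enum_val u) (enum_val v))%:Z.

Definition connected_graph : Prop :=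
  (0 < #|vert G|)%N /\
  forall i j, connect [rel x y | (0 < nedges x y)%N] i j.

(* The pair (i, [:: (a1, x1); ...; (an, xn)]) stands for the path whose
   successive vertices are i, x1, ..., xn, read from its target i back to its
   source xn. *)
Fixpoint walk i s : bool :=
  if s is (a, j) :: s' then (ends a == [set i; j]) && walk j s' else true.

Definition gpath := {w : vert G * seq (edge G * vert G) | walk w.1 w.2}.

Definition ptarget (p : gpath) : vert G := (val p).1.
Definition psteps (p : gpath) : seq (edge G * vert G) := (val p).2.
Definition psource (p : gpath) : vert G := last (ptarget p) (unzip2 (psteps p)).
Definition plength (p : gpath) : nat := size (psteps p).

End GraphTheory.

(* The linear extension of h to the vector space spanned by K; locked, since
   conversion tests on its unfolding diverge. *)
HB.lock Definition lext (k : fieldType) (K : choiceType) (V : lmodType k)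
  (h : K -> V) (f : {malg k[K]}) : V := \sum_(p <- msupp f) f@_p *: h p.

Section LinearExtension.
Variables (k : fieldType) (K : choiceType) (V : lmodType k).
Implicit Types (h : K -> V) (f g : {malg k[K]}).

Lemma lextEw h f (d : {fset K}) :
  (msupp f `<=` d)%fset -> lext h f = \sum_(p <- d) f@_p *: h p.
Proof.
move=> le; rewrite lext.unlock (big_fset_incl _ le) // => x _ /mcoeff_outdom ->.
by rewrite scale0r.
Qed.

Lemma lextD h : {morph lext h : f g / f + g}.
Proof.
move=> f g; pose d := (msupp f `|` msupp g)%fset.
rewrite (@lextEw h f d) ?fsubsetUl // (@lextEw h g d) ?fsubsetUr //.
rewrite (@lextEw h (f + g) d) ?msuppD_le // -big_split /=.
by apply: eq_bigr => p _; rewrite mcoeffD scalerDl.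
Qed.

Lemma lextZ h c : {morph lext h : f / c *: f}.
Proof.
move=> f; rewrite (@lextEw h (c *: f) (msupp f)) ?msuppZ_le // lext.unlock scaler_sumr.
by apply: eq_bigr => p _; rewrite mcoeffZ scalerA.
Qed.

Lemma lextU h p : lext h << p >> = h p.
Proof.
by rewrite (lextEw h (d := [fset p]%fset)) ?msuppU_le // big_seq_fset1 mcoeffUU scale1r.
Qed.

Lemma lext0 h : lext h 0 = 0.
Proof. by rewrite !lext.unlock msupp0 big_seq_fset0. Qed.

Lemma lext_addf h1 h2 f : lext (fun p => h1 p + h2 p) f = lext h1 f + lext h2 f.
Proof. by rewrite !lext.unlock -big_split; apply: eq_bigr => p _; rewrite scalerDr. Qed.

Lemma lext_scalef c h f : lext (fun p => c *: h p) f = c *: lext h f.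
Proof.
by rewrite !lext.unlock scaler_sumr; apply: eq_bigr => p _; rewrite !scalerA mulrC.
Qed.

Lemma malgUZ c p : << c *g p >> = c *: << p >> :> {malg k[K]}.
Proof. by apply/malgP => q; rewrite mcoeffZ !mcoeffU mulr_natr. Qed.

Lemma malg_lin_ind (P : {malg k[K]} -> Prop) :
  P 0 -> (forall f g, P f -> P g -> P (f + g)) ->
  (forall c f, P f -> P (c *: f)) -> (forall p, P << p >>) -> forall f, P f.
Proof.
move=> P0 PD PZ PU f; rewrite [f]monalgE; apply: big_ind => // p _.
by rewrite malgUZ; apply: PZ.
Qed.

End LinearExtension.

Section BilinearMul.
Variables (k : fieldType) (V : lmodType k) (B : V -> Prop) (m : V -> V -> V).
Hypothesis B_ind : forall P : V -> Prop, P 0 ->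
  (forall x y, P x -> P y -> P (x + y)) -> (forall c x, P x -> P (c *: x)) ->
  (forall b, B b -> P b) -> forall x, P x.
Hypothesis mDl : left_distributive m +%R.
Hypothesis mDr : right_distributive m +%R.
Hypothesis mZl : forall c x y, m (c *: x) y = c *: m x y.
Hypothesis mZr : forall c x y, m x (c *: y) = c *: m x y.

Lemma bilin0l x : m 0 x = 0.
Proof. by have := mZl 0 0 x; rewrite !scale0r. Qed.

Lemma bilin0r x : m x 0 = 0.
Proof. by have := mZr 0 x 0; rewrite !scale0r. Qed.

Lemma bilin_suml (J : Type) (r : seq J) (F : J -> V) y :
  m (\sum_(l <- r) F l) y = \sum_(l <- r) m (F l) y.
Proof. by elim/big_rec2: _ => [|l u v _ <-]; rewrite ?bilin0l // mDl. Qed.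

Lemma bilin_sumr (J : Type) (r : seq J) (F : J -> V) y :
  m y (\sum_(l <- r) F l) = \sum_(l <- r) m y (F l).
Proof. by elim/big_rec2: _ => [|l u v _ <-]; rewrite ?bilin0r // mDr. Qed.

Lemma bilinA :
  (forall x y z, B x -> B y -> B z -> m x (m y z) = m (m x y) z) -> associative m.
Proof.
move=> mA x y z.
elim/B_ind: x => [|x x' IH IH'|c x IH|x Bx].
- by rewrite !bilin0l.
- by rewrite !mDl IH IH'.
- by rewrite !mZl IH.
elim/B_ind: y => [|y y' IH IH'|c y IH|y By].
- by rewrite bilin0l bilin0r bilin0l.
- by rewrite mDl !mDr mDl IH IH'.
- by rewrite mZl !mZr mZl IH.
elim/B_ind: z => [|z z' IH IH'|c z IH|z Bz].
- by rewrite !bilin0r.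
- by rewrite !mDr IH IH'.
- by rewrite !mZr IH.
exact: mA.
Qed.

Lemma bilin1l e : (forall x, B x -> m e x = x) -> left_id e m.
Proof.
move=> me x; elim/B_ind: x => [|x x' IH IH'|c x IH|x Bx].
- by rewrite bilin0r.
- by rewrite mDr IH IH'.
- by rewrite mZr IH.
exact: me.
Qed.

Lemma bilin1r e : (forall x, B x -> m x e = x) -> right_id e m.
Proof.
move=> me x; elim/B_ind: x => [|x x' IH IH'|c x IH|x Bx].
- by rewrite bilin0l.
- by rewrite mDl IH IH'.
- by rewrite mZl IH.
exact: me.
Qed.

End BilinearMul.

Section PathAlgebra.
Variables (k : fieldType) (G : graph).
Implicit Types (i j : vert G) (s : seq (edge G * vert G)).

Definition path_alg := {malg k[gpath G]}.
HB.instance Definition _ := GRing.Lmodule.on path_alg.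
Implicit Types (x y z : path_alg).

(* The basis vector of the walk (i, s), or 0 when (i, s) is not a walk. *)
Definition kpath i s : path_alg :=
  if insub (i, s) is Some p then << p : gpath G >> else 0.

(* Paths are composed from right to left: p . q is q followed by p. *)
Definition pcat (p q : gpath G) : path_alg :=
  if psource p == ptarget q then kpath (ptarget p) (psteps p ++ psteps q) else 0.

Definition pmul x y : path_alg := lext (fun p => lext (pcat p) y) x.

Definition pidem i : path_alg := kpath i [::].
Definition pone : path_alg := \sum_i pidem i.

Lemma walk_cat i s t :
  walk i (s ++ t) = walk i s && walk (last i (unzip2 s)) t.
Proof. by elim: s i => [|[a j] s IH] i //=; rewrite IH andbA. Qed.

Lemma kpathE (p : gpath G) : kpath (ptarget p) (psteps p) = << p >>.
Proof.
rewrite /kpath; have -> : (ptarget p, psteps p) = val p by case: p => -[].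
by rewrite valK.
Qed.

Lemma kpath_walk i s (w : walk i s) : kpath i s = << (exist _ (i, s) w : gpath G) >>.
Proof. by rewrite -kpathE. Qed.

Lemma pmulDl : left_distributive pmul +%R.
Proof. by move=> x y z; rewrite !/pmul lextD. Qed.

Lemma pmulDr : right_distributive pmul +%R.
Proof.
move=> x y z; rewrite !/pmul -lext_addf; congr (lext _ x).
by apply: funext => p; rewrite lextD.
Qed.

Lemma pmulZl c x y : pmul (c *: x) y = c *: pmul x y.
Proof. by rewrite !/pmul lextZ. Qed.

Lemma pmulZr c x y : pmul x (c *: y) = c *: pmul x y.
Proof.
rewrite !/pmul -lext_scalef; congr (lext _ x).
by apply: funext => p; rewrite lextZ.
Qed.

Lemma pmul0l x : pmul 0 x = 0. Proof. by rewrite /pmul lext0. Qed.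

Lemma pmul0r x : pmul x 0 = 0.
Proof. by have := pmulZr 0 x 0; rewrite !scale0r. Qed.

Lemma pmulUU p q : pmul << p >> << q >> = pcat p q.
Proof. by rewrite /pmul !lextU. Qed.

Lemma pmul_kpath i s j t : walk i s -> walk j t ->
  pmul (kpath i s) (kpath j t) =
  if last i (unzip2 s) == j then kpath i (s ++ t) else 0.
Proof. by move=> ws wt; rewrite !(kpath_walk ws, kpath_walk wt) pmulUU. Qed.

Definition is_kpath x : Prop := exists i s, walk i s /\ x = kpath i s.

Lemma path_alg_ind (P : path_alg -> Prop) :
  P 0 -> (forall x y, P x -> P y -> P (x + y)) ->
  (forall c x, P x -> P (c *: x)) ->
  (forall b, is_kpath b -> P b) -> forall x, P x.
Proof.
move=> P0 PD PZ PU; apply: malg_lin_ind => // -[[i s] w].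
by rewrite -kpath_walk; apply: PU; exists i, s.
Qed.

Lemma pmul_kpathA i s j t l u : walk i s -> walk j t -> walk l u ->
  pmul (kpath i s) (pmul (kpath j t) (kpath l u)) =
  pmul (pmul (kpath i s) (kpath j t)) (kpath l u).
Proof.
move=> ws wt wu; rewrite !pmul_kpath //.
have [ejl|njl] := eqVneq (last j (unzip2 t)) l; last first.
  rewrite pmul0r; have [eij|nij] := eqVneq; last by rewrite pmul0l.
  rewrite pmul_kpath ?walk_cat ?ws ?eij //.
  by rewrite /unzip2 map_cat last_cat -/unzip2 eij (negPf njl).
have wtu : walk j (t ++ u) by rewrite walk_cat wt ejl.
rewrite pmul_kpath //; have [eij|nij] := eqVneq; last by rewrite pmul0l.
rewrite pmul_kpath ?walk_cat ?ws ?eij //.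
by rewrite /unzip2 map_cat last_cat -/unzip2 eij ejl eqxx catA.
Qed.

Lemma pmulA : associative pmul.
Proof.
apply: (bilinA path_alg_ind pmulDl pmulDr pmulZl pmulZr).
move=> _ _ _ [i [s [ws ->]]] [j [t [wt ->]]] [l [u [wu ->]]].
exact: pmul_kpathA.
Qed.

Lemma pmul1l : left_id pone pmul.
Proof.
apply: (bilin1l path_alg_ind pmulDr pmulZr) => _ [i [s [ws ->]]].
rewrite /pone (bilin_suml pmulDl pmulZl) (bigD1 i) //=.
rewrite pmul_kpath //= eqxx big1 ?addr0 // => j /negPf nji.
by rewrite pmul_kpath //= nji.
Qed.

Lemma pmul1r : right_id pone pmul.
Proof.
apply: (bilin1r path_alg_ind pmulDl pmulZl) => _ [i [s [ws ->]]].
rewrite /pone (bilin_sumr pmulDr pmulZr) (bigD1 (last i (unzip2 s))) //=.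
rewrite pmul_kpath //= eqxx cats0 big1 ?addr0 // => j nji.
by rewrite pmul_kpath //= eq_sym (negPf nji).
Qed.

HB.instance Definition _ := GRing.Zmodule_isPzRing.Build path_alg
  pmulA pmul1l pmul1r pmulDl pmulDr.

Definition phomog (n : nat) x : Prop := {in msupp x, forall p, plength p = n}.

(* There is at most one j with ends a = [set i; j], so the sum has at most one
   nonzero term, and none when i is not an end-vertex of a. *)
Definition theta_at i (a : edge G) : path_alg :=
  \sum_j kpath i [:: (a, j); (a, i)].

Definition theta : path_alg := \sum_i \sum_a theta_at i a.

Definition in_theta_ideal x : Prop :=
  exists r : seq (path_alg * path_alg), x = \sum_(u <- r) u.1 * theta * u.2.

Definition theta_ideal : pred path_alg := fun x => `[< in_theta_ideal x >].

Lemma theta_idealP x : reflect (in_theta_ideal x) (x \in theta_ideal).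
Proof. exact: asboolP. Qed.

Lemma theta_idealMl x y : y \in theta_ideal -> x * y \in theta_ideal.
Proof.
move=> /theta_idealP[r ->]; apply/theta_idealP.
exists [seq (x * u.1, u.2) | u <- r]; rewrite big_map mulr_sumr.
by apply: eq_bigr => u _; rewrite !mulrA.
Qed.

Lemma theta_idealMr x y : y \in theta_ideal -> y * x \in theta_ideal.
Proof.
move=> /theta_idealP[r ->]; apply/theta_idealP.
exists [seq (u.1, u.2 * x) | u <- r]; rewrite big_map mulr_suml.
by apply: eq_bigr => u _; rewrite !mulrA.
Qed.

Lemma theta_ideal_zmod : zmod_closed theta_ideal.
Proof.
split; first by apply/theta_idealP; exists [::]; rewrite big_nil.
move=> x y xI yI.
have /theta_idealP[s es] := theta_idealMl (-1) yI.
move: xI => /theta_idealP[r er]; apply/theta_idealP; exists (r ++ s).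
by rewrite big_cat /= -er -es mulN1r.
Qed.

HB.instance Definition _ :=
  GRing.isZmodClosed.Build path_alg theta_ideal theta_ideal_zmod.

Lemma theta_idealZ c y : y \in theta_ideal -> c *: y \in theta_ideal.
Proof.
move=> yI; have -> : c *: y = (c *: (1 : path_alg) : path_alg) * y.
  by rewrite -[in LHS](mul1r y); symmetry; exact: pmulZl.
exact: theta_idealMl.
Qed.

End PathAlgebra.

Section Preprojective.
Variables (k : fieldType) (G : graph).
Local Notation kG := (path_alg k G).

Definition theta_zmod : zmodClosed kG :=
  GRing.ZmodClosed.clone kG (@theta_ideal k G) _.
Definition preproj : Type := Quotient.quot theta_zmod.
HB.instance Definition _ := GRing.Zmodule.on preproj.
Implicit Types (x y z : preproj) (u v : kG).

Definition pproj u : preproj := (\pi_(Quotient.quot theta_zmod) u)%qT.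
Definition prepr x : kG 
  := generic_quotient.repr (x : Quotient.quot theta_zmod).

Lemma preprK x : pproj (prepr x) = x.
Proof. exact: reprK. Qed.

Lemma pproj_eq u v : u - v \in @theta_ideal k G <-> pproj u = pproj v.
Proof. by rewrite Quotient.idealrBE; split=> /eqP. Qed.

Lemma pprojD : {morph pproj : u v / u + v}.
Proof. by move=> u v; rewrite /pproj raddfD. Qed.

Lemma pproj0 : pproj 0 = 0.
Proof. by apply: (addrI (pproj 0)); rewrite -pprojD !addr0. Qed.

Definition preproj_one : preproj := pproj 1.
Definition preproj_mul x y : preproj := pproj (prepr x * prepr y).
Definition preproj_scale (c : k) x : preproj := pproj (c *: prepr x).

Lemma pprojM u v : pproj (u * v) = preproj_mul (pproj u) (pproj v).
Proof.
apply/pproj_eq; set u' := prepr _; set v' := prepr _.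
have -> : u * v - u' * v' = u * (v - v') + (u - u') * v'.
  by rewrite mulrBr mulrBl addrA addrNK.
apply: rpredD; [apply: theta_idealMl | apply: theta_idealMr];
  by apply/pproj_eq; rewrite preprK.
Qed.

Lemma pprojZ c u : pproj (c *: u) = preproj_scale c (pproj u).
Proof.
apply/pproj_eq; rewrite -scalerBr; apply: theta_idealZ.
by apply/pproj_eq; rewrite preprK.
Qed.

Lemma preproj_mulA : associative preproj_mul.
Proof.
move=> x y z; rewrite -[x]preprK -[y]preprK -[z]preprK.
by rewrite -!pprojM mulrA.
Qed.

Lemma preproj_mul1l : left_id preproj_one preproj_mul.
Proof. by move=> x; rewrite -[x]preprK -pprojM mul1r. Qed.

Lemma preproj_mul1r : right_id preproj_one preproj_mul.
Proof. by move=> x; rewrite -[x]preprK -pprojM mulr1. Qed.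

Lemma preproj_mulDl : left_distributive preproj_mul +%R.
Proof.
move=> x y z; rewrite -[x]preprK -[y]preprK -[z]preprK.
by rewrite -pprojD -!pprojM -pprojD mulrDl.
Qed.

Lemma preproj_mulDr : right_distributive preproj_mul +%R.
Proof.
move=> x y z; rewrite -[x]preprK -[y]preprK -[z]preprK.
by rewrite -pprojD -!pprojM -pprojD mulrDr.
Qed.

HB.instance Definition _ := GRing.Zmodule_isPzRing.Build preproj
  preproj_mulA preproj_mul1l preproj_mul1r preproj_mulDl preproj_mulDr.

Lemma pproj_mul : {morph pproj : u v / u * v}.
Proof. exact: pprojM. Qed.

Lemma preproj_scaleA c d x :
  preproj_scale c (preproj_scale d x) = preproj_scale (c * d) x.
Proof. by rewrite -[x]preprK -!pprojZ scalerA. Qed.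

Lemma preproj_scale1 : left_id 1 preproj_scale.
Proof. by move=> x; rewrite -[x]preprK -pprojZ scale1r. Qed.

Lemma preproj_scaleDr : right_distributive preproj_scale +%R.
Proof.
move=> c x y; rewrite -[x]preprK -[y]preprK -pprojD -!pprojZ -pprojD.
by rewrite scalerDr.
Qed.

Lemma preproj_scaleDl x : {morph preproj_scale^~ x : c d / c + d}.
Proof. by move=> c d; rewrite -[x]preprK -!pprojZ -pprojD scalerDl. Qed.

HB.instance Definition _ := GRing.Zmodule_isLmodule.Build k preproj
  preproj_scaleA preproj_scale1 preproj_scaleDr preproj_scaleDl.

Lemma pproj_scale c : {morph pproj : u / c *: u}.
Proof. exact: pprojZ. Qed.

Lemma preproj_scaleAl c x y : c *: (x * y) = (c *: x) * y.
Proof.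
rewrite -[x]preprK -[y]preprK -pproj_mul -!pproj_scale -pproj_mul.
by congr pproj; symmetry; exact: pmulZl.
Qed.

Lemma preproj_scaleAr c x y : c *: (x * y) = x * (c *: y).
Proof.
rewrite -[x]preprK -[y]preprK -pproj_mul -!pproj_scale -pproj_mul.
by congr pproj; symmetry; exact: pmulZr.
Qed.

Definition preproj_deg (n : nat) x : Prop := exists2 u, phomog n u & x = pproj u.

Definition preproj_idem (i : vert G) : preproj := pproj (pidem k i).

Definition preproj_piece (i j : vert G) (n : nat) x : Prop :=
  exists2 y, preproj_deg n y & x = preproj_idem i * y * preproj_idem j.

End Preprojective.

Section Dimension.
Variables (k : fieldType) (V : lmodType k).
Implicit Type S : V -> Prop.

Definition has_dim S (d : nat) : Prop :=
  exists b : 'I_d -> V,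
    [/\ forall l, S (b l),
        forall c : 'I_d -> k, \sum_l c l *: b l = 0 -> forall l, c l = 0
      & forall x, S x -> exists c : 'I_d -> k, x = \sum_l c l *: b l].

(* Junk value 0 when S is not finite-dimensional; this does not occur for the
   pieces of the preprojective algebra, see preproj_piece_has_dim. *)
Definition dimk S : nat := xget 0%N (has_dim S).

Definition in_span (r : seq V) x : Prop :=
  exists c : 'I_(size r) -> k, x = \sum_l c l *: r`_l.

Lemma in_span0 r : in_span r 0.
Proof. by exists (fun=> 0); rewrite big1 // => l _; rewrite scale0r. Qed.

Lemma in_spanD r x y : in_span r x -> in_span r y -> in_span r (x + y).
Proof.
move=> [c ->] [d ->]; exists (fun l => c l + d l); rewrite -big_split.
by apply: eq_bigr => l _; rewrite scalerDl.
Qed.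

Lemma in_spanZ r c x : in_span r x -> in_span r (c *: x).
Proof.
move=> [d ->]; exists (fun l => c * d l); rewrite scaler_sumr.
by apply: eq_bigr => l _; rewrite scalerA.
Qed.

Lemma in_span_mem r x : x \in r -> in_span r x.
Proof.
move=> xr; have lt : (index x r < size r)%N by rewrite index_mem.
exists (fun l => (l == Ordinal lt)%:R); rewrite (bigD1 (Ordinal lt)) //=.
rewrite eqxx scale1r nth_index // big1 ?addr0 // => l /negPf ->.
by rewrite scale0r.
Qed.

Lemma eq_has_dim S S' d : (forall x, S x <-> S' x) -> has_dim S d -> has_dim S' d.
Proof.
by move=> SS' [b [Sb fb gb]]; exists b; split=> // [l|x Sx]; [exact/SS' | exact/gb/SS'].
Qed.

Lemma has_dim_le S d d' : has_dim S d -> has_dim S d' -> (d <= d')%N.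
Proof.
move=> [b [Sb fb _]] [b' [_ _ gb']].
have /choice[M hM] l : exists c : 'I_d' -> k, b l = \sum_l' c l' *: b' l'.
  exact: gb'.
pose A : 'M[k]_(d, d') := \matrix_(i, j) M i j.
have kA : kermx A = 0.
  apply/row_matrixP => u; rewrite row0; apply/rowP => v; rewrite [LHS]mxE [RHS]mxE.
  pose c l := kermx A u l.
  apply: (fb c).
  under eq_bigr => i _ do rewrite hM scaler_sumr.
  rewrite exchange_big big1 // => j _ /=.
  under eq_bigr => i _ do rewrite scalerA.
  rewrite -scaler_suml (_ : \sum_i _ = (kermx A *m A) u j).
    by rewrite mulmx_ker mxE scale0r.
  by rewrite [RHS]mxE; apply: eq_bigr => i _; rewrite [A i j]mxE.
have rA : row_free A by rewrite -kermx_eq0 kA.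
by rewrite -(eqP rA) rank_leq_col.
Qed.

Lemma dimkE S d : has_dim S d -> dimk S = d.
Proof.
move=> Sd; rewrite /dimk; case: xgetP => [e _ Se|/(_ d)//].
by apply/eqP; rewrite eqn_leq !(has_dim_le (S := S)).
Qed.

Lemma has_dim_span r : exists d, has_dim (in_span r) d.
Proof.
elim: r => [|v r [d [b [Sb fb gb]]]].
  exists 0%N, (fun=> 0); split=> [[]||x [c ->]] //; first by move=> c _ [].
  by exists (fun=> 0); rewrite !big_ord0.
have span_cons x : in_span (v :: r) x <-> exists c y, in_span r y /\ x = c *: v + y.
  split=> [[c ->]|[c [y [[e ->] ->]]]].
    rewrite big_ord_recl; exists (c ord0), (\sum_(l < size r) c (lift ord0 l) *: r`_l).
    by split; first by exists (fun l => c (lift ord0 l)).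
  exists (fun l : 'I_(size r).+1 => if unlift ord0 l is Some l' then e l' else c).
  rewrite big_ord_recl /= unlift_none; congr (_ + _).
  by apply: eq_bigr => l _; rewrite liftK.
have [vr|vNr] := pselect (in_span r v).
  exists d, b; split=> // [l|x /span_cons[c [y [ry ->]]]].
    by apply/span_cons; exists 0, (b l); split; rewrite ?scale0r ?add0r.
  have [e ->] := gb _ vr; have [f ->] := gb _ ry; exists (fun l => c * e l + f l).
  rewrite scaler_sumr -big_split; apply: eq_bigr => l _.
  by rewrite scalerDl scalerA.
have sumr c : in_span r (\sum_(l < d) c l *: b l).
  have /choice[M hM] l : exists e : 'I_(size r) -> k, b l = \sum_m e m *: r`_m.
    exact: Sb.
  exists (fun m => \sum_l c l * M l m).
  under [RHS]eq_bigr do rewrite scaler_suml.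
  rewrite exchange_big; apply: eq_bigr => l _ /=; rewrite hM scaler_sumr.
  by apply: eq_bigr => m _; rewrite scalerA.
exists d.+1, (fun l => if unlift ord0 l is Some l' then b l' else v); split.
- move=> l; apply/span_cons; case: unliftP => [l' _|_].
    by exists 0, (b l'); rewrite scale0r add0r.
  exists 1, 0; rewrite scale1r addr0; split=> //.
  by exists (fun=> 0); rewrite big1 // => *; rewrite scale0r.
- move=> c; rewrite big_ord_recl /= unlift_none.
  under eq_bigr do rewrite liftK.
  move=> e; have c0 : c ord0 = 0.
    apply: contrapT => /eqP nc0; apply: vNr.
    have -> : v = \sum_(l < d) (- (c ord0)^-1 * c (lift ord0 l)) *: b l.
      under eq_bigr do rewrite -scalerA.
      rewrite -scaler_sumr; have -> : \sum_i c (lift ord0 i) *: b i = - (c ord0 *: v).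
        by apply/eqP; rewrite -addr_eq0 addrC e.
      by rewrite scalerN scaleNr opprK scalerA mulVf ?scale1r.
    exact: sumr.
  move: e; rewrite c0 scale0r add0r => /fb fc l.
  by have [l' ->|->] := unliftP ord0 l.
- move=> x /span_cons[c [y [/gb[e ->] ->]]].
  exists (fun l => if unlift ord0 l is Some l' then e l' else c).
  rewrite big_ord_recl /= !unlift_none; congr (_ + _).
  by apply: eq_bigr => l _; rewrite !liftK.
Qed.

End Dimension.

Definition hilbert (k : fieldType) (G : graph) (n : nat) : 'M[int]_#|vert G| :=
  \matrix_(u, v) (dimk (@preproj_piece k G (enum_val u) (enum_val v) n))%:Z.

Section HilbertFinite.
Variables (k : fieldType) (G : graph).
Local Notation P := (preproj k G).
Local Notation kG := (path_alg k G).
Variables (i j : vert G) (n : nat).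

Lemma preproj_piece0 : preproj_piece i j n (0 : P).
Proof.
exists 0; last by rewrite mulr0 mul0r.
exists 0; last by rewrite pproj0.
by move=> p; rewrite msupp0.
Qed.

Lemma preproj_pieceD (x y : P) :
  preproj_piece i j n x -> preproj_piece i j n y -> preproj_piece i j n (x + y).
Proof.
move=> [_ [u hu ->] ->] [_ [v hv ->] ->]; exists (pproj (u + v)).
  exists (u + v) => // p /(fsubsetP (msuppD_le _ _)); rewrite in_fsetU.
  by case/orP; [exact: hu | exact: hv].
by rewrite pprojD mulrDr mulrDl.
Qed.

Lemma preproj_pieceZ c (x : P) : preproj_piece i j n x -> preproj_piece i j n (c *: x).
Proof.
move=> [_ [u hu ->] ->]; exists (pproj (c *: u)).
  by exists (c *: u) => // p /(fsubsetP (msuppZ_le _ _)); exact: hu.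
by rewrite pproj_scale preproj_scaleAl preproj_scaleAr.
Qed.

Definition piece_gens : seq P :=
  [seq pproj (kpath k i (val s)) |
     s <- enum {: n.-tuple (edge G * vert G)} & last i (unzip2 (val s)) == j].

Lemma piece_kpath l s :
  preproj_idem k i * pproj (kpath k l s) * preproj_idem k j =
  if walk l s && ((l == i) && (last l (unzip2 s) == j))
  then pproj (kpath k l s) else 0.
Proof.
have p0 := pproj0 k G.
have [ws|nws] := boolP (walk l s); last first.
  by rewrite /kpath insubF ?(negPf nws) // p0 mulr0 mul0r.
rewrite /preproj_idem -!pproj_mul.
have -> : pidem k i * kpath k l s = if i == l then kpath k l s else 0.
  by rewrite -[LHS]/(pmul _ _) pmul_kpath //=; case: eqP => [->|].
rewrite [l == i]eq_sym; case: eqP => [_|_]; last by rewrite mul0r p0.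
rewrite -[_ * _]/(pmul _ _) pmul_kpath //= cats0.
by case: eqP => // _; rewrite p0.
Qed.

Lemma piece_span (x : P) : in_span piece_gens x <-> preproj_piece i j n x.
Proof.
split=> [[c ->]|[_ [u hu ->] ->]].
  apply: big_ind; [exact: preproj_piece0|exact: preproj_pieceD|].
  move=> l _; apply: preproj_pieceZ.
  have /mapP[s /=] := mem_nth 0 (ltn_ord l).
  rewrite mem_filter => /andP[/eqP sj _] ->.
  have [ws|nws] := boolP (walk i (val s)); last first.
    rewrite /kpath insubF ?(negPf nws) //.
    rewrite pproj0.
    exact: preproj_piece0.
  exists (pproj (kpath k i (val s))).
    exists (kpath k i (val s)) => //; rewrite (kpath_walk k ws) => p.
    rewrite msuppU oner_eq0 in_fset1 => /eqP ->.
    by rewrite /plength /psteps /= size_tuple.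
  by rewrite piece_kpath ws eqxx sj eqxx.
have {hu} : forall p, u@_p != 0 -> plength p = n.
  by move=> p; rewrite mcoeff_neq0; exact: hu.
rewrite [in pproj u](monalgE u) => hu.
have pE (r : seq (gpath G)) : all (fun p => plength p == n) r ->
    in_span piece_gens (preproj_idem k i * pproj (\sum_(p <- r) << u@_p *g p >>)
      * preproj_idem k j); last first.
  by apply: pE; apply/allP => p; rewrite -mcoeff_neq0 => /hu ->.
elim: r => [_|p r IH /= /andP[/eqP pn rn]].
  rewrite big_nil; rewrite pproj0.
  by rewrite mulr0 mul0r; exact: in_span0.
rewrite big_cons pprojD mulrDr mulrDl; apply: in_spanD; last exact: IH.
have -> : << u@_p *g p >> = u@_p *: kpath k (ptarget p) (psteps p).
  by rewrite kpathE; exact: malgUZ.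
rewrite pproj_scale -preproj_scaleAr -preproj_scaleAl.
apply: in_spanZ; rewrite piece_kpath.
case: ifP => [/and3P[_ /eqP pi /eqP pj]|_]; last exact: in_span0.
apply: in_span_mem; have sz : size (psteps p) == n by apply/eqP.
rewrite pi in pj *.
apply/mapP; exists (Tuple sz) => //.
by rewrite mem_filter /= pj eqxx mem_enum.
Qed.

Lemma preproj_piece_has_dim :
  has_dim (@preproj_piece k G i j n) (dimk (@preproj_piece k G i j n)).
Proof.
have [d /(eq_has_dim piece_span) hd] := has_dim_span piece_gens.
by rewrite (dimkE hd).
Qed.

End HilbertFinite.

Section MatrixSeries.
Variable n : nat.

Definition mseries := nat -> 'M[int]_n.
Implicit Types (F E : mseries).

(* The series M t^d. *)
Definition smono (M : 'M[int]_n) (d : nat) : mseries :=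
  fun m => if m == d then M else 0.

Definition sone : mseries := smono 1%:M 0%N.

Definition smul F E : mseries := fun m => \sum_(i < m.+1) F i *m E (m - i)%N.

Definition spow F (p : nat) : mseries := iter p (smul F) sone.

(* The inverse of a series F with constant term 1, as the geometric series
   \sum_p (1 - F)^p; the terms with p > m do not contribute to degree m. *)
Definition sinv F : mseries :=
  fun m => \sum_(p < m.+1) spow (sone \- F) p m.

Lemma spow_lt F p m : F 0%N = 0 -> (m < p)%N -> spow F p m = 0.
Proof.
move=> F0; elim: p m => // p IH m lt_mp.
rewrite -[LHS]/(smul F (spow F p) m) /smul big1 // => -[[|i] /= lti] _.
  by rewrite F0 mul0mx.
rewrite IH ?mulmx0 //; case: m lt_mp lti => // m lt_mp _.
by rewrite subSS (leq_ltn_trans (leq_subr _ _)).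
Qed.

Lemma sinvE F m K : F 0%N = 1%:M -> (m < K)%N ->
  sinv F m = \sum_(p < K) spow (sone \- F) p m.
Proof.
move=> F0 lt_mK; have N0 : (sone \- F) 0%N = 0 by rewrite /= F0 subrr.
rewrite /sinv (big_ord_widen_cond K predT (fun p => spow (sone \- F) p m)) //=.
rewrite [RHS](bigID (fun p : 'I_K => (p < m.+1)%N)) /=.
by rewrite [X in _ + X]big1 ?addr0 // => p; rewrite -leqNgt => /spow_lt ->.
Qed.

Lemma smul_sinv F : F 0%N = 1%:M -> smul F (sinv F) =1 sone.
Proof.
move=> F0 m; pose N := sone \- F.
have N0 : N 0%N = 0 by rewrite /N /= F0 subrr.
have FN E : smul F E m = E m - smul N E m.
  apply/eqP; rewrite eq_sym subr_eq /smul -big_split /=; apply/eqP.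
  under eq_bigr => i _ do rewrite -mulmxDl /N /= addrC subrK.
  rewrite big_ord_recl /= subn0 mul1mx big1 ?addr0 // => i _.
  by rewrite /sone /smono /= mul0mx.
have -> : smul F (sinv F) m = \sum_(p < m.+1) smul F (spow N p) m.
  rewrite /smul exchange_big; apply: eq_bigr => i _ /=.
  by rewrite -mulmx_sumr -(@sinvE F _ m.+1) // ltnS leq_subr.
under eq_bigr => p _ do rewrite FN -[smul N _]/(spow N p.+1).
have tele K : \sum_(p < K) (spow N p m - spow N p.+1 m) = spow N 0 m - spow N K m.
  elim: K => [|K IH]; first by rewrite big_ord0 subrr.
  by rewrite big_ord_recr /= IH addrA subrK.
by rewrite tele (spow_lt (p := m.+1)) ?subr0.
Qed.

End MatrixSeries.

(* The series 1 - A t + t^2. *)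
Definition cartan_series (G : graph) : mseries #|vert G| :=
  (smono 1%:M 0%N \- smono (adjmx G) 1%N) \+ smono 1%:M 2%N.

(* The series 1 + P t^h, P being the permutation matrix of s. *)
Definition perm_series (G : graph) (s : {perm vert G}) (h : nat) :
    mseries #|vert G| :=
  smono 1%:M 0%N \+
  smono (\matrix_(u, v) (s (enum_val u) == enum_val v)%:R) h.

Inductive adet :=
  | typeA of nat | typeD of nat | typeE6 | typeE7 | typeE8 | typeT of nat.

Definition adet_valid (X : adet) : bool :=
  match X with
  | typeA n | typeT n => (1 <= n)%N
  | typeD n => (4 <= n)%N
  | typeE6 | typeE7 | typeE8 => true
  end.

Definition adet_rank (X : adet) : nat :=
  match X with
  | typeA n | typeD n | typeT n => n
  | typeE6 => 6 | typeE7 => 7 | typeE8 => 8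
  end%N.

Definition coxeter (X : adet) : nat :=
  match X with
  | typeA n => n.+1
  | typeD n => 2 * n - 2
  | typeE6 => 12 | typeE7 => 18 | typeE8 => 30
  | typeT n => 2 * n + 1
  end%N.

Definition line_adj (x y : nat) : bool := (x.+1 == y) || (y.+1 == x).

(* The line 0 - 1 - ... - (m - 1), with a further vertex m joined to b. *)
Definition branch_adj (m b x y : nat) : bool :=
  [|| [&& x < m, y < m & line_adj x y],
      (x == m) && (y == b) | (x == b) && (y == m)]%N.

Definition adet_adj (X : adet) (x y : nat) : bool :=
  match X with
  | typeA _ => line_adj x y
  | typeD n => branch_adj n.-1 (n - 3)%N x y
  | typeE6 => branch_adj 5%N 2%N x y
  | typeE7 => branch_adj 6%N 2%N x y
  | typeE8 => branch_adj 7%N 2%N x y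
  | typeT _ => line_adj x y || ((x == 0) && (y == 0))%N
  end.

Definition has_adet_type (G : graph) (X : adet) : Prop :=
  adet_valid X /\
  exists2 f : 'I_(adet_rank X) -> vert G, bijective f &
    forall x y, nedges (f x) (f y) = adet_adj X x y.

(* M is the direct sum of the subgroups gr n. *)
Definition is_grading (M : zmodType) (gr : nat -> M -> Prop) : Prop :=
  [/\ forall n, gr n 0 /\ (forall x y, gr n x -> gr n y -> gr n (x - y)),
      forall x, exists N (f : nat -> M),
        (forall n, gr n (f n)) /\ x = \sum_(n < N) f n
    & forall N (f : nat -> M), (forall n, gr n (f n)) ->
        \sum_(n < N) f n = 0 -> forall n, (n < N)%N -> f n = 0].

(* Koszul rings in the sense of Beilinson, Ginzburg and Soergel. *)
Section Koszul.
Variables (A : pzRingType) (gr : nat -> A -> Prop).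

Definition graded_ring : Prop :=
  [/\ is_grading gr, gr 0%N 1
    & forall m n a b, gr m a -> gr n b -> gr (m + n)%N (a * b)].

(* A_0 is semisimple as a left module over itself: left ideals of A_0 have
   complements. *)
Definition left_ideal0 (J : A -> Prop) : Prop :=
  [/\ forall a, J a -> gr 0%N a, J 0, forall a b, J a -> J b -> J (a - b)
    & forall a b, gr 0%N a -> J b -> J (a * b)].

Definition semisimple0 : Prop :=
  forall J, left_ideal0 J -> exists J' : A -> Prop,
    [/\ left_ideal0 J', forall a, J a -> J' a -> a = 0
      & forall a, gr 0%N a -> exists b c, [/\ J b, J' c & a = b + c]].

(* Only modules generated in a nonnegative degree occur below, so gradings by
   natural numbers suffice. *)
Record gmod := GMod {
  gmod_sort :> lmodType A;
  gdeg : nat -> gmod_sort -> Prop;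
  gdeg_grading : is_grading gdeg;
  gdegZ : forall m n a x, gr m a -> gdeg n x -> gdeg (m + n)%N (a *: x) }.

Definition graded_hom (M N : gmod) (f : {linear M -> N}) : Prop :=
  forall n x, gdeg n x -> gdeg n (f x).

Definition onto (M N : gmod) (f : {linear M -> N}) : Prop :=
  forall y, exists x, f x = y.

Definition graded_projective (P : gmod) : Prop :=
  forall (M N : gmod) (g : {linear M -> N}) (f : {linear P -> N}),
    graded_hom g -> onto g -> graded_hom f ->
    exists2 h : {linear P -> M}, graded_hom h & forall x, g (h x) = f x.

Definition generated_in_degree (P : gmod) (d : nat) : Prop :=
  forall x : P, exists r : seq (A * P),
    (forall u, u \in r -> gdeg d u.2) /\ x = \sum_(u <- r) u.1 *: u.2.

Definition positive_part (a : A) : Prop :=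
  exists N (f : nat -> A),
    (forall n, gr n.+1 (f n)) /\ a = \sum_(n < N) f n.

(* S is the graded left module A_0, on which A_+ acts by zero: it lives in
   degree 0 and is the quotient of the regular module A by A_+. *)
Definition is_degree0_module (S : gmod) : Prop :=
  (forall s : S, gdeg 0%N s) /\
  exists2 q : {linear A^o -> S},
    (forall s, exists a, q a = s) & forall a, q a = 0 <-> positive_part a.

(* A_0 has a graded projective resolution ... -> P_1 -> P_0 -> A_0 -> 0 with P_i
   generated in degree i. *)
Definition koszul : Prop :=
  [/\ graded_ring, semisimple0 &
    exists (S : gmod) (P : nat -> gmod) (aug : {linear P 0%N -> S})
        (d : forall i, {linear P i.+1 -> P i}),
      is_degree0_module S /\
      [/\ forall i, graded_projective (P i) /\ generated_in_degree (P i) i,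
          graded_hom aug /\ (forall i, graded_hom (d i)),
          onto aug,
          forall x, aug x = 0 <-> exists y, d 0%N y = x
        & forall i x, d i x = 0 <-> exists y, d i.+1 y = x]].

End Koszul.

(* Main.v *)
Require Import Defs.
From HB Require Import structures.
From mathcomp Require Import all_boot all_order all_algebra perm.
From mathcomp Require Import finmap boolp monalg zify.

Set Implicit Arguments.
Unset Strict Implicit.
Unset Printing Implicit Defensive.

Import Order.TTheory GRing.Theory Num.Theory.
Local Open Scope ring_scope.

(** Let [A] be the adjacency matrix, and let [U_0 = 1], [U_1 = A] and
    [U_(n+2) = U_(n+1) A - U_n], so that [sum_n U_n t^n] is the inverse of
    [1 - A t + t^2]. Write [x : l <- j] for an arrow from [j] to [l], that is, an
    oriented edge, and [x'] for the opposite arrow.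
    Multiplication by arrows on the right gives complexes

      [0 --> P_ij(n) --> sum_(x : l <- j) P_il(n+1) --> P_ij(n+2) --> 0],
      [a |-> (a x')_x],   [(v_x)_x |-> sum_x v_x x],

    where [P] is the preprojective algebra. If they are exact, dimensions obey
    the recursion of [U_n], and the complexes are the graded pieces of a linear
    projective resolution, so that [P] is Koszul.

    Exactness is proved by an explicit splitting. Let [b_n(j)] be the sum of the
    column [j] of [U_n]; then [A b_n = b_(n+1) + b_(n-1)] with [b_(-1) = 0]. On
    paths, define operators [D_x] by induction on the length [n] of [p]:

      [D_x (p y) = [x = y] p - b_(n-1)(l) / b_n(j) D_(y') (p) x']
                                                          for [y : l <- j].

    They satisfy Euler's formula [sum_y D_y (u) y = u] modulo the relation
    ([deriv_euler]), and the recursion of the weights [b_n] is precisely what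
    makes them preserve the ideal of the relation ([deriv_ideal]). Exactness
    follows ([mul_arr_exact], [mul_arr_inj]), in the degrees where the weights
    occurring do not vanish; as they are integers, characteristic zero lets one
    test this over the integers. So the Hilbert function is [U_n] as long as
    the weights [b_m] with [m < n] have no zero entry ([hilbert_cheb]).

    Suppose that [b_N(j) = 0], with [N] minimal. Then [U_N] is a Hilbert
    function, hence nonnegative, and its column [j] is zero. It commutes with
    [A] and the graph is connected, so [U_N = 0] ([cheb_col_zero]). Thus either
    no weight vanishes, or some [U_N] is zero ([weight_dichotomy]).

    Outside the ADET types there is a nonzero function [d >= 0] on the vertices
    with [A d >= 2 d] ([classification]: otherwise a longest path, taken from a
    loop if there is one, exhibits the type). Nonnegativity of
    the [U_m] makes [U_m d] nondecreasing in [m], so no [U_N] vanishes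
    ([cheb_subadditive]), and the first half of the theorem follows.

    For an ADET type, following one explicit column of [U_n] shows that the
    first zero is [U_(h-1)] ([first_zero_column_adet]). The algebra then
    vanishes in degrees at least [h - 1]. The matrix [P = U_(h-2)] is symmetric
    and nonnegative with [P^2 = 1], because
    [U_(n+1)^2 - U_(n+2) U_n = 1], so it is the matrix of an involution; and
    [U_(h+n) = - P U_n], which is the claimed formula. *)

(** * The path algebra *)

(** Locked, since conversion tests between two scalings unfold finitely
    supported functions and diverge. *)
HB.lock Definition kscale (k : fieldType) (G : graph) (c : k) (u : path_alg k G) :
  path_alg k G := c *: u.
Notation "c *' u" := (kscale c u) (at level 40).

Section Paths.
Variables (k : fieldType) (G : graph).
Local Notation kG := (path_alg k G).
Local Notation kpath := (@kpath k G).
Local Notation arrow := (vert G * edge G * vert G)%type.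
Implicit Types (i j l : vert G) (s t : seq (edge G * vert G)) (u v w : kG).
Implicit Types (x y z : arrow).

Lemma kscaleE c u : c *' u = c *: u.
Proof. by rewrite kscale.unlock. Qed.

Lemma kscale_mull c u v : c *' u * v = c *' (u * v).
Proof. by rewrite !kscaleE; exact: pmulZl. Qed.

Lemma kscale_mulr c u v : u * (c *' v) = c *' (u * v).
Proof. by rewrite !kscaleE; exact: pmulZr. Qed.

Lemma kscaleDr c : {morph @kscale k G c : u v / u + v}.
Proof. by move=> u v; rewrite !kscaleE scalerDr. Qed.

Lemma kscaleBr c u v : c *' (u - v) = c *' u - c *' v.
Proof. by rewrite !kscaleE scalerBr. Qed.

Lemma kscaleA c d u : c *' (d *' u) = (c * d) *' u.
Proof. by rewrite !kscaleE scalerA. Qed.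

Lemma kscale0 u : (0 : k) *' u = 0.
Proof. by rewrite kscaleE scale0r. Qed.

Lemma kscaler0 c : c *' (0 : kG) = 0.
Proof. by rewrite kscaleE scaler0. Qed.

Lemma kscale1 u : (1 : k) *' u = u.
Proof. by rewrite kscaleE scale1r. Qed.

Lemma pproj_kscale c u : pproj (c *' u) = c *: pproj u.
Proof. by rewrite kscaleE pproj_scale. Qed.

Lemma kpath_linear_ind (P : kG -> Prop) :
  P 0 -> (forall u v, P u -> P v -> P (u + v)) -> (forall c u, P u -> P (c *' u)) ->
  (forall i s, walk i s -> P (kpath i s)) -> forall u, P u.
Proof.
move=> P0 PD PZ Pk; apply: path_alg_ind => // [c u|_ [i [s [ws ->]]]]; last exact: Pk.
by rewrite -kscaleE; exact: PZ.
Qed.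

Lemma mul_kpath i s j t : walk i s -> walk j t ->
  kpath i s * kpath j t =
  if last i (unzip2 s) == j then kpath i (s ++ t) else 0.
Proof. exact: pmul_kpath. Qed.

Lemma kpath_nwalk i s : ~~ walk i s -> kpath i s = 0.
Proof. by move=> /negPf nw; rewrite /Defs.kpath insubF. Qed.

(** Arrows are all triples [(l, a, j)], read from [j] to [l]; those for which
    [a] does not join [l] and [j] give the zero element of the path algebra.
    This keeps the index set a plain product. *)
Definition is_arrow x : bool := ends x.1.2 == [set x.1.1; x.2].
Definition arr x : kG := kpath x.1.1 [:: (x.1.2, x.2)].
Definition opp_arrow x : arrow := (x.2, x.1.2, x.1.1).
Local Notation e := (@pidem k G).

Lemma opp_arrowK : involutive opp_arrow.
Proof. by move=> [[l a] j]. Qed.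

Lemma is_arrow_opp x : is_arrow (opp_arrow x) = is_arrow x.
Proof. by rewrite /is_arrow /= finset.setUC. Qed.

Lemma arr_eq0 x : ~~ is_arrow x -> arr x = 0.
Proof. by move=> nx; rewrite /arr kpath_nwalk //= andbT. Qed.

Lemma kpath_rcons i s a j :
  kpath i (rcons s (a, j)) = kpath i s * arr (last i (unzip2 s), a, j).
Proof.
have [ws|nws] := boolP (walk i s); last first.
  by rewrite [kpath i s]kpath_nwalk // kpath_nwalk ?mul0r // -cats1 walk_cat (negPf nws).
have [va|nva] := boolP (is_arrow (last i (unzip2 s), a, j)); last first.
  rewrite [arr _]arr_eq0 // mulr0 kpath_nwalk // -cats1 walk_cat ws /= andbT.
  exact: nva.
by rewrite /arr mul_kpath //= ?eqxx ?cats1 // andbT.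
Qed.

Lemma kpath_last i s l : kpath i s * e l = if last i (unzip2 s) == l then kpath i s else 0.
Proof.
have [ws|nws] := boolP (walk i s); first by rewrite /pidem mul_kpath // cats0.
by rewrite kpath_nwalk // mul0r if_same.
Qed.

Lemma idem_kpath i s l : e l * kpath i s = if l == i then kpath i s else 0.
Proof.
have [ws|nws] := boolP (walk i s); last by rewrite kpath_nwalk // mulr0 if_same.
by rewrite /pidem mul_kpath //=; case: eqP => [->|].
Qed.

Lemma arr_idem x l : arr x * e l = if x.2 == l then arr x else 0.
Proof. exact: kpath_last. Qed.

Lemma idem_arr x l : e l * arr x = if l == x.1.1 then arr x else 0.
Proof. exact: idem_kpath. Qed.

Lemma idem_mul i j : e i * e j = if i == j then e i else 0.
Proof. exact: kpath_last. Qed.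

Lemma kpath_nil i : e i = kpath i [::].
Proof. by []. Qed.

Lemma sum_idem : \sum_i e i = 1 :> kG.
Proof. by []. Qed.

Lemma sum_idemr u : u = \sum_i u * e i.
Proof. by rewrite -mulr_sumr sum_idem mulr1. Qed.

Lemma thetaE : theta k G = \sum_y arr (opp_arrow y) * arr y.
Proof.
rewrite /theta /theta_at.
under eq_bigr => i _.
  under eq_bigr => a _.
    under eq_bigr => j _.
      rewrite -[[:: _; _]]/(rcons [:: (a, j)] (a, i)) kpath_rcons.
      rewrite -[kpath i _]/(arr (opp_arrow ((j, a), i))) /=.
      over.
    over.
  rewrite exchange_big.
  over.
rewrite exchange_big [RHS](eq_bigr (fun y => arr (opp_arrow (y.1, y.2)) * arr (y.1, y.2))); last by case.
rewrite -(pair_bigA _ (fun la j => arr (opp_arrow (la, j)) * arr (la, j))) /=.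
rewrite [RHS](eq_bigr (fun la => \sum_j arr (opp_arrow ((la.1, la.2), j)) * arr ((la.1, la.2), j))); last by case.
rewrite -(pair_bigA _ (fun l a => \sum_j arr (opp_arrow ((l, a), j)) * arr ((l, a), j))) /=.
by apply: eq_bigr => l _; rewrite exchange_big.
Qed.

Lemma theta_idemC j : e j * theta k G = theta k G * e j.
Proof.
rewrite thetaE mulr_sumr mulr_suml; apply: eq_bigr => y _.
by rewrite -mulrA arr_idem mulrA idem_arr /= eq_sym; case: eqP; rewrite ?mul0r ?mulr0.
Qed.

(** * Homogeneous elements *)

Lemma phomog0 n : phomog n (0 : kG).
Proof. by move=> p; rewrite msupp0. Qed.

Lemma phomogD n u v : phomog n u -> phomog n v -> phomog n (u + v).
Proof.
move=> hu hv p /(fsubsetP (msuppD_le _ _)); rewrite in_fsetU.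
by case/orP; [exact: hu | exact: hv].
Qed.

Lemma phomogZ n c u : phomog n u -> phomog n (c *' u).
Proof. by move=> hu p; rewrite kscaleE => /(fsubsetP (msuppZ_le _ _)); exact: hu. Qed.

Lemma phomogN n u : phomog n u -> phomog n (- u).
Proof. by rewrite -scaleN1r -kscaleE; exact: phomogZ. Qed.

Lemma phomog_sum n (T : Type) (r : seq T) (P : pred T) (F : T -> kG) :
  (forall a, P a -> phomog n (F a)) -> phomog n (\sum_(a <- r | P a) F a).
Proof. by move=> hF; apply: big_ind => //; [exact: phomog0 | exact: phomogD]. Qed.

Lemma phomog_kpath i s n : size s = n -> phomog n (kpath i s).
Proof.
move=> <-; have [ws|nws] := boolP (walk i s); last first.
  by rewrite kpath_nwalk //; exact: phomog0.
rewrite (kpath_walk k ws) => p.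
by rewrite msuppU oner_eq0 in_fset1 => /eqP ->.
Qed.

Lemma phomog_arr x : phomog 1 (arr x).
Proof. exact: phomog_kpath. Qed.

Lemma phomog_idem i : phomog 0 (e i).
Proof. exact: phomog_kpath. Qed.

Lemma phomog_ind n (P : kG -> Prop) :
  P 0 -> (forall u v, P u -> P v -> P (u + v)) -> (forall c u, P u -> P (c *' u)) ->
  (forall i s, walk i s -> size s = n -> P (kpath i s)) ->
  forall u, phomog n u -> P u.
Proof.
move=> P0 PD PZ Pk u hu; rewrite [u]monalgE big_seq.
apply: big_ind => // p pu; rewrite malgUZ -kscaleE; apply: PZ.
rewrite -kpathE; apply: Pk; last exact: hu.
by case: p {pu} => -[].
Qed.

Lemma phomogM m n u v : phomog m u -> phomog n v -> phomog (m + n) (u * v).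
Proof.
move=> hu hv; elim/phomog_ind: hu => [|u1 u2 h1 h2|c u1 h1|i s ws ms].
- by rewrite mul0r; exact: phomog0.
- by rewrite mulrDl; exact: phomogD.
- by rewrite kscale_mull; exact: phomogZ.
elim/phomog_ind: hv => [|u1 u2 h1 h2|c u1 h1|j t wt nt].
- by rewrite mulr0; exact: phomog0.
- by rewrite mulrDr; exact: phomogD.
- by rewrite kscale_mulr; exact: phomogZ.
rewrite mul_kpath //; case: eqP => _; last exact: phomog0.
by apply: phomog_kpath; rewrite size_cat ms nt.
Qed.

Lemma phomog_theta : phomog 2 (theta k G).
Proof.
rewrite thetaE; apply: phomog_sum => y _.
by apply: (@phomogM 1 1); exact: phomog_arr.
Qed.

Definition hpart n u : kG := lext (fun p : gpath G => if plength p == n then << p >> else 0) u.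

Lemma hpartD n : {morph hpart n : u v / u + v}.
Proof. exact: lextD. Qed.

Lemma hpartZ n c : {morph hpart n : u / c *' u}.
Proof. by move=> u; rewrite !kscaleE; exact: lextZ. Qed.

Lemma hpart0 n : hpart n 0 = 0.
Proof. exact: lext0. Qed.

Lemma hpart_sum n (T : Type) (r : seq T) (P : pred T) (F : T -> kG) :
  hpart n (\sum_(a <- r | P a) F a) = \sum_(a <- r | P a) hpart n (F a).
Proof. exact: (big_morph _ (hpartD n) (hpart0 n)). Qed.

Lemma hpart_kpath n i s : hpart n (kpath i s) = if size s == n then kpath i s else 0.
Proof.
have [ws|nws] := boolP (walk i s); last by rewrite kpath_nwalk // hpart0 if_same.
by rewrite (kpath_walk k ws) /hpart lextU.
Qed.

Lemma hpart_homog n m u : phomog m u -> hpart n u = if m == n then u else 0.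
Proof.
elim/phomog_ind=> [|u1 u2 h1 h2|c u1 h1|i s ws ms].
- by rewrite hpart0 if_same.
- by rewrite hpartD h1 h2; case: eqP; rewrite ?addr0.
- by rewrite hpartZ h1; case: eqP; rewrite ?kscaler0.
by rewrite hpart_kpath ms.
Qed.

Lemma phomog_hpart n u : phomog n (hpart n u).
Proof.
elim/kpath_linear_ind: u => [|u1 u2 h1 h2|c u1 h1|i s ws].
- by rewrite hpart0; exact: phomog0.
- by rewrite hpartD; exact: phomogD.
- by rewrite hpartZ; exact: phomogZ.
by rewrite hpart_kpath; case: eqP => [/phomog_kpath|_] //; exact: phomog0.
Qed.

Lemma hpart_decomp u : exists N, forall M, (N <= M)%N -> u = \sum_(n < M) hpart n u.
Proof.
elim/kpath_linear_ind: u => [|u1 u2 [N1 h1] [N2 h2]|c u1 [N h1]|i s ws].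
- by exists 0%N => M _; rewrite big1 // => *; rewrite hpart0.
- exists (maxn N1 N2) => M; rewrite geq_max => /andP[l1 l2].
  rewrite {1}(h1 _ l1) {1}(h2 _ l2) -big_split.
  by apply: eq_bigr => n _; rewrite /= hpartD.
- exists N => M /h1 {1}->; rewrite (big_morph _ (kscaleDr c) (kscaler0 c)).
  by apply: eq_bigr => n _; rewrite hpartZ.
exists (size s).+1 => M lt; rewrite (bigD1 (Ordinal lt)) //= hpart_kpath eqxx.
rewrite big1 ?addr0 // => n /eqP ne; rewrite hpart_kpath; case: eqP => // en.
by case: ne; apply: val_inj.
Qed.

(** A product [u theta v] expands into products [p theta q] with [p], [q] paths,
    each of which is homogeneous because [theta] is; so the component of degree
    [n] of an element of the ideal only sees the paths of total length [n -
    2]. *)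
Lemma hpart_ideal_ind n (P : kG -> Prop) :
  P 0 -> (forall u v, P u -> P v -> P (u + v)) -> (forall c u, P u -> P (c *' u)) ->
  (forall i s j t, walk i s -> walk j t -> (size s + 2 + size t)%N = n ->
    P (kpath i s * theta k G * kpath j t)) ->
  forall u, u \in @theta_ideal k G -> P (hpart n u).
Proof.
move=> P0 PD PZ Pk u /theta_idealP[r ->]; rewrite hpart_sum.
apply: big_ind => // -[v w] _ /=.
elim/kpath_linear_ind: v => [|u1 u2 h1 h2|c u1 h1|i s ws].
- by rewrite !mul0r hpart0.
- by rewrite !mulrDl hpartD; exact: PD.
- by rewrite !kscale_mull hpartZ; exact: PZ.
elim/kpath_linear_ind: w => [|u1 u2 h1 h2|c u1 h1|j t wt].
- by rewrite !mulr0 hpart0.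
- by rewrite !mulrDr hpartD; exact: PD.
- by rewrite !kscale_mulr hpartZ; exact: PZ.
have h : phomog (size s + 2 + size t) (kpath i s * theta k G * kpath j t).
  apply: phomogM; last exact: phomog_kpath.
  by apply: phomogM; [exact: phomog_kpath|exact: phomog_theta].
by rewrite (hpart_homog _ h); case: eqP => [/Pk|_] //; apply.
Qed.

Lemma hpart_ideal n u : u \in @theta_ideal k G -> hpart n u \in @theta_ideal k G.
Proof.
move: u; apply: (hpart_ideal_ind (P := fun v => v \in @theta_ideal k G)) => [|u v|c u|i s j t _ _ _].
- exact: rpred0.
- exact: rpredD.
- by rewrite kscaleE; exact: theta_idealZ.
by apply/theta_idealP; exists [:: (kpath i s, kpath j t)]; rewrite big_seq1.
Qed.
End Paths.

(** * Derivations with respect to arrows *)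

Section Derivations.
Variables (k : fieldType) (G : graph) (b : nat -> vert G -> k).
Local Notation kG := (path_alg k G).
Local Notation kpath := (@kpath k G).
Local Notation arrow := (vert G * edge G * vert G)%type.
Local Notation e := (@pidem k G).
Local Notation arr := (@arr k G).
Local Notation theta := (theta k G).
Local Notation pi := (@pproj k G).
Implicit Types (i j l : vert G) (s t r : seq (edge G * vert G)) (u v w : kG).
Implicit Types (x y z : arrow).

(** The weight at [n - 1], extended by zero so that [A b_n = b_(n+1) + b_(n-1)]
    also holds for [n = 0]. *)
Definition bpred n : vert G -> k := if n is m.+1 then b m else fun=> 0.

Definition coefd n y : k := bpred n y.1.1 / b n y.2.

(** The derivative of the path ending (at its source) with the steps listed in
    [r], the last step first: the recursion removes arrows on the right, whereas
    paths are lists of steps read from the left. *)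
Fixpoint deriv_rev i r x : kG :=
  if r is (a, j) :: r' then
    let y := (last i (unzip2 (rev r')), a, j) in
    (y == x)%:R *' kpath i (rev r')
      - coefd (size r') y *' (deriv_rev i r' (opp_arrow y) * arr (opp_arrow x))
  else 0.

Definition deriv x u : kG :=
  lext (fun p : gpath G => deriv_rev (ptarget p) (rev (psteps p)) x) u.

Lemma derivD x : {morph deriv x : u v / u + v}.
Proof. exact: lextD. Qed.

Lemma derivZ x c : {morph deriv x : u / c *' u}.
Proof. by move=> u; rewrite !kscaleE; exact: lextZ. Qed.

Lemma deriv0 x : deriv x 0 = 0.
Proof. exact: lext0. Qed.

Lemma deriv_sum x (T : Type) (r : seq T) (P : pred T) (F : T -> kG) :
  deriv x (\sum_(a <- r | P a) F a) = \sum_(a <- r | P a) deriv x (F a).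
Proof. exact: (big_morph _ (derivD x) (deriv0 x)). Qed.

Lemma deriv_kpath x i s : walk i s -> deriv x (kpath i s) = deriv_rev i (rev s) x.
Proof. by move=> ws; rewrite (kpath_walk k ws) /deriv lextU. Qed.

Lemma deriv_idem x i : deriv x (e i) = 0.
Proof. by rewrite kpath_nil deriv_kpath. Qed.

Lemma deriv_kpath_rcons x i s a j :
  let y := (last i (unzip2 s), a, j) in
  is_arrow y ->
  deriv x (kpath i s * arr y) =
  (y == x)%:R *' kpath i s
    - coefd (size s) y *' (deriv (opp_arrow y) (kpath i s) * arr (opp_arrow x)).
Proof.
move=> y vy; have [ws|nws] := boolP (walk i s); last first.
  by rewrite kpath_nwalk // mul0r !deriv0 mul0r !kscaler0 subrr.
rewrite -kpath_rcons deriv_kpath; last by rewrite -cats1 walk_cat ws /= andbT.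
by rewrite rev_rcons /= revK size_rev -/y -deriv_kpath.
Qed.

Lemma deriv_idemr x u : deriv x u * e x.1.1 = deriv x u.
Proof.
elim/kpath_linear_ind: u => [|u1 u2 h1 h2|c u1 h1|i s ws].
- by rewrite deriv0 mul0r.
- by rewrite derivD mulrDl h1 h2.
- by rewrite derivZ kscale_mull h1.
elim/last_ind: s ws => [|s [a j] _] ws; first by rewrite deriv_idem mul0r.
rewrite kpath_rcons; set y := (_, a, j).
have vy : is_arrow y by move: ws; rewrite -cats1 walk_cat /= andbT => /andP[].
rewrite deriv_kpath_rcons // mulrBl !kscale_mull -mulrA arr_idem eqxx kpath_last.
by case: eqP => [<-|_] /=; rewrite ?eqxx // !kscale0.
Qed.

Lemma deriv_idem_neq x u l : l != x.2 -> deriv x (u * e l) = 0.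
Proof.
move=> nl; elim/kpath_linear_ind: u => [|u1 u2 h1 h2|c u1 h1|i s ws].
- by rewrite mul0r deriv0.
- by rewrite mulrDl derivD h1 h2 addr0.
- by rewrite kscale_mull derivZ h1 kscaler0.
rewrite kpath_last; case: eqP => [el|_]; last exact: deriv0.
elim/last_ind: s ws el => [|s [a j] _] ws; first by rewrite deriv_idem.
rewrite -cats1 /unzip2 map_cat last_cat /= => jl; rewrite cats1 kpath_rcons.
set y := (_, a, j).
have vy : is_arrow y by move: ws; rewrite -cats1 walk_cat /= andbT => /andP[].
rewrite deriv_kpath_rcons //; have /negPf -> : y != x.
  by apply: contraNneq nl => <-; rewrite /= jl.
rewrite -deriv_idemr -mulrA idem_arr /= jl (negPf nl) mulr0.
by rewrite kscale0 kscaler0 subrr.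
Qed.

(** The length of the path enters through the coefficient, so the recursion only
    extends to homogeneous elements. *)
Lemma deriv_mul_arr x n u y : phomog n u -> is_arrow y ->
  deriv x (u * arr y) =
  (y == x)%:R *' (u * e y.1.1)
    - coefd n y *' (deriv (opp_arrow y) u * arr (opp_arrow x)).
Proof.
move=> hu vy; elim/phomog_ind: hu => [|u1 u2 h1 h2|c u1 h1|i s ws <-].
- by rewrite !mul0r !deriv0 mul0r !kscaler0 subrr.
- rewrite !mulrDl !derivD mulrDl !kscaleDr h1 h2 opprD.
  by rewrite -!addrA; congr (_ + _); rewrite addrCA.
- rewrite !kscale_mull !derivZ kscale_mull !(kscaleA _ c) ![_ * c]mulrC -!(kscaleA c).
  by rewrite h1 kscaleBr.
have [el|nl] := eqVneq (last i (unzip2 s)) y.1.1.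
  case: y el vy => [[l a] j] /= el; rewrite -el => vy.
  by rewrite deriv_kpath_rcons // kpath_last eqxx.
have es : kpath i s = kpath i s * e (last i (unzip2 s)) by rewrite kpath_last eqxx.
rewrite {1}es -mulrA idem_arr (negPf nl) mulr0 deriv0.
rewrite {2}es deriv_idem_neq // mul0r kscaler0 kpath_last (negPf nl) kscaler0.
by rewrite subrr.
Qed.

Lemma phomog_deriv x n u : phomog n.+1 u -> phomog n (deriv x u).
Proof.
move=> hu; elim/phomog_ind: hu => [|u1 u2 h1 h2|c u1 h1|i s ws].
- by rewrite deriv0; exact: phomog0.
- by rewrite derivD; exact: phomogD.
- by rewrite derivZ; exact: phomogZ.
elim/last_ind: s n ws x => [|s [a j] IH] // n ws x; rewrite size_rcons => -[sn].
rewrite kpath_rcons; set y := (_, a, j).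
move: ws; rewrite -cats1 walk_cat => /= /and3P[ws vy _].
rewrite deriv_kpath_rcons //; apply: phomogD.
  by apply: phomogZ; exact: phomog_kpath.
apply/phomogN/phomogZ; case: n sn => [|n] sn.
  by rewrite (size0nil sn) deriv_idem mul0r; exact: phomog0.
by rewrite -addn1; apply: phomogM; [exact: IH | exact: phomog_arr].
Qed.

End Derivations.

(** * Derivations modulo the relation *)

Section Quotient.
Variables (k : fieldType) (G : graph) (b : nat -> vert G -> k).
Local Notation kG := (path_alg k G).
Local Notation kpath := (@kpath k G).
Local Notation arrow := (vert G * edge G * vert G)%type.
Local Notation e := (@pidem k G).
Local Notation arr := (@arr k G).
Local Notation theta := (theta k G).
Implicit Types (i j l : vert G) (s t r : seq (edge G * vert G)) (u v w : kG).
Implicit Types (x y z : arrow).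

(* The preprojective algebra enters only through these properties; [scal] embeds
   the scalars. *)
Variables (B : pzRingType) (pi : kG -> B) (scal : k -> B).
Hypothesis scal0 : scal 0 = 0.
Hypothesis scal1 : scal 1 = 1.
Hypothesis scalD : {morph scal : c d / c + d}.
Hypothesis scalM : {morph scal : c d / c * d}.
Hypothesis piD : {morph pi : u v / u + v}.
Hypothesis piM : {morph pi : u v / u * v}.
Hypothesis piZ : forall c u, pi (c *' u) = scal c * pi u.
Hypothesis pi_eq0P : forall u, pi u = 0 <-> u \in @theta_ideal k G.

Lemma pi0 : pi 0 = 0.
Proof. by rewrite -(kscale0 (0 : kG)) piZ scal0 mul0r. Qed.

Lemma piN u : pi (- u) = - pi u.
Proof. by apply/eqP; rewrite -addr_eq0 -piD addNr pi0. Qed.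

Lemma piB u v : pi (u - v) = pi u - pi v.
Proof. by rewrite piD piN. Qed.

Lemma pi_sum (T : Type) (r : seq T) (P : pred T) (F : T -> kG) :
  pi (\sum_(a <- r | P a) F a) = \sum_(a <- r | P a) pi (F a).
Proof. exact: (big_morph _ piD pi0). Qed.

Lemma pi_theta : pi theta = 0.
Proof.
apply/pi_eq0P/theta_idealP; exists [:: (1, 1)].
by rewrite big_seq1 mul1r mulr1.
Qed.

Lemma pi_mul_theta u v : pi (u * theta * v) = 0.
Proof. by rewrite !piM pi_theta mulr0 mul0r. Qed.

Lemma pi_hpart n u : pi u = 0 -> pi (hpart n u) = 0.
Proof. by move=> /pi_eq0P/(hpart_ideal n)/pi_eq0P. Qed.

Lemma pi_idem_theta j : \sum_(y | y.2 == j) pi (arr (opp_arrow y) * arr y) = 0.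
Proof.
rewrite -pi_sum; suff -> : \sum_(y | y.2 == j) arr (opp_arrow y) * arr y = e j * theta * 1.
  exact: pi_mul_theta.
rewrite mulr1 thetaE mulr_sumr [RHS](bigID (fun y => y.2 == j)) /= [X in _ = _ + X]big1 ?addr0.
  by apply: eq_bigr => y /eqP yj; rewrite mulrA idem_arr /= yj eqxx.
by move=> y nyj; rewrite mulrA idem_arr /= eq_sym (negPf nyj) mul0r.
Qed.

(** Euler's formula. For [u = p z] the definition gives [p z] from the first
    term, while the second one contributes [w (sum_y y' y)] with [w] the
    derivative of [p] along [z'], which the relation kills. *)
Lemma deriv_euler n u : phomog n.+1 u ->
  \sum_y pi (deriv b y u * arr y) = pi u.
Proof.
move=> hu; elim/phomog_ind: hu => [|u1 u2 h1 h2|c u1 h1|i s ws].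
- by rewrite big1 ?pi0 // => y _; rewrite deriv0 mul0r pi0.
- rewrite piD -h1 -h2 -big_split; apply: eq_bigr => y _.
  by rewrite derivD mulrDl piD.
- rewrite piZ -h1 mulr_sumr; apply: eq_bigr => y _.
  by rewrite derivZ kscale_mull piZ.
elim/last_ind: s ws => [|s [a j] _] ws // _.
rewrite kpath_rcons; set z := (_, a, j).
have vz : is_arrow z by move: ws; rewrite -cats1 walk_cat /= andbT => /andP[].
under eq_bigr => y _ do
  rewrite deriv_kpath_rcons // mulrBl !kscale_mull piB -mulrA !piZ.
rewrite sumrB (bigD1 z) //= eqxx scal1 mul1r big1 ?addr0; last first.
  by move=> y /negPf ny; rewrite eq_sym ny scal0 mul0r.
set w := deriv b _ _; rewrite -mulr_sumr.
suff -> : \sum_y pi (w * (arr (opp_arrow y) * arr y)) = 0 by rewrite mulr0 subr0.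
rewrite (bigID (fun y => y.2 == j)) /= [X in _ + X]big1 ?addr0.
  under eq_bigr => y _ do rewrite piM.
  by rewrite -mulr_sumr pi_idem_theta mulr0.
move=> y nyj; rewrite mulrA /w -deriv_idemr -mulrA -mulrA.
by rewrite [e _ * _]mulrA idem_arr /= eq_sym (negPf nyj) mul0r mulr0 pi0.
Qed.

Hypothesis b_rec : forall n j,
  \sum_(y : arrow | is_arrow y && (y.2 == j)) b n y.1.1 = b n.+1 j + bpred b n j.

(** In degree zero Euler's formula fails, but there the weight [b_(-1)] is
    zero. *)
Lemma bpred_euler n u j : phomog n u ->
  scal (bpred b n j) * \sum_(y : arrow | y.2 == j) pi (deriv b y u * arr y) =
  scal (bpred b n j) * pi (u * e j).
Proof.
case: n => [|n] hu; first by rewrite scal0 !mul0r.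
congr (_ * _); rewrite piM -(deriv_euler hu) mulr_suml.
rewrite [RHS](bigID (fun y => y.2 == j)) /= [X in _ = _ + X]big1 ?addr0.
  by apply: eq_bigr => y yj; rewrite -piM -mulrA arr_idem yj.
by move=> y nyj; rewrite -piM -mulrA arr_idem (negPf nyj) mulr0 pi0.
Qed.

Lemma arrows_into (f : arrow -> B) j :
  (forall y, ~~ is_arrow y -> f y = 0) ->
  \sum_(y | is_arrow y && (y.2 == j)) f y = \sum_(y | y.2 == j) f y.
Proof.
move=> f0; rewrite [RHS](bigID (@is_arrow G)) /= [X in _ = _ + X]big1 ?addr0.
  by apply: eq_bigl => y; rewrite andbC.
by move=> y /andP[_ /f0].
Qed.

(** For [x : i <- j], applying the recursion twice to [u y' y] and summing over
    [y], the derivative becomes [1 - sum_y c_(n+1)(y) + b_(n-1)(j) / b_(n+1)(j)]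
    times [u x']: the product [c_(n+1)(y) c_n(y')] does not depend on [y : l <-
    j], so Euler's formula applies to the last term. The factor is zero by the
    recursion of the weights. *)
Lemma deriv_theta n u x : phomog n u ->
  (forall m j, (m <= n.+1)%N -> b m j != 0) -> pi (deriv b x (u * theta)) = 0.
Proof.
move=> hu b0; rewrite thetaE mulr_sumr deriv_sum pi_sum.
pose v := u * arr (opp_arrow x).
have vanish y : y.2 != x.2 -> forall w, w * e y.2 * arr (opp_arrow x) = 0.
  by move=> ny w; rewrite -mulrA idem_arr /= (negPf ny) mulr0.
have E y : is_arrow y -> pi (deriv b x (u * (arr (opp_arrow y) * arr y))) =
    scal (y == x)%:R * pi v - (if y.2 == x.2 then
      scal (coefd b n.+1 y) * pi v
        - scal (coefd b n.+1 y * coefd b n (opp_arrow y)) *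
            (pi (deriv b y u * arr y) * pi (arr (opp_arrow x))) else 0).
  move=> vy; have hy : phomog n.+1 (u * arr (opp_arrow y)).
    by rewrite -addn1; apply: phomogM => //; exact: phomog_arr.
  rewrite mulrA (deriv_mul_arr _ _ hy) // (deriv_mul_arr _ _ hu) ?is_arrow_opp //.
  rewrite opp_arrowK eqxx kscale1 /= -mulrA arr_idem eqxx piB piZ.
  congr (_ - _); first by case: eqP => [->|_] //; rewrite scal0 !mul0r.
  rewrite mulrBl kscale_mull piZ piB piZ.
  have [ey|ny] := eqVneq y.2 x.2; last first.
    have -> : deriv b y u * arr y = deriv b y u * arr y * e y.2.
      by rewrite -mulrA arr_idem eqxx.
    by rewrite !vanish // pi0 mulr0 subrr mulr0.
  by rewrite mulrBr scalM -[_ * _ * (pi _ * _)]mulrA -piM -[u * _ * _]mulrA idem_arr /= ey eqxx.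
rewrite (bigID (@is_arrow G)) /= [X in _ + X]big1 ?addr0; last first.
  by move=> y /(arr_eq0 k) ->; rewrite !mulr0 deriv0 pi0.
under eq_bigr => y vy do rewrite (E _ vy).
rewrite sumrB -big_mkcondr sumrB.
have -> : \sum_(y | is_arrow y) scal (y == x)%:R * pi v = pi v.
  have [vx|nvx] := boolP (is_arrow x); last first.
    by rewrite {2}/v arr_eq0 ?is_arrow_opp // mulr0 pi0 big1 // => y _;
      rewrite /v arr_eq0 ?is_arrow_opp // mulr0 pi0 mulr0.
  rewrite (bigD1 x) //= eqxx scal1 mul1r big1 ?addr0 // => y /andP[_ /negPf ->].
  by rewrite scal0 mul0r.
set j := x.2; have bj m : (m <= n.+1)%N -> b m j != 0 by move/b0.
have -> : \sum_(y | is_arrow y && (y.2 == j)) scal (coefd b n.+1 y) * pi v =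
    scal (1 + bpred b n j / b n.+1 j) * pi v.
  rewrite -mulr_suml -(big_morph _ scalD scal0); congr (scal _ * _).
  rewrite (eq_bigr (fun y => b n y.1.1 / b n.+1 j)); last by move=> y /andP[_ /eqP <-].
  by rewrite -mulr_suml b_rec mulrDl divff ?bj.
have -> : \sum_(y | is_arrow y && (y.2 == j))
     scal (coefd b n.+1 y * coefd b n (opp_arrow y)) * (pi (deriv b y u * arr y) * pi (arr (opp_arrow x)))
   = scal (bpred b n j / b n.+1 j) * pi v.
  rewrite (eq_bigr (fun y => scal (b n.+1 j)^-1 *
      ((scal (bpred b n j) * pi (deriv b y u * arr y)) * pi (arr (opp_arrow x))))).
    rewrite -mulr_sumr -mulr_suml -mulr_sumr arrows_into; last first.
      by move=> y /(arr_eq0 k) ->; rewrite mulr0 pi0.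
    rewrite bpred_euler // -[_ * pi _ * _]mulrA -piM -[u * _ * _]mulrA idem_arr /= eqxx.
    by rewrite mulrA -scalM mulrC.
  move=> y /andP[_ /eqP yj]; rewrite -[scal _ * pi _ * _]mulrA [RHS]mulrA -scalM.
  congr (scal _ * _).
  by rewrite /coefd /= yj mulrC -mulrA [_^-1 * (_ * _)]mulrA mulVf ?b0 ?mul1r 1?mulrC // leqW.
by rewrite scalD scal1 mulrDl mul1r addrK subrr.
Qed.

(** Induction on the path [q] in [p theta q]: the recursion for the derivative
    removes the last arrow of [q], down to the case of [u theta]. *)
Lemma deriv_ideal n u x : phomog n u -> pi u = 0 ->
  (forall m j, (m < n)%N -> b m j != 0) -> pi (deriv b x u) = 0.
Proof.
move=> hu /pi_eq0P ui b0.
have -> : u = hpart n u by rewrite (hpart_homog _ hu) eqxx.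
move: u ui {hu}.
apply: (hpart_ideal_ind (P := fun u => pi (deriv b x u) = 0)) => [|u v hu hv|c u hu|i s j t ws wt].
- by rewrite deriv0 pi0.
- by rewrite derivD piD hu hv addr0.
- by rewrite derivZ piZ hu mulr0.
elim/last_ind: t n b0 wt x => [|t [a l] IH] n b0 wt x ln.
  rewrite -kpath_nil -mulrA -theta_idemC mulrA kpath_last.
  case: eqP => _; last by rewrite mul0r deriv0 pi0.
  apply: (@deriv_theta (size s)); first exact: phomog_kpath.
  by move=> m l lm; apply: b0; rewrite -ln addn0 addn2 ltnS.
move: wt; rewrite -cats1 walk_cat => /= /and3P[wt vy _].
rewrite cats1 kpath_rcons mulrA; set y := (_, a, l).
have ht : phomog (size s + 2 + size t) (kpath i s * theta * kpath j t).
  apply: phomogM; last exact: phomog_kpath.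
  by apply: phomogM; [exact: phomog_kpath|exact: phomog_theta].
rewrite (deriv_mul_arr _ _ ht) // piB !piZ -mulrA pi_mul_theta.
rewrite piM [pi (deriv b _ _)](IH (size s + 2 + size t)%N) // => [|m l' lm].
  by rewrite mul0r !mulr0 subrr.
by apply/b0/(leq_trans lm); rewrite -ln size_rcons leq_add2l leqnSn.
Qed.

Definition qdeg n (a : B) : Prop := exists2 u, phomog n u & a = pi u.

Lemma sum_pi_idem (a : B) : (exists u, a = pi u) -> \sum_j a * pi (e j) = a.
Proof.
move=> [u ->]; rewrite [in RHS](sum_idemr u) pi_sum.
by apply: eq_bigr => j _; rewrite piM.
Qed.

Lemma degS_decomp n (a : B) : qdeg n.+1 a ->
  exists2 v : arrow -> B, forall x, qdeg n (v x) & a = \sum_x v x * pi (arr x).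
Proof.
move=> [u hu ->]; elim/phomog_ind: hu => [|u1 u2 [v1 h1 e1] [v2 h2 e2]|c u1 [v h e1]|i s ws].
- exists (fun=> 0) => [x|]; first by exists 0; rewrite ?pi0 //; exact: phomog0.
  by rewrite pi0 big1 // => x _; rewrite mul0r.
- exists (fun x => v1 x + v2 x) => [x|].
    have [w1 hw1 ->] := h1 x; have [w2 hw2 ->] := h2 x.
    by exists (w1 + w2); [exact: phomogD | rewrite piD].
  by rewrite piD e1 e2 -big_split; apply: eq_bigr => x _; rewrite mulrDl.
- exists (fun x => scal c * v x) => [x|].
    by have [w hw ->] := h x; exists (c *' w); [exact: phomogZ | rewrite piZ].
  by rewrite piZ e1 mulr_sumr; apply: eq_bigr => x _; rewrite mulrA.
elim/last_ind: s ws => [|s [c j] _] ws //; rewrite size_rcons => -[sn].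
rewrite kpath_rcons; set z := (_, c, j).
exists (fun x => if x == z then pi (kpath i s) else 0) => [x|].
  case: eqP => _; first by exists (kpath i s) => //; exact: phomog_kpath.
  by exists 0; rewrite ?pi0 //; exact: phomog0.
rewrite piM (bigD1 z) //= eqxx big1 ?addr0 // => x /negPf ->.
by rewrite mul0r.
Qed.

Lemma deriv_mul_arr_sum n (u : arrow -> kG) x : (forall y, phomog n (u y)) ->
  is_arrow x ->
  pi (deriv b x (\sum_y u y * arr y)) = pi (u x * e x.1.1)
    - (\sum_(y | is_arrow y) scal (coefd b n y) * pi (deriv b (opp_arrow y) (u y))) * pi (arr (opp_arrow x)).
Proof.
move=> hu vx; rewrite deriv_sum pi_sum (bigID (@is_arrow G)) /= [X in _ + X]big1 ?addr0; last first.
  by move=> y /(arr_eq0 k) ->; rewrite mulr0 deriv0 pi0.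
under eq_bigr => y vy do rewrite (deriv_mul_arr _ _ (hu y)) // piB !piZ [pi (deriv b _ _ * _)]piM mulrA.
rewrite sumrB -mulr_suml (bigD1 x) //= eqxx scal1 mul1r big1 ?addr0 // => y /andP[_ /negPf ->].
by rewrite scal0 mul0r.
Qed.

(** Deriving [sum_y v_y y = 0] along [x] gives [v_x = a x'], where [a = sum_y
    c_n(y) D_(y') (v_y)] is independent of [x]. *)
Lemma mul_arr_exact n (v : arrow -> B) :
  (forall m j, (m <= n)%N -> b m j != 0) ->
  (forall x, qdeg n (v x)) -> (forall x, v x * pi (e x.1.1) = v x) ->
  (forall x, ~~ is_arrow x -> v x = 0) ->
  \sum_x v x * pi (arr x) = 0 ->
  exists2 a : B, (if n is m.+1 then qdeg m a else a = 0) &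
    forall x, v x = a * pi (arr (opp_arrow x)).
Proof.
move=> b0 hv ve v0 sv.
have /choice[u hu] x : exists w, phomog n w /\ v x = pi w by have [w] := hv x; exists w.
have hom y : phomog n (u y) by have [] := hu y.
pose U := \sum_y u y * arr y.
have hU : phomog n.+1 U.
  by apply: phomog_sum => y _; rewrite -addn1; apply: phomogM => //; exact: phomog_arr.
have U0 : pi U = 0.
  rewrite pi_sum -[RHS]sv; apply: eq_bigr => y _.
  by have [_ ->] := hu y; rewrite piM.
exists (\sum_(y | is_arrow y) scal (coefd b n y) * pi (deriv b (opp_arrow y) (u y))) => [|x].
  case: n {b0 hv hu hU U0} hom => [|m] hom.
    by rewrite big1 // => y _; rewrite /coefd /= mul0r scal0 mul0r.
  exists (\sum_(y | is_arrow y) coefd b m.+1 y *' deriv b (opp_arrow y) (u y)).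
    by apply: phomog_sum => y _; apply/phomogZ/phomog_deriv.
  by rewrite pi_sum; apply: eq_bigr => y _; rewrite piZ.
have [vx|nvx] := boolP (is_arrow x); last first.
  by rewrite v0 // arr_eq0 ?is_arrow_opp // pi0 mulr0.
have := deriv_ideal x hU U0 b0; rewrite (deriv_mul_arr_sum hom vx) => /eqP.
rewrite subr_eq0 => /eqP <-.
by rewrite piM -[LHS]ve; have [_ ->] := hu x.
Qed.

(** Deriving [a y' = 0] along [y'] gives [b_n(l) a e_j = b_(n-1)(j) D_y (a) y]
    for [y : l <- j]. Summed over [y], the left-hand side acquires the factor
    [(A b_n)(j)] and the right-hand side is [b_(n-1)(j) a e_j], by Euler's
    formula; the difference of the two factors is [b_(n+1)(j)]. *)
Lemma mul_arr_inj n (a : B) :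
  (forall m j, (m <= n)%N -> b m j != 0) -> qdeg n a ->
  (forall x, a * pi (arr x) = 0) -> forall j, scal (b n.+1 j) * (a * pi (e j)) = 0.
Proof.
move=> b0 [u hu ->] ua j.
have E y : is_arrow y && (y.2 == j) ->
    scal (b n y.1.1) * pi (u * e j) = scal (bpred b n j) * pi (deriv b y u * arr y).
  move=> /andP[vy /eqP yj].
  have hy : phomog n.+1 (u * arr (opp_arrow y)).
    by rewrite -addn1; apply: phomogM => //; exact: phomog_arr.
  have y0 : pi (u * arr (opp_arrow y)) = 0 by rewrite piM ua.
  have := deriv_ideal (opp_arrow y) hy y0 b0.
  rewrite (deriv_mul_arr _ _ hu) ?is_arrow_opp // opp_arrowK eqxx kscale1 /= yj piB piZ.
  move=> /eqP; rewrite subr_eq0 => /eqP ->; rewrite mulrA -scalM /coefd /= yj.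
  by rewrite mulrC divfK // b0.
have : scal (\sum_(y : arrow | is_arrow y && (y.2 == j)) b n y.1.1) * pi (u * e j)
     = scal (bpred b n j) * pi (u * e j).
  rewrite (big_morph _ scalD scal0) mulr_suml (eq_bigr _ E) -mulr_sumr arrows_into.
    exact: bpred_euler.
  by move=> y /(arr_eq0 k) ->; rewrite mulr0 pi0.
rewrite b_rec scalD mulrDl -[X in _ = X -> _]add0r => /addIr.
by rewrite piM.
Qed.

Lemma qdegD n (a c : B) : qdeg n a -> qdeg n c -> qdeg n (a + c).
Proof. by move=> [u hu ->] [v hv ->]; exists (u + v); [exact: phomogD|rewrite piD]. Qed.

Lemma qdeg0 n : qdeg n 0.
Proof. by exists 0; rewrite ?pi0 //; exact: phomog0. Qed.

Lemma qdegM m n (a c : B) : qdeg m a -> qdeg n c -> qdeg (m + n) (a * c).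
Proof. by move=> [u hu ->] [v hv ->]; exists (u * v); [exact: phomogM|rewrite piM]. Qed.

Lemma qdeg_idem i : qdeg 0 (pi (e i)).
Proof. by exists (e i) => //; exact: phomog_idem. Qed.

Lemma qdeg_arr x : qdeg 1 (pi (arr x)).
Proof. by exists (arr x) => //; exact: phomog_arr. Qed.

Lemma pi_idemK j : pi (e j) * pi (e j) = pi (e j).
Proof. by rewrite -piM idem_mul eqxx. Qed.

Lemma pi_arr_idem x : pi (arr x) * pi (e x.2) = pi (arr x).
Proof. by rewrite -piM arr_idem eqxx. Qed.

Lemma pi_idem_arr x : pi (e x.1.1) * pi (arr x) = pi (arr x).
Proof. by rewrite -piM idem_arr eqxx. Qed.

Lemma pi_idem_arr_neq x j : j != x.1.1 -> pi (e j) * pi (arr x) = 0.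
Proof. by move=> /negPf nj; rewrite -piM idem_arr nj pi0. Qed.

Lemma pi_arr_nonarrow x : ~~ is_arrow x -> pi (arr x) = 0.
Proof. by move=> /(arr_eq0 k) ->; rewrite pi0. Qed.

Definition qpiece i j n (a : B) :=
  exists2 y : B, qdeg n y & a = pi (e i) * y * pi (e j).

Lemma qpieceP i j n (a : B) : qpiece i j n a <->
  [/\ qdeg n a, pi (e i) * a = a & a * pi (e j) = a].
Proof.
split=> [[y hy ->]|[ha ia aj]]; last by exists a => //; rewrite ia aj.
split; first by have := qdegM (qdegM (qdeg_idem i) hy) (qdeg_idem j); rewrite addn0.
  by rewrite !mulrA pi_idemK.
by rewrite -mulrA pi_idemK.
Qed.

Lemma qpiece_arr i x n (a : B) :
  qpiece i x.1.1 n a -> qpiece i x.2 n.+1 (a * pi (arr x)).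
Proof.
move=> /qpieceP[ha ia aj]; apply/qpieceP; split.
- by rewrite -addn1; apply: qdegM => //; exact: qdeg_arr.
- by rewrite mulrA ia.
- by rewrite -mulrA pi_arr_idem.
Qed.

(** The middle term of the complex of [P_ij], as families indexed by all
    triples. *)
Definition qfamily i j n (v : arrow -> B) := forall x,
  if is_arrow x && (x.2 == j) then qpiece i x.1.1 n (v x) else v x = 0.

Lemma qpiece0 i j n : qpiece i j n 0.
Proof. by exists 0; [exact: qdeg0 | rewrite mulr0 mul0r]. Qed.

Lemma qpieceD i j n (a c : B) : qpiece i j n a -> qpiece i j n c -> qpiece i j n (a + c).
Proof.
move=> [y hy ->] [z hz ->]; exists (y + z); first exact: qdegD.
by rewrite mulrDr mulrDl.
Qed.

Lemma qfamily_sum i j n (v : arrow -> B) :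
  qfamily i j n v -> qpiece i j n.+1 (\sum_x v x * pi (arr x)).
Proof.
move=> hv; apply: big_ind; [exact: qpiece0|exact: qpieceD|move=> x _].
have := hv x; case: ifP => [/andP[_ /eqP <-]|_ ->]; first exact: qpiece_arr.
by rewrite mul0r; exact: qpiece0.
Qed.

Lemma qfamily_opp i j n (a : B) :
  qpiece i j n a -> qfamily i j n.+1 (fun x => a * pi (arr (opp_arrow x))).
Proof.
move=> ha x; case: ifP => [/andP[_ /eqP xj]|/negbT].
  by apply: (qpiece_arr (x := opp_arrow x)); rewrite /= xj.
rewrite negb_and => /orP[nx|nj]; last first.
  by have [_ _ <-] := (qpieceP i j n a).1 ha; rewrite -mulrA pi_idem_arr_neq ?mulr0 1?eq_sym.
by rewrite (pi_arr_nonarrow (x := opp_arrow x)) ?is_arrow_opp // mulr0.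
Qed.

Lemma mul_arr_complex (a : B) :
  \sum_x a * pi (arr (opp_arrow x)) * pi (arr x) = 0.
Proof.
transitivity (a * pi theta); last by rewrite pi_theta mulr0.
rewrite thetaE pi_sum mulr_sumr.
by apply: eq_bigr => x _; rewrite piM mulrA.
Qed.

Lemma qpiece_decomp i j n (a : B) : qpiece i j n.+1 a ->
  exists2 v, qfamily i j n v & a = \sum_x v x * pi (arr x).
Proof.
move=> /qpieceP[ha ia aj]; have [v hv ea] := degS_decomp ha.
exists (fun x => if is_arrow x && (x.2 == j) then pi (e i) * v x * pi (e x.1.1) else 0).
  by move=> x; case: (is_arrow x && _) => //; exists (v x).
rewrite -ia -aj ea mulr_suml mulr_sumr; apply: eq_bigr => x _.
have [vx|nx] := boolP (is_arrow x); last first.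
  by rewrite (pi_arr_nonarrow nx) !(mulr0, mul0r).
rewrite -[in LHS](pi_idem_arr x) -!mulrA -[pi (arr x) * _]piM arr_idem.
by case: eqP => _; rewrite /= ?pi0 ?mulr0 ?mul0r // !mulrA.
Qed.

Lemma qpiece_exact i j n (v : arrow -> B) :
  (forall m l, (m <= n)%N -> b m l != 0) -> qfamily i j n v ->
  \sum_x v x * pi (arr x) = 0 ->
  exists2 a : B, (if n is m.+1 then qpiece i j m a else a = 0) &
    forall x, v x = a * pi (arr (opp_arrow x)).
Proof.
move=> b0 hv sv.
have [||x nx|a ha va] := mul_arr_exact b0 _ _ _ sv.
- by move=> x; have := hv x; case: ifP => _ => [/qpieceP[]|->] //; exact: qdeg0.
- by move=> x; have := hv x; case: ifP => _ => [/qpieceP[]|->] //; rewrite mul0r.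
- by have := hv x; rewrite (negPf nx).
exists (pi (e i) * a * pi (e j)) => [|x].
  by case: n ha {hv b0} => [->|m ha]; [rewrite mulr0 mul0r|exists a].
have := hv x; case: ifP => [/andP[vx /eqP xj] /qpieceP[_ iv _]|/negbT].
  by rewrite -iv va -!mulrA -[in e j]xj (pi_idem_arr (opp_arrow x)).
rewrite negb_and => /orP[nx|nj] ->; last by rewrite -mulrA pi_idem_arr_neq ?mulr0 1?eq_sym.
by rewrite (pi_arr_nonarrow (x := opp_arrow x)) ?is_arrow_opp // mulr0.
Qed.

Lemma qpiece_inj i j n (a : B) :
  (forall c, c != 0 -> forall d : B, scal c * d = 0 -> d = 0) ->
  (forall m l, (m <= n.+1)%N -> b m l != 0) -> qpiece i j n a ->
  (forall x, a * pi (arr x) = 0) -> a = 0.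
Proof.
move=> kI b0 /qpieceP[ha _ aj] a0; rewrite -aj.
apply: (kI _ (b0 n.+1 j (leqnn _))); apply: mul_arr_inj => //.
by move=> m l lm; apply: b0; apply: leqW.
Qed.

End Quotient.

(** * Dimensions in exact sequences *)

Section DirectSum.
Variables (k : fieldType) (V : lmodType k).

Lemma has_dim_index (T : finType) (S : V -> Prop) (b : T -> V) :
  (forall t, S (b t)) ->
  (forall c : T -> k, \sum_t c t *: b t = 0 -> forall t, c t = 0) ->
  (forall x, S x -> exists c : T -> k, x = \sum_t c t *: b t) ->
  has_dim S #|T|.
Proof.
move=> Sb fb gb; exists (fun l => b (enum_val l)); split=> [l|c sc l|x /gb[c ->]].
- exact: Sb.
- rewrite -(enum_valK l); apply: (fb (fun t => c (enum_rank t))).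
  rewrite -[RHS]sc (reindex (@enum_val T T)) /=; last first.
    by exists enum_rank => ? _; rewrite ?enum_valK ?enum_rankK.
  by apply: eq_bigr => m _; rewrite enum_valK.
- exists (fun l => c (enum_val l)).
  by rewrite (reindex (@enum_val T T)) //; exists enum_rank => ? _; rewrite ?enum_valK ?enum_rankK.
Qed.

End DirectSum.

Section DirectSum2.
Variables (k : fieldType) (V : lmodType k).

Lemma has_dim0 : has_dim (fun x : V => x = 0) 0.
Proof.
exists (fun=> 0); split=> // [c _ []|x ->] //.
by exists (fun=> 0); rewrite big_ord0.
Qed.

Lemma has_dim_ffun (X : finType) (S : X -> V -> Prop) (d : X -> nat) :
  (forall x, has_dim (S x) (d x)) -> (forall x, S x 0) ->
  has_dim (fun v : {ffun X -> V} => forall x, S x (v x)) (\sum_x d x).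
Proof.
move=> hd S0; have /choice[b hb] : forall x, exists b : nat -> V,
    [/\ forall l, (l < d x)%N -> S x (b l),
        forall c : 'I_(d x) -> k, \sum_l c l *: b l = 0 -> forall l, c l = 0
      & forall v, S x v -> exists c : 'I_(d x) -> k, v = \sum_l c l *: b l].
  move=> x; have [b [Sb fb gb]] := hd x.
  exists (fun m => if insub m is Some l then b l else 0); split.
  - by move=> l lt; rewrite insubT.
  - by move=> c; under eq_bigr => l _ do rewrite valK; exact: fb.
  - move=> v /gb[c ->]; exists c.
    by under [RHS]eq_bigr => l _ do rewrite valK.
pose T : finType := {x : X & 'I_(d x)}.
have -> : (\sum_x d x)%N = #|T|.
  by rewrite card_tagged sumnE big_map big_enum; apply: eq_bigr => x _; rewrite card_ord.
have sumT (c : T -> k) x :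
    (\sum_t c t *: [ffun y => if y == tag t then b (tag t) (tagged t) else 0]) x
    = \sum_(l < d x) c (Tagged (fun x => 'I_(d x)) l) *: b x l.
  rewrite sum_ffunE.
  rewrite (eq_bigr (fun t : T => c (Tagged (fun x => 'I_(d x)) (tagged t)) *:
      (if x == tag t then b (tag t) (tagged t) else 0))); last first.
    by case=> y l _ /=; rewrite !ffunE /=.
  rewrite -(@sig_big_dep _ _ _ X (fun x => 'I_(d x)) predT (fun _ => predT)
    (fun y l => c (Tagged (fun x => 'I_(d x)) l) *: (if x == y then b y l else 0))) /=.
  rewrite (bigD1 x) //= eqxx [X in _ + X]big1 ?addr0 // => y /negPf ny.
  by rewrite big1 // => l _; rewrite eq_sym ny scaler0.
apply: (has_dim_index (b := fun t : T =>
    [ffun y => if y == tag t then b (tag t) (tagged t) else 0])).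
- move=> [x l] y; rewrite ffunE /=; case: eqP => [->|_] //.
  by have [Sb _ _] := hb x; apply: Sb.
- move=> c c0 [x l]; have [_ fb _] := hb x.
  apply: (fb (fun l => c (Tagged (fun x => 'I_(d x)) l))).
  by rewrite -sumT c0 ffunE.
move=> v Sv.
have /choice[c hc] : forall x, exists c : nat -> k, v x = \sum_(l < d x) c l *: b x l.
  move=> x; have [_ _ gb] := hb x; have [c ->] := gb _ (Sv x).
  exists (fun m => if insub m is Some l then c l else 0).
  by under [RHS]eq_bigr => l _ do rewrite valK.
exists (fun t : T => c (tag t) (tagged t)); apply/ffunP => x.
by rewrite hc sumT.
Qed.
End DirectSum2.

Section Exact.
Variables (k : fieldType) (V W Z : lmodType k).
Variables (SV : V -> Prop) (SW : W -> Prop) (SZ : Z -> Prop).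
Variables (f : {linear V -> W}) (g : {linear W -> Z}).
Hypothesis SWD : forall x y, SW x -> SW y -> SW (x + y).
Hypothesis SWZ : forall c x, SW x -> SW (c *: x).
Hypothesis SW0 : SW 0.
Hypothesis SVD : forall x y, SV x -> SV y -> SV (x + y).
Hypothesis SVZ : forall c x, SV x -> SV (c *: x).
Hypothesis SV0 : SV 0.
Hypothesis fS : forall x, SV x -> SW (f x).
Hypothesis gS : forall x, SW x -> SZ (g x).
Hypothesis f_inj : forall x, SV x -> f x = 0 -> x = 0.
Hypothesis gf : forall x, SV x -> g (f x) = 0.
Hypothesis g_ker : forall x, SW x -> g x = 0 -> exists2 y, SV y & x = f y.
Hypothesis g_surj : forall z, SZ z -> exists2 x, SW x & z = g x.

(** A basis of the middle term: the image of a basis of the left term and lifts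
    of a basis of the right term. *)
Lemma has_dim_exact p r : has_dim SV p -> has_dim SZ r -> has_dim SW (p + r).
Proof.
move=> [b [Sb fb gb]] [b' [Sb' fb' gb']].
have /choice[w hw] l : exists w, SW w /\ b' l = g w.
  by have [w] := g_surj (Sb' l); exists w.
have sumSW (c : 'I_r -> k) : SW (\sum_l c l *: w l).
  by apply: big_ind => // l _; apply: SWZ; have [] := hw l.
have sumSV (c : 'I_p -> k) : SV (\sum_l c l *: b l).
  by apply: big_ind => // l _; apply: SVZ.
have gw (c : 'I_r -> k) : g (\sum_l c l *: w l) = \sum_l c l *: b' l.
  by rewrite linear_sum; apply: eq_bigr => l _; rewrite linearZ; have [_ ->] := hw l.
have fbE (c : 'I_p -> k) : \sum_l c l *: f (b l) = f (\sum_l c l *: b l).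
  by rewrite linear_sum; apply: eq_bigr => l _; rewrite linearZ.
pose bb l := match split l with inl l => f (b l) | inr l => w l end.
have bbE (c : 'I_(p + r) -> k) : \sum_l c l *: bb l =
    f (\sum_l c (lshift r l) *: b l) + \sum_l c (rshift p l) *: w l.
  rewrite big_split_ord -fbE /bb; congr (_ + _); apply: eq_bigr => l _.
    by rewrite (unsplitK (inl l)).
  by rewrite (unsplitK (inr l)).
exists bb; split=> [l|c|x Sx].
- by rewrite /bb; case: split => m; [exact: fS | have [] := hw m].
- rewrite bbE => e.
  have c2 : forall l, c (rshift p l) = 0.
    apply: fb'; rewrite -gw; have := congr1 g e.
    by rewrite linearD gf // add0r linear0.
  have c1 : forall l, c (lshift r l) = 0.
    apply: fb; apply: f_inj => //; move: e.
    by rewrite [X in _ + X]big1 ?addr0 // => l _; rewrite c2 scale0r.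
  by move=> l; rewrite -(splitK l); case: split.
have [c2 ec2] := gb' _ (gS Sx).
have [||y Sy ey] := @g_ker (x - \sum_l c2 l *: w l).
- by apply: SWD => //; rewrite -scaleN1r; apply: SWZ.
- by rewrite linearB gw ec2 subrr.
have [c1 ec1] := gb _ Sy.
exists (fun l => match split l with inl l => c1 l | inr l => c2 l end).
rewrite bbE -[LHS](subrK (\sum_l c2 l *: w l)) ey ec1.
congr (f _ + _); apply: eq_bigr => l _.
  by rewrite (unsplitK (inl l)).
by rewrite (unsplitK (inr l)).
Qed.
End Exact.

Section PieceDims.
Variables (k : fieldType) (V : lmodType k) (X : finType).
Variables (R R' : X -> V -> V) (SV SZ : V -> Prop) (SX : X -> V -> Prop).
Hypothesis RD : forall x, {morph R x : a c / a + c}.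
Hypothesis RZ : forall x c a, R x (c *: a) = c *: R x a.
Hypothesis R'D : forall x, {morph R' x : a c / a + c}.
Hypothesis R'Z : forall x c a, R' x (c *: a) = c *: R' x a.
Hypothesis SXlin : forall x, [/\ SX x 0, forall a c, SX x a -> SX x c -> SX x (a + c)
  & forall c a, SX x a -> SX x (c *: a)].
Hypothesis SVlin : [/\ SV 0, forall a c, SV a -> SV c -> SV (a + c)
  & forall c a, SV a -> SV (c *: a)].
Hypothesis R'S : forall x a, SV a -> SX x (R' x a).
Hypothesis RS : forall v : X -> V, (forall x, SX x (v x)) -> SZ (\sum_x R x (v x)).
Hypothesis R'_inj : forall a, SV a -> (forall x, R' x a = 0) -> a = 0.
Hypothesis RR' : forall a, SV a -> \sum_x R x (R' x a) = 0.
Hypothesis R_ker : forall v : X -> V, (forall x, SX x (v x)) ->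
  \sum_x R x (v x) = 0 -> exists2 a, SV a & forall x, v x = R' x a.
Hypothesis R_surj : forall z, SZ z ->
  exists2 v : X -> V, forall x, SX x (v x) & z = \sum_x R x (v x).

Definition family_of (a : V) : {ffun X -> V} := [ffun x => R' x a].
Definition family_sum (v : {ffun X -> V}) : V := \sum_x R x (v x).

Fact family_of_linear : linear family_of.
Proof.
by move=> c a a'; apply/ffunP => x; rewrite /family_of !ffunE R'D R'Z.
Qed.
HB.instance Definition _ := GRing.isLinear.Build k V {ffun X -> V} _ family_of family_of_linear.

Fact family_sum_linear : linear family_sum.
Proof.
move=> c v v'; rewrite /family_sum scaler_sumr -big_split; apply: eq_bigr => x _.
by rewrite !ffunE RD RZ.
Qed.
HB.instance Definition _ := GRing.isLinear.Build k {ffun X -> V} V _ family_sum family_sum_linear.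

Lemma exact_family_dims (dX : X -> nat) p r :
  (forall x, has_dim (SX x) (dX x)) -> has_dim SV p -> has_dim SZ r ->
  (\sum_x dX x = p + r)%N.
Proof.
move=> hX hp hr; have [SV0 SVD SVZ] := SVlin.
have SX0 x : SX x 0 by have [] := SXlin x.
have h1 := has_dim_ffun hX SX0.
have h2 : has_dim (fun v : {ffun X -> V} => forall x, SX x (v x)) (p + r).
  apply: (@has_dim_exact _ _ _ _ SV _ SZ family_of family_sum) => //.
  - by move=> v v' hv hv' x; rewrite ffunE; have [_ D _] := SXlin x; apply: D.
  - by move=> c v hv x; rewrite ffunE; have [_ _ Z] := SXlin x; apply: Z.
  - by move=> x; rewrite ffunE.
  - by move=> a Sa x; rewrite ffunE; apply: R'S.
  - by move=> v hv; apply: RS.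
  - move=> a Sa /ffunP a0; apply: R'_inj => // x.
    by have := a0 x; rewrite !ffunE.
  - move=> a Sa; rewrite -[RHS](RR' Sa); apply: eq_bigr => x _.
    by rewrite ffunE.
  - move=> v hv /(R_ker hv)[a Sa ha]; exists a => //.
    by apply/ffunP => x; rewrite ffunE.
  - move=> z /R_surj[v hv ->]; exists (finfun v) => [x|]; first by rewrite ffunE.
    by apply: eq_bigr => x _; rewrite ffunE.
by apply/eqP; rewrite eqn_leq !(has_dim_le h1 h2, has_dim_le h2 h1).
Qed.
End PieceDims.

(** * The dimension recursion *)

Section Preprojective.
Variables (k : fieldType) (G : graph).
Local Notation P := (preproj k G).
Local Notation arrow := (vert G * edge G * vert G)%type.
Local Notation pi := (@pproj k G : path_alg k G -> P).
Implicit Types (x : arrow) (a : P).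

Definition pscalar (c : k) : P := c *: (1 : P).

Lemma pscalarE c a : pscalar c * a = c *: a.
Proof. by rewrite /pscalar -preproj_scaleAl mul1r. Qed.

Lemma pscalar0 : pscalar 0 = 0. Proof. exact: scale0r. Qed.
Lemma pscalar1 : pscalar 1 = 1. Proof. exact: scale1r. Qed.
Lemma pscalarD : {morph pscalar : c d / c + d}.
Proof. by move=> c d; exact: scalerDl. Qed.
Lemma pscalarM : {morph pscalar : c d / c * d}.
Proof. by move=> c d; rewrite pscalarE /pscalar scalerA. Qed.

Lemma pscalar_pproj c u : pi (c *' u) = pscalar c * pi u.
Proof. by rewrite pscalarE pproj_kscale. Qed.

Lemma pproj_eq0 u : pi u = 0 <-> u \in @theta_ideal k G.
Proof. by rewrite -[in X in _ = X](pproj0 k G) -pproj_eq subr0. Qed.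

Lemma pscalar_reg c : c != 0 -> forall a, pscalar c * a = 0 -> a = 0.
Proof.
move=> c0 a /(congr1 (fun z => pscalar c^-1 * z)) /=.
have e : pscalar (c^-1 * c) = 1 by rewrite (mulVf c0) pscalar1.
by rewrite mulrA -pscalarM e mul1r mulr0.
Qed.

Variable b : nat -> vert G -> k.
Hypothesis b_rec : forall n j,
  \sum_(y : arrow | is_arrow y && (y.2 == j)) b n y.1.1 = b n.+1 j + bpred b n j.

Lemma preproj_pieceE i j n a : preproj_piece i j n a <-> @qpiece k G P pi i j n a.
Proof. by []. Qed.

Lemma preproj_exact i j n (v : arrow -> P) :
  (forall m l, (m <= n)%N -> b m l != 0) -> qfamily pi i j n v ->
  \sum_x v x * pi (arr k x) = 0 ->
  exists2 a : P, (if n is m.+1 then preproj_piece i j m a else a = 0) &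
    forall x, v x = a * pi (arr k (opp_arrow x)).
Proof.
exact: (@qpiece_exact k G b P pi pscalar pscalar0 pscalar1 pscalarD pscalarM
  (@pprojD k G) (@pproj_mul k G) pscalar_pproj pproj_eq0 b_rec).
Qed.

Lemma preproj_inj i j n (a : P) :
  (forall m l, (m <= n.+1)%N -> b m l != 0) -> preproj_piece i j n a ->
  (forall x, a * pi (arr k x) = 0) -> a = 0.
Proof.
exact: (@qpiece_inj k G b P pi pscalar pscalar0 pscalar1 pscalarD pscalarM
  (@pprojD k G) (@pproj_mul k G) pscalar_pproj pproj_eq0 b_rec i j n a pscalar_reg).
Qed.

Lemma preproj_decomp i j n (a : P) : preproj_piece i j n.+1 a ->
  exists2 v : arrow -> P, qfamily pi i j n v & a = \sum_x v x * pi (arr k x).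
Proof.
exact: (@qpiece_decomp k G P pi pscalar pscalar0 (@pprojD k G) (@pproj_mul k G) pscalar_pproj).
Qed.

Lemma preproj_family_sum i j n (v : arrow -> P) :
  qfamily pi i j n v -> preproj_piece i j n.+1 (\sum_x v x * pi (arr k x)).
Proof.
exact: (@qfamily_sum k G P pi pscalar pscalar0 (@pprojD k G) (@pproj_mul k G) pscalar_pproj).
Qed.

Lemma preproj_family_opp i j n a : preproj_piece i j n a ->
  qfamily pi i j n.+1 (fun x => a * pi (arr k (opp_arrow x))).
Proof.
exact: (@qfamily_opp k G P pi pscalar pscalar0 (@pproj_mul k G) pscalar_pproj).
Qed.

Lemma preproj_complex (a : P) :
  \sum_x a * pi (arr k (opp_arrow x)) * pi (arr k x) = 0.
Proof.
exact: (@mul_arr_complex k G P pi pscalar pscalar0 (@pprojD k G) (@pproj_mul k G) pscalar_pproj pproj_eq0).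
Qed.

Definition pdim i j n := dimk (@preproj_piece k G i j n).

(** The alternating sum of dimensions in the exact complex. For [n = 0] the left
    term is zero. *)
Lemma pdim_rec i j n : (forall m l, (m <= n)%N -> b m l != 0) ->
  (\sum_(x : arrow | is_arrow x && (x.2 == j)) pdim i x.1.1 n =
   (if n is m.+1 then pdim i j m else 0) + pdim i j n.+1)%N.
Proof.
move=> b0; rewrite big_mkcond /=.
pose SX (x : arrow) (a : P) :=
  if is_arrow x && (x.2 == j) then preproj_piece i x.1.1 n a else a = 0.
pose SV (a : P) := if n is m.+1 then preproj_piece i j m a else a = 0.
apply: (@exact_family_dims k P _ (fun x a => a * pi (arr k x))
  (fun x a => a * pi (arr k (opp_arrow x))) SV (@preproj_piece k G i j n.+1) SX).
- by move=> x a c; exact: mulrDl.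
- by move=> x c a; rewrite -preproj_scaleAl.
- by move=> x a c; exact: mulrDl.
- by move=> x c a; rewrite -preproj_scaleAl.
- rewrite /SX => x; case: ifP => _; split.
  + exact: preproj_piece0.
  + by move=> a c; exact: preproj_pieceD.
  + by move=> c a; exact: preproj_pieceZ.
  + by [].
  + by move=> a c -> ->; exact: addr0.
  + by move=> c a ->; exact: scaler0.
- rewrite /SV; case: (n) => [|m]; split.
  + by [].
  + by move=> a c -> ->; exact: addr0.
  + by move=> c a ->; exact: scaler0.
  + exact: preproj_piece0.
  + by move=> a c; exact: preproj_pieceD.
  + by move=> c a; exact: preproj_pieceZ.
- rewrite /SV /SX => x a; case: (n) => [->|m ha].
    case: ifP => _; last exact: mul0r.
    by rewrite mul0r; exact: preproj_piece0.
  exact: (preproj_family_opp ha x).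
- exact: preproj_family_sum.
- rewrite /SV => a; case: n b0 {SX SV} => [|m] b0 //.
  move=> ha a0; apply: (preproj_inj b0 ha) => x.
  by rewrite -(opp_arrowK x); exact: a0.
- by move=> a _; exact: preproj_complex.
- by move=> v hv; exact: preproj_exact.
- exact: preproj_decomp.
- rewrite /SX => x; case: ifP => _; [exact: preproj_piece_has_dim|exact: has_dim0].
- rewrite /SV; case: (n) => [|m]; [exact: has_dim0|exact: preproj_piece_has_dim].
- exact: preproj_piece_has_dim.
Qed.

End Preprojective.

Section LowDegree.
Variables (k : fieldType) (G : graph).
Local Notation kG := (path_alg k G).
Local Notation P := (preproj k G).
Local Notation e := (@pidem k G).
Local Notation pi := (@pproj k G : kG -> P).
Implicit Types i j : vert G.

(** The relation has degree two. *)
Lemma hpart0_ideal (u : kG) : u \in @theta_ideal k G -> hpart 0 u = 0.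
Proof.
move: u; apply: (hpart_ideal_ind (P := fun v => v = 0)) => // [u v -> ->|c u ->|i s j t _ _].
- exact: addr0.
- exact: kscaler0.
by rewrite addn2.
Qed.

Lemma pidem_neq0 i : e i != 0.
Proof.
rewrite kpath_nil (kpath_walk k (isT : walk i [::])); apply/eqP => /malgP.
by move=> /(_ (exist _ (i, [::]) isT)) /eqP; rewrite mcoeffUU mcoeff0 oner_eq0.
Qed.

Lemma preproj_idem_neq0 i : pi (e i) != 0.
Proof.
apply/eqP => /pproj_eq0/hpart0_ideal; rewrite kpath_nil hpart_kpath /= -kpath_nil.
by apply/eqP/pidem_neq0.
Qed.

Lemma phomog0P (u : kG) : phomog 0 u -> exists c : vert G -> k, u = \sum_i c i *' e i.
Proof.
elim/phomog_ind => [|u1 u2 [c ->] [d ->]|c u1 [d ->]|i s _ /size0nil ->].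
- by exists (fun=> 0); rewrite big1 // => i _; exact: kscale0.
- exists (fun i => c i + d i); rewrite -big_split; apply: eq_bigr => i _.
  by rewrite !kscaleE scalerDl.
- exists (fun i => c * d i); rewrite (big_morph _ (kscaleDr c) (kscaler0 G c)).
  by apply: eq_bigr => i _; rewrite kscaleA.
exists (fun j => (j == i)%:R); rewrite (bigD1 i) //= eqxx kscale1 big1 ?addr0 //.
by move=> j /negPf ->; rewrite kscale0.
Qed.

Lemma idem_homog0 i j (u : kG) : phomog 0 u ->
  exists c : k, e i * u * e j = if i == j then c *' e i else 0.
Proof.
move=> /phomog0P[c ->]; exists (c i); rewrite mulr_sumr mulr_suml (bigD1 i) //=.
rewrite kscale_mulr idem_mul eqxx kscale_mull idem_mul big1 ?addr0.
  by case: eqP; rewrite ?kscaler0.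
by move=> l /negPf nl; rewrite kscale_mulr idem_mul eq_sym nl kscaler0 mul0r.
Qed.

Lemma pdim0 i j : pdim k i j 0 = (i == j).
Proof.
apply: dimkE; case: eqP => [<-|/eqP nij] /=; last first.
  apply: (eq_has_dim _ (has_dim0 P)) => a; split=> [->|[_ [u hu ->] ->]].
    exact: preproj_piece0.
  have [c] := idem_homog0 i j hu; rewrite (negPf nij) /preproj_idem -!pproj_mul => ->.
  exact: pproj0.
exists (fun=> pi (e i)); split.
- move=> _; exists 1.
    exists 1 => //; rewrite -(sum_idem k G); apply: phomog_sum => l _.
    exact: phomog_idem.
  by rewrite mulr1 /preproj_idem -pproj_mul idem_mul eqxx.
- move=> c; rewrite big_ord_recl big_ord0 => c0 l; apply/eqP; move: c0.
  apply: contraPT => c0; rewrite addr0 -pscalarE ord1.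
  move=> /(pscalar_reg _) e0; have /eqP := preproj_idem_neq0 i; apply.
  by apply: e0; rewrite -(ord1 l).
move=> _ [_ [u hu ->] ->].
have [c] := idem_homog0 i i hu; rewrite eqxx /preproj_idem -!pproj_mul => ->.
exists (fun=> c); rewrite big_ord_recl big_ord0.
by rewrite pproj_kscale addr0.
Qed.

Lemma pdim_eq0 i j n : pdim k i j n = 0%N ->
  forall a : P, preproj_piece i j n a -> a = 0.
Proof.
move=> d0 a ha; have := preproj_piece_has_dim k i j n; rewrite -/(pdim k i j n) d0.
by move=> [b [_ _ /(_ a ha)[c ->]]]; rewrite big_ord0.
Qed.

Lemma pdim_vanish n : (forall i j, pdim k i j n = 0%N) ->
  forall i j, pdim k i j n.+1 = 0%N.
Proof.
move=> d0 i j; apply: dimkE; apply: (eq_has_dim _ (has_dim0 P)) => a.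
split=> [->|/preproj_decomp[v hv ->]]; first exact: preproj_piece0.
apply: big1 => x _; have -> : v x = 0; last exact: mul0r.
by have := hv x; case: ifP => // _ /preproj_pieceE; exact: pdim_eq0.
Qed.

End LowDegree.

(** * The matrices U_n *)

Fixpoint cheb_rec m (A : 'M[int]_m) n : 'M[int]_m :=
  if n is n1.+1 then
    if n1 is n2.+1 then cheb_rec A n1 *m A - cheb_rec A n2 else A
  else 1%:M.

(** These are the Chebyshev polynomials of the second kind evaluated at [A / 2].
    Locked, because the recursion by two steps unfolds under simplification. *)
HB.lock Definition cheb m (A : 'M[int]_m) n : 'M[int]_m := cheb_rec A n.

Section Chebyshev.
Variables (m : nat) (A : 'M[int]_m).
Local Notation cheb := (cheb A).

Lemma cheb0 : cheb 0 = 1%:M. Proof. by rewrite cheb.unlock. Qed.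

Lemma cheb1 : cheb 1 = A. Proof. by rewrite cheb.unlock. Qed.

Lemma chebSS n : cheb n.+2 = cheb n.+1 *m A - cheb n.
Proof. by rewrite cheb.unlock. Qed.

Lemma cheb_step (p : nat -> Prop) : p 0%N -> p 1%N ->
  (forall n, p n -> p n.+1 -> p n.+2) -> forall n, p n.
Proof.
move=> p0 p1 pS n; suff [] : p n /\ p n.+1 by [].
by elim: n => [|n [h1 h2]] //; split; last exact: pS.
Qed.

Lemma chebC n : A *m cheb n = cheb n *m A.
Proof.
elim/cheb_step: n => [||n h1 h2]; rewrite ?cheb0 ?cheb1 ?mulmx1 ?mul1mx //.
by rewrite chebSS mulmxBr mulmxBl mulmxA h1 h2.
Qed.

Lemma cheb_tr n : A^T = A -> (cheb n)^T = cheb n.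
Proof.
move=> At; elim/cheb_step: n => [||n h1 h2]; rewrite ?cheb0 ?cheb1 ?trmx1 //.
by rewrite chebSS linearB /= trmx_mul At h1 h2 chebC.
Qed.

Lemma cheb_sqr n : cheb n.+1 *m cheb n.+1 - cheb n.+2 *m cheb n = 1%:M.
Proof.
elim: n => [|n IH]; first by rewrite chebSS cheb0 cheb1 mulmx1 opprB addrC subrK.
have e : A *m cheb n.+1 = cheb n.+2 + cheb n by rewrite chebC chebSS subrK.
rewrite [cheb n.+3]chebSS mulmxBl -mulmxA e mulmxDr -IH.
by rewrite opprB addrCA opprD [_ + (- _ - _)]addrA subrr add0r.
Qed.

Definition tseries : mseries m :=
  (smono 1%:M 0%N \- smono A 1%N) \+ smono 1%:M 2%N.

Lemma sinv_cheb : sinv tseries =1 cheb.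
Proof.
have F0 : tseries 0%N = 1%:M by rewrite /tseries /smono /= subr0 addr0.
have F1 : tseries 1%N = - A by rewrite /tseries /smono /= sub0r addr0.
have F2 : tseries 2%N = 1%:M by rewrite /tseries /smono /= subr0 add0r.
have F3 n : tseries n.+3 = 0 by rewrite /tseries /smono /= subr0 addr0.
have E := smul_sinv F0.
elim/cheb_step => [||n h1 h2].
- have := E 0%N; rewrite /smul big_ord_recl big_ord0 /= subn0 F0 mul1mx addr0.
  by move=> ->; rewrite cheb0.
- have e0 : sinv tseries 0%N = 1%:M.
    by have := E 0%N; rewrite /smul big_ord_recl big_ord0 /= subn0 F0 mul1mx addr0 => ->.
  have := E 1%N; rewrite /smul !big_ord_recl big_ord0 /= F0 F1 subnn e0 mul1mx mulmx1 addr0.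
  by rewrite /sone /smono /= => /eqP; rewrite subr_eq0 cheb1 => /eqP.
have := E n.+2; rewrite /smul !big_ord_recl big1 ?addr0; last first.
  by move=> l _; rewrite /= F3 mul0mx.
rewrite /= F0 F1 F2 !mul1mx subn0 subSS subn0 /bump /= !subSS subn0 h1 h2.
rewrite /sone /smono /= mulNmx chebC chebSS => e.
by move/eqP: e; rewrite addr_eq0 opprD opprK => /eqP.
Qed.

(** A solution of the recursion is determined by two consecutive terms, and the
    sequence starting at a zero [U_(N+1)] is [0, - U_N, ...]. *)
Lemma cheb_antiperiodic N n : cheb N.+1 = 0 ->
  cheb (N.+2 + n) = - (cheb N *m cheb n).
Proof.
move=> c0; elim/cheb_step: n => [||n h1 h2].
- by rewrite addn0 chebSS c0 mul0mx sub0r cheb0 mulmx1.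
- by rewrite addn1 chebSS c0 subr0 chebSS c0 mul0mx sub0r mulNmx cheb1.
by rewrite !addnS chebSS -addnS h1 h2 chebSS mulmxBr mulNmx mulmxA opprB opprK addrC.
Qed.

End Chebyshev.

(** * The Hilbert function and the vanishing of weights *)

Section GraphSums.
Variable G : graph.
Local Notation arrow := (vert G * edge G * vert G)%type.
Implicit Types i j l : vert G.

Lemma nedgesC i j : nedges i j = nedges j i.
Proof. by rewrite /nedges; apply: eq_card => a; rewrite !inE setUC. Qed.

Lemma sum_arrows (V : nmodType) (F : vert G -> V) j :
  \sum_(y : arrow | is_arrow y && (y.2 == j)) F y.1.1 = \sum_l F l *+ nedges l j.
Proof.
rewrite (eq_bigl (fun y : arrow => (fun la => ends la.2 == [set la.1; j]) y.1 && (y.2 == j))); last first.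
  by move=> [[l a] j'] /=; rewrite /is_arrow /=; case: (j' =P j) => [->|]; rewrite ?andbT ?andbF.
rewrite -(pair_big (fun la : vert G * edge G => ends la.2 == [set la.1; j]) (pred1 j) (fun la _ => F la.1)) /=.
under eq_bigr => la _ do rewrite big_pred1_eq.
rewrite (eq_bigl (fun la : vert G * edge G => predT la.1 && (ends la.2 == [set la.1; j]))) //.
rewrite -(pair_big_dep predT (fun l a => ends a == [set l; j]) (fun l _ => F l)) /=.
by apply: eq_bigr => l _; rewrite sumr_const /nedges cardsE.
Qed.

Lemma adjmx_tr : (adjmx G)^T = adjmx G.
Proof. by apply/matrixP => u v; rewrite !mxE nedgesC. Qed.

Lemma sum_enum_val (V : nmodType) (F : vert G -> V) :
  \sum_(u < #|vert G|) F (enum_val u) = \sum_l F l.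
Proof.
rewrite [RHS](reindex (@enum_val _ (vert G))) //=.
by exists enum_rank => ? _; rewrite ?enum_valK ?enum_rankK.
Qed.

End GraphSums.

Section Hilbert.
Variables (k : fieldType) (G : graph).
Hypothesis k0 : [pchar k] =i pred0.
Local Notation A := (adjmx G).
Local Notation U := (cheb A).
Local Notation n := #|vert G|.

(** The column sums of [U_d]: the choice of weights that are dimensions, hence
    nonnegative, as long as [U_d] is the Hilbert function. *)
Definition col_weight d : 'rV[int]_n := const_mx 1 *m U d.
Definition kweight d (j : vert G) : k := (col_weight d 0 (enum_rank j))%:~R.

Lemma kweight_rec d j :
  \sum_(y | is_arrow y && (y.2 == j)) kweight d y.1.1 = kweight d.+1 j + bpred kweight d j.
Proof.
rewrite sum_arrows.
have -> : bpred kweight d j = (if d is d'.+1 then col_weight d' 0 (enum_rank j) else 0)%:~R.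
  by case: d.
rewrite -intrD.
have -> : col_weight d.+1 0 (enum_rank j) + (if d is d'.+1 then col_weight d' 0 (enum_rank j) else 0)
   = (col_weight d *m A) 0 (enum_rank j).
  case: d => [|d]; first by rewrite addr0 /col_weight cheb0 cheb1 mulmx1.
  by rewrite /col_weight chebSS mulmxBr !mulmxA [X in X + _]mxE [X in _ + X + _]mxE subrK.
rewrite [(_ *m A) _ _]mxE rmorph_sum -sum_enum_val; apply: eq_bigr => u _.
by rewrite /kweight enum_valK [A _ _]mxE enum_rankK rmorphM /= mulr_natr.
Qed.

Lemma intr_pchar0 (z : int) : z != 0 -> z%:~R != 0 :> k.
Proof.
case: z => m m0; first by rewrite -pmulrn ((pcharf0P _).1 k0).
by rewrite NegzE mulrNz oppr_eq0 -pmulrn ((pcharf0P _).1 k0).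
Qed.

Lemma hilbert_rec d : (forall m u, (m <= d)%N -> col_weight m 0 u != 0) ->
  hilbert k G d.+1 = hilbert k G d *m A - (if d is m.+1 then hilbert k G m else 0).
Proof.
move=> w0; apply/matrixP => u v; rewrite !mxE.
have b0 m l : (m <= d)%N -> kweight m l != 0 by move=> md; apply/intr_pchar0/w0.
have := pdim_rec kweight_rec (enum_val u) (enum_val v) b0.
move=> /(congr1 Posz); rewrite PoszD (big_morph Posz PoszD (erefl _)).
rewrite (sum_arrows (fun l => (pdim k (enum_val u) l d)%:Z)) => e.
transitivity ((if d is m.+1 then pdim k (enum_val u) (enum_val v) m else 0)%N%:Z
  + (pdim k (enum_val u) (enum_val v) d.+1)%:Z - (if d is m.+1 then hilbert k G m else 0) u v).
  by rewrite addrAC; case: (d) => [|m]; rewrite mxE ?subrr ?add0r.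
rewrite -e -sum_enum_val; congr (_ - _); apply: eq_bigr => w _.
by rewrite !mxE -mulr_natr natz.
Qed.

Lemma hilbert0 : hilbert k G 0 = 1%:M.
Proof.
by apply/matrixP => u v; rewrite !mxE -/(pdim _ _ _ _) pdim0 (inj_eq enum_val_inj); case: eqP.
Qed.

Lemma hilbert_cheb d : (forall m u, (m < d)%N -> col_weight m 0 u != 0) ->
  hilbert k G d = U d.
Proof.
elim/cheb_step: d => [||d h1 h2] w0.
- by rewrite hilbert0 cheb0.
- by rewrite hilbert_rec // hilbert0 mul1mx subr0 cheb1.
have wd m u : (m < d.+1)%N -> col_weight m 0 u != 0 by move=> md; apply: w0; exact: leqW.
by rewrite hilbert_rec // chebSS h2 ?h1 // => m u md; apply: wd; exact: leqW.
Qed.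

Lemma hilbert_vanish d : hilbert k G d = 0 -> hilbert k G d.+1 = 0.
Proof.
move=> h0; apply/matrixP => u v; rewrite !mxE -/(pdim _ _ _ _) pdim_vanish // => i j.
move/matrixP/(_ (enum_rank i) (enum_rank j)): h0.
by rewrite !mxE !enum_rankK => -[].
Qed.

Lemma hilbert_ge0 d u v : 0 <= hilbert k G d u v.
Proof. by rewrite mxE. Qed.

Hypothesis Gconn : connected_graph G.

(** Since [U_N] commutes with [A], a zero column [j] makes the sum of the
    columns at the neighbours of [j] zero; being nonnegative, each of them is
    zero. Connectedness spreads this to all columns. *)
Lemma cheb_col_zero N j : (forall u v, 0 <= U N u v) -> col_weight N 0 j = 0 -> U N = 0.
Proof.
move=> U0 wj.
have colz v : col_weight N 0 v = 0 -> forall u, U N u v = 0.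
  rewrite /col_weight mxE => /eqP; under eq_bigr => u _ do rewrite mxE mul1r.
  by rewrite psumr_eq0 // => /allP h u; apply/eqP/h; rewrite mem_index_enum.
have step v w : 0 < A v w -> (forall u, U N u w = 0) -> forall u, U N u v = 0.
  move=> vw w0 u; have : (U N *m A) u w = 0.
    by rewrite -chebC mxE big1 // => x _; rewrite w0 mulr0.
  rewrite mxE => /eqP; rewrite psumr_eq0 => [/allP/(_ v)|x _]; last first.
    by rewrite mulr_ge0 // mxE.
  by rewrite mem_index_enum mulf_eq0 [A v w == 0]gt_eqF // orbF => /(_ isT)/eqP.
have path_zero p w : path [rel x y | (0 < nedges x y)%N] w p ->
    (forall u, U N u (enum_rank w) = 0) ->
    forall u, U N u (enum_rank (last w p)) = 0.
  elim: p w => [|y p IH] w //= /andP[wy py] w0; apply: (IH y py).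
  by apply: step w0; rewrite mxE !enum_rankK nedgesC.
apply/matrixP => u v; rewrite [RHS]mxE.
have /connectP[p hp lp] := Gconn.2 (enum_val j) (enum_val v).
have := path_zero p _ hp _ u; rewrite -lp !enum_valK; apply.
exact: colz.
Qed.

(** At the first zero of a weight, [U_N] is still the Hilbert function. *)
Lemma weight_dichotomy : (forall d u, col_weight d 0 u != 0) \/
  exists2 N, U N = 0 & forall m u, (m < N)%N -> col_weight m 0 u != 0.
Proof.
have [[d [u wu]]|nw] := pselect (exists d u, col_weight d 0 u = 0); last first.
  by left=> d u; apply/eqP => w0; apply: nw; exists d, u.
right; have ex : exists d, [exists u, col_weight d 0 u == 0].
  by exists d; apply/existsP; exists u; rewrite wu.
case: (ex_minnP ex) => N /existsP[v /eqP wv] minN.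
have w0 m w : (m < N)%N -> col_weight m 0 w != 0.
  by apply: contraTneq => ww; rewrite -leqNgt; apply: minN; apply/existsP; exists w; rewrite ww.
exists N => //; apply: (@cheb_col_zero N v) => // x y.
by rewrite -hilbert_cheb ?hilbert_ge0.
Qed.

End Hilbert.

(** * Graphs without a subadditive function *)

Ltac line_arith :=
  rewrite /=; repeat (match goal with
    |- context [if ?b then _ else _] => let E := fresh in case E : b
  end); lia.

Section Classification.
Local Open Scope nat_scope.
Variable G : graph.
Local Notation vert := (vert G).
Implicit Types (x y v w : vert) (d : vert -> nat) (L s : seq vert).

(** [A d >= 2 d] for a nonzero [d >= 0]; for instance the null root of an affine
    Dynkin diagram contained in the graph, extended by zero. *)
Definition subadditive d : Prop :=
  (exists x, 0 < d x) /\ forall x, 2 * d x <= \sum_y nedges x y * d y.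

Definition adj : rel vert := [rel x y | 0 < nedges x y].

Lemma adjC x y : adj x y = adj y x.
Proof. by rewrite /adj /= nedgesC. Qed.

Lemma sum_nbrs d x s : uniq s -> all (adj x) s ->
  \sum_(y <- s) d y <= \sum_y nedges x y * d y.
Proof.
move=> us /allP hs; rewrite big_uniq // [X in _ <= X](bigID (mem s)) /=.
apply: leq_trans (leq_addr _ _); apply: leq_sum => y ys.
by rewrite leq_pmull //; apply: hs.
Qed.

Lemma subadditive_nbrs d : (exists x, 0 < d x) ->
  (forall x, 0 < d x -> exists s,
    [/\ uniq s, all (adj x) s & 2 * d x <= \sum_(y <- s) d y]) ->
  subadditive d.
Proof.
move=> d0 hd; split=> // x; have [/hd[s [us hs hx]]|] := ltnP 0 (d x).
  exact: leq_trans hx (sum_nbrs d us hs).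
by rewrite leqn0 => /eqP ->.
Qed.

Lemma has_adet_type_seq X L x0 : adet_valid X -> uniq L -> (forall x, x \in L) ->
  size L = adet_rank X ->
  (forall i j, i < size L -> j < size L -> nedges (nth x0 L i) (nth x0 L j) = adet_adj X i j) ->
  has_adet_type G X.
Proof.
move=> vX uL aL sL hL; split=> //; exists (fun i : 'I_(adet_rank X) => nth x0 L i).
  apply: inj_card_bij => [i j /eqP|]; last first.
    by rewrite card_ord -sL -(card_uniqP uL) subset_leq_card //; apply/subsetP => x _; exact: aL.
  by rewrite nth_uniq ?sL // => /eqP; exact: val_inj.
by move=> i j; rewrite hL ?sL.
Qed.

Hypothesis nosub : forall d, ~ subadditive d.

Lemma nedges_le1 x y : nedges x y <= 1.
Proof.
rewrite leqNgt; apply/negP => e2; apply: (nosub (d := fun z => (z == x) || (z == y))).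
split=> [|z]; first by exists x; rewrite eqxx.
have [->|zx] := eqVneq z x; first by rewrite (bigD1 y) //= eqxx orbT muln1 muln1 ltn_addr.
have [->|//] := eqVneq z y.
by rewrite (bigD1 x) //= eqxx muln1 nedgesC muln1 ltn_addr.
Qed.

Lemma nedgesE x y : nedges x y = adj x y.
Proof. by have := nedges_le1 x y; rewrite /adj /=; case: (nedges x y) => [|[|]]. Qed.

(** The function equal to one on a cycle of length at least three is
    subadditive. *)
Lemma cycle_short c : uniq c -> cycle adj c -> size c <= 2.
Proof.
move=> uc cc; rewrite leqNgt; apply/negP => c3.
apply: (nosub (d := fun z => z \in c)); apply: subadditive_nbrs.
  by case: c c3 {uc cc} => // x c _; exists x; rewrite mem_head.
move=> x; rewrite lt0b => xc; rewrite xc.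
have [i p ec] := rot_to xc.
have up : uniq (x :: p) by rewrite -ec rot_uniq.
have sp : 2 <= size p by have := size_rot i c; rewrite ec /= => e; rewrite -ltnS e.
have mp z : z \in p -> z \in c by move=> zp; rewrite -(mem_rot i) ec inE zp orbT.
have cp : cycle adj (x :: p) by rewrite -ec rot_cycle.
case: p sp up mp cp {ec} => // y p sp up mp cp.
have lp : last y p \in p by case: p sp {up mp cp} => // z p _; rewrite /= mem_last.
exists [:: y; last y p]; split.
- rewrite /= andbT inE; apply: contraTneq up => ey.
  have yp : y \in p by have := lp; rewrite -ey.
  by rewrite /= yp andbF.
- move: cp; rewrite /cycle rcons_path => /andP[/= /andP[-> _]].
  by rewrite /= andbT adjC.
by rewrite !big_cons big_nil mp ?mem_head // mp // inE lp orbT.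
Qed.

(** A vertex of the line [L] has its neighbours on the line, so only further
    neighbours [s] have to be supplied to check subadditivity. *)
Lemma line_check L x0 d : uniq L -> sorted adj L -> (exists x, 0 < d x) ->
  (forall x, x \notin L -> 0 < d x -> exists s,
    [/\ uniq s, all (adj x) s & 2 * d x <= \sum_(y <- s) d y]) ->
  (forall i, i < size L -> exists s,
    [/\ uniq s, all (adj (nth x0 L i)) s,
       forall j, j < size L -> line_adj i j -> nth x0 L j \notin s
     & 2 * d (nth x0 L i) <= (if i is i'.+1 then d (nth x0 L i') else 0)
         + (if i.+1 < size L then d (nth x0 L i.+1) else 0) + \sum_(y <- s) d y]) ->
  False.
Proof.
move=> uL sL d0 hX hL; apply: (nosub (d := d)); apply: subadditive_nbrs => // x dx.
have [xL|/hX] := boolP (x \in L); last exact.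
have iL : index x L < size L by rewrite index_mem.
have step i : i.+1 < size L -> adj (nth x0 L i) (nth x0 L i.+1).
  by move/sortedP: sL; apply.
have [s [us hs ns]] := hL _ iL; rewrite nth_index // => le2.
move: (index x L) iL (nth_index x0 xL) le2 ns hs => i iL ei le2 ns hs; subst x.
pose s1 := if i is i'.+1 then [:: nth x0 L i'] else [::].
pose s2 := if i.+1 < size L then [:: nth x0 L i.+1] else [::].
exists (s1 ++ s2 ++ s); split; last first.
- rewrite !big_cat /= addnA; apply: leq_trans le2 _; rewrite leq_add2r leq_add //.
    by rewrite /s1; case: (i) => [|i'] //; rewrite big_seq1.
  by rewrite /s2; case: ifP => //; rewrite big_seq1.
- rewrite !all_cat hs andbT; apply/andP; split.
    by rewrite /s1; case: i iL {le2 ns s2 hs s1 dx xL} => [|i'] //= iL; rewrite adjC andbT; exact: step.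
  by rewrite /s2; case: ifP => //= lt; rewrite andbT; exact: step.
rewrite !cat_uniq us !andbT.
have u2 : uniq s2 by rewrite /s2; case: ifP.
have n2 : ~~ has (mem s2) s.
  rewrite /s2; case: ifP => [lt|_]; last by rewrite has_pred0.
  by rewrite has_sym /= orbF; apply: ns; rewrite // /line_adj eqxx.
rewrite u2 n2 /s1; case: i iL ns {le2 s1 hs xL dx u2 n2} @s2 => [|i'] iL ns s2 /=.
  by rewrite has_pred0.
rewrite has_sym /= orbF mem_cat negb_or ns ?andbT //; last 2 first.
- exact: ltnW.
- by rewrite /line_adj eqxx orbT.
rewrite /s2; case: ifP => // lt; rewrite inE nth_uniq //; last exact: ltnW.
by rewrite neq_ltn ltnS leqnSn.
Qed.

(** The subgraphs met below consist of a line [L], with weights [W], and of at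
    most two further vertices [X], with weights [c]; loops are allowed on the
    line. *)
Lemma line_ext L X x0 (W : nat -> nat) (c : vert -> nat) :
  uniq (L ++ X) -> sorted adj L -> (exists2 i, i < size L & 0 < W i) ->
  (forall x, x \in X -> 2 * c x <= \sum_(y <- X | adj x y) c y \/
    exists b, [/\ b < size L, adj x (nth x0 L b)
      & 2 * c x <= W b + \sum_(y <- X | adj x y) c y]) ->
  (forall i, i < size L ->
     2 * W i <= (if i is i'.+1 then W i' else 0) + (if i.+1 < size L then W i.+1 else 0)
       + ((if adj (nth x0 L i) (nth x0 L i) then W i else 0)
       + \sum_(x <- X | adj (nth x0 L i) x) c x)) ->
  False.
Proof.
rewrite cat_uniq => /and3P[uL LX uX] sL [i0 li0 wi0] hX hL.
pose d x := if x \in L then W (index x L) else if x \in X then c x else 0.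
have XL x : x \in X -> x \notin L.
  by move=> xX; apply: contra LX => xL; apply/hasP; exists x.
have dL i : i < size L -> d (nth x0 L i) = W i.
  by move=> li; rewrite /d mem_nth // index_uniq.
have dX P : \sum_(y <- [seq y <- X | P y]) d y = \sum_(y <- X | P y) c y.
  rewrite big_filter big_seq_cond [RHS]big_seq_cond; apply: eq_bigr => y /andP[yX _].
  by rewrite /d (negPf (XL _ yX)) yX.
have nX P x : x \in L -> x \notin [seq y <- X | P y].
  by move=> xL; rewrite mem_filter negb_and orbC; apply/orP; left; apply/negP => /XL/negP.
apply: (@line_check L x0 d) => //.
- by exists (nth x0 L i0); rewrite dL.
- move=> x nxL; rewrite {1 2}/d (negPf nxL); case: ifP => // xX _.
  have [le2|[b [lb ab le2]]] := hX x xX.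
    exists [seq y <- X | adj x y]; rewrite filter_uniq // filter_all; split=> //.
    by rewrite (dX (adj x)).
  exists (nth x0 L b :: [seq y <- X | adj x y]); split.
  - by rewrite /= (nX (adj x)) ?mem_nth //= filter_uniq.
  - by rewrite /= filter_all andbT.
  by rewrite big_cons (dX (adj x)) dL.
move=> i li; set x := nth x0 L i.
have xL : x \in L by rewrite mem_nth.
exists ((if adj x x then [:: x] else [::]) ++ [seq y <- X | adj x y]); split.
- rewrite cat_uniq filter_uniq // andbT; case: ifP => _ /=; last by rewrite has_pred0.
  by rewrite has_sym /= orbF (nX (adj x)).
- by rewrite all_cat filter_all andbT; case: ifP => //= ->.
- move=> j lj ij; rewrite mem_cat negb_or (nX (adj x)) ?mem_nth // andbT.
  case: ifP => // _; rewrite inE nth_uniq //.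
  by move: ij; rewrite /line_adj; lia.
have dx : d x = W i := dL i li.
rewrite big_cat /= (dX (adj x)) dx; apply: leq_trans (hL i li) _.
rewrite -/x; apply: leq_add; last first.
  by rewrite leq_add2r; case: ifP => // _; rewrite big_seq1 dx.
apply: leq_add; last by case: ifP => // l1; rewrite dL.
by case: i li {x xL dx} => [|i'] li //; rewrite dL // ltnW.
Qed.

Lemma segment L x0 i j : uniq L -> sorted adj L -> i <= j -> j < size L ->
  exists p, [/\ uniq (nth x0 L i :: p), {subset nth x0 L i :: p <= L},
    path adj (nth x0 L i) p, last (nth x0 L i) p = nth x0 L j & size p = j - i].
Proof.
move=> uL sL ij lj; have li : i < size L by exact: leq_ltn_trans lj.
have E : take (j - i).+1 (drop i L) = nth x0 L i :: take (j - i) (drop i.+1 L).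
  by rewrite (drop_nth x0 li).
exists (take (j - i) (drop i.+1 L)); rewrite -E; split.
- by rewrite take_uniq // drop_uniq.
- by move=> x /mem_take/mem_drop.
- have : sorted adj (take (j - i).+1 (drop i L)).
    apply: take_sorted; apply: drop_sorted; exact: sL.
  by rewrite E.
- have -> : last (nth x0 L i) (take (j - i) (drop i.+1 L)) =
      last (nth x0 L i) (take (j - i).+1 (drop i L)) by rewrite E.
  rewrite (last_nth x0) size_takel ?size_drop; last by lia.
  by rewrite /= nth_take // nth_drop subnKC.
by rewrite size_takel // size_drop; lia.
Qed.

Lemma no_chord L x0 i j : uniq L -> sorted adj L -> i.+1 < j -> j < size L ->
  ~~ adj (nth x0 L i) (nth x0 L j).
Proof.
move=> uL sL ij lj; apply/negP => a.
have [p [up _ pp lp sp]] := segment x0 uL sL (ltnW (ltnW ij)) lj.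
have := cycle_short up; rewrite /cycle rcons_path pp lp adjC a /= sp => /(_ isT).
by lia.
Qed.

Lemma line_adjE L x0 i j : uniq L -> sorted adj L -> i < size L -> j < size L ->
  i != j -> adj (nth x0 L i) (nth x0 L j) = line_adj i j.
Proof.
move=> uL sL; wlog ij : i j / i < j => [hw li lj ne|].
  have [/hw|ji|e] := ltngtP i j; [exact| |by rewrite e eqxx in ne].
  by rewrite adjC hw // 1?eq_sym // /line_adj orbC.
move=> li lj _; rewrite /line_adj [j.+1 == i]gtn_eqF ?orbF 1?ltnW //.
have [e|ne] := eqVneq i.+1 j; first by subst j; move/sortedP: sL; apply.
by apply/negbTE/no_chord => //; rewrite ltn_neqAle ne.
Qed.

Lemma attached_once L x0 v i j : uniq L -> sorted adj L -> v \notin L ->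
  i < size L -> j < size L -> adj v (nth x0 L i) -> adj v (nth x0 L j) -> i = j.
Proof.
move=> uL sL vL; wlog ij : i j / i < j => [hw li lj ai aj|].
  by have [ij|ji|//] := ltngtP i j; [exact: hw|symmetry; exact: hw].
move=> li lj ai aj.
have [p [up Lp pp lp sp]] := segment x0 uL sL (ltnW ij) lj.
have := @cycle_short (v :: nth x0 L i :: p).
rewrite /cycle cons_uniq up (contra (Lp v) vL) /= rcons_path ai pp lp adjC aj sp.
by move=> /(_ isT isT); lia.
Qed.

Hypothesis Gconn : connected_graph G.

Lemma boundary L x : x \in L -> (forall y, y \in L) \/
  exists y v, [/\ y \in L, v \notin L & adj y v].
Proof.
move=> xL; have [h|nh] := pselect (exists y v, [/\ y \in L, v \notin L & adj y v]).
  by right.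
left=> y; have /connectP[p hp ->] := Gconn.2 x y.
elim: p x xL hp => [|z p IH] x xL //= /andP[xz hp]; apply: (IH z) => //.
by apply: contrapT => /negP zL; apply: nh; exists x, z.
Qed.

Lemma longest (Q : seq vert -> Prop) L0 : Q L0 -> (forall L, Q L -> uniq L) ->
  exists2 L, Q L & forall L', Q L' -> size L' <= size L.
Proof.
move=> Q0 Qu; pose P n := `[< exists2 L, Q L & size L = n >].
have exP : exists n, P n by exists (size L0); apply/asboolP; exists L0.
have ubP n : P n -> n <= #|vert|.
  by move=> /asboolP[L /Qu uL <-]; rewrite -(card_uniqP uL) max_card.
case: (ex_maxnP exP ubP) => n /asboolP[L QL <-] maxn; exists L => // L' QL'.
by apply: maxn; apply/asboolP; exists L'.
Qed.

Lemma sorted_rcons L x0 v : sorted adj L ->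
  (0 < size L -> adj (nth x0 L (size L).-1) v) -> sorted adj (rcons L v).
Proof.
case: L => // x p /= sp a; rewrite rcons_path sp -[last x p](nth_last x0 (x :: p)).
exact: a.
Qed.

(** A path [L] of maximal length starting at the loop [u]. A vertex [v] outside
    [L] is joined to [L] before its end, which gives a subadditive function
    equal to 2 between the loop and the branching point, and to 1 at the two
    vertices beyond. A second loop gives a function equal to 1 between the
    loops. So the graph is the line [L] with a loop at one end. *)
Lemma classify_loop u : adj u u -> exists X, has_adet_type G X.
Proof.
move=> uu; have [||L [q [eL uL sL]] maxL] := @longest
    (fun L => exists q, [/\ L = u :: q, uniq L & sorted adj L]) [:: u].
- by exists [::].
- by move=> L [q []].
have L0 : nth u L 0 = u by rewrite eL.
have lL : 0 < size L by rewrite eL.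
have uinL : u \in L by rewrite eL mem_head.
have [aL|[y [v [yL vL yv]]]] := boundary uinL; last first.
  exfalso; pose b := index y L; have lb : b < size L by rewrite index_mem.
  have nb : nth u L b = y by rewrite nth_index.
  have lb1 : b.+1 < size L.
    rewrite ltn_neqAle lb andbT; apply/negP => /eqP eb.
    suff /maxL : exists q, [/\ rcons L v = u :: q, uniq (rcons L v) & sorted adj (rcons L v)].
      by rewrite size_rcons ltnn.
    exists (rcons q v); split; first by rewrite eL.
      by rewrite rcons_uniq vL.
    by apply: (@sorted_rcons L u) => // _; rewrite -eb nb.
  apply: (@line_ext L [:: v] u (fun i => if i <= b then 2 else i == b.+1) (fun=> 1)) => //.
  - by rewrite cat_uniq uL /= orbF vL.
  - by exists 0.
  - move=> x; rewrite inE => /eqP ->; right; exists b; rewrite nb; split=> //; first by rewrite adjC.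
    by rewrite leqnn leq_addr.
  move=> i li; rewrite big_cons big_nil.
  have a0 : (i == 0) ==> adj (nth u L i) (nth u L i).
    by apply/implyP => /eqP ->; rewrite L0.
  have ab : (i == b) ==> adj (nth u L i) v by apply/implyP => /eqP ->; rewrite nb.
  move: (adj _ v) (adj _ _) a0 ab => av ai; clear -li lb1.
  by case: i li => [|i] li; line_arith.
exists (typeT (size L)); apply: (@has_adet_type_seq _ L u) => // i j li lj.
rewrite nedgesE /adet_adj; have [<-|ne] := eqVneq i j; last first.
  by rewrite line_adjE //; clear -ne; lia.
have -> : line_adj i i = false by rewrite /line_adj; clear; lia.
rewrite andbb orFb.
have [->|i0] := posnP i; first by rewrite L0 uu.
rewrite [adj _ _](_ : _ = false) //; apply/negP => ii.
apply: (@line_ext L [::] u (fun k => k <= i) (fun=> 0)) => //.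
- by rewrite cats0.
- by exists 0.
move=> l ll; rewrite big_nil.
have a0 : (l == 0) ==> adj (nth u L l) (nth u L l).
  by apply/implyP => /eqP ->; rewrite L0.
have ai : (l == i) ==> adj (nth u L l) (nth u L l) by apply/implyP => /eqP ->.
move: (adj _ _) a0 ai => al; clear -ll li i0.
by case: l ll => [|l] ll; line_arith.
Qed.

Hypothesis noloop : forall x, ~~ adj x x.

Lemma line_adjE_noloop L x0 i j : uniq L -> sorted adj L -> i < size L -> j < size L ->
  adj (nth x0 L i) (nth x0 L j) = line_adj i j.
Proof.
move=> uL sL li lj; have [<-|] := eqVneq i j; last exact: line_adjE.
by rewrite (negPf (noloop _)) /line_adj; clear; lia.
Qed.

Lemma branch_adjE L v b i j : uniq (rcons L v) -> sorted adj L -> b < size L ->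
  adj v (nth v L b) -> i < (size L).+1 -> j < (size L).+1 ->
  nedges (nth v (rcons L v) i) (nth v (rcons L v) j) = branch_adj (size L) b i j.
Proof.
rewrite rcons_uniq => /andP[vL uL] sL lb ab.
have av l : l < size L -> adj v (nth v L l) = (l == b).
  move=> ll; apply/idP/eqP => [al|->] //.
  exact: (attached_once uL sL vL ll lb al ab).
rewrite !ltnS (leq_eqVlt i) (leq_eqVlt j) nedgesE !nth_rcons /branch_adj.
move=> /orP[/eqP ->|li] /orP[/eqP ->|lj]; rewrite ?ltnn ?eqxx ?li ?lj ?andbF /=.
- by rewrite (negPf (noloop v)) (gtn_eqF lb).
- by rewrite av // (ltn_eqF lj) andbF orbF.
- by rewrite adjC av // (ltn_eqF li) andbT.
by rewrite line_adjE_noloop // (ltn_eqF li) (ltn_eqF lj) andbF !orbF.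
Qed.

(** The line [L] with a vertex [v] attached to its vertex [b]: type D if [b] is
    next to the end. Otherwise, up to reversing the line, [b] is in the first
    half; [b >= 3] contains the affine E7, and [b = 2] leaves E6, E7, E8 or
    contains the affine E8. *)
Lemma classify_branch_core L v b : uniq (rcons L v) -> sorted adj L ->
  (forall x, x \in rcons L v) -> 0 < b -> b.+1 < size L -> adj v (nth v L b) ->
  (b.+2 == size L) || (1 < b) && (b.*2 < size L) -> exists X, has_adet_type G X.
Proof.
move=> uLv sL aL b0 lb ab.
have Ht X : adet_valid X -> adet_rank X = (size L).+1 ->
    adet_adj X =2 branch_adj (size L) b -> has_adet_type G X.
  move=> vX rX eX; apply: (@has_adet_type_seq X (rcons L v) v) => //.
    by rewrite size_rcons rX.
  by move=> i j; rewrite size_rcons => li lj; rewrite (@branch_adjE _ _ b) ?eX // ltnW.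
have uX : uniq (L ++ [:: v]) by rewrite cats1.
have abi i : (i == b) ==> adj (nth v L i) v by apply/implyP => /eqP ->; rewrite adjC.
have nosubW W c : 0 < W b -> 2 * c <= W b ->
    (forall i, i < size L -> 2 * W i <= (if i is i'.+1 then W i' else 0) +
       (if i.+1 < size L then W i.+1 else 0) + (i == b) * c) -> False.
  move=> wb cb hi; apply: (@line_ext L [:: v] v W (fun=> c)) => //.
  - by exists b => //; exact: ltnW.
  - move=> x; rewrite inE => /eqP ->; right; exists b; split=> //; first exact: ltnW.
    exact: leq_trans cb (leq_addr _ _).
  move=> i li; apply: leq_trans (hi i li) _; rewrite leq_add2l.
  rewrite (negPf (noloop _)) big_cons big_nil addn0 add0n.
  by have := abi i; case: (i == b) => //= ->; rewrite mul1n.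
case/orP => [/eqP eb|/andP[b1 b2]].
  exists (typeD (size L).+1); apply: Ht => //=.
    by clear -eb b0; lia.
  by move=> x y; rewrite /adet_adj /= (_ : _ - 3 = b) //; clear -eb; lia.
have [b3|] := ltnP 2 b.
  (* Affine E7 with centre [L_b]. *)
  exfalso; apply: (nosubW (fun i => 4 - (i - b) - (b - i)) 2).
  - by rewrite subnn.
  - by rewrite subnn.
  clear -b2 b3; case=> [|i] li; line_arith.
rewrite leq_eqVlt ltnS [b <= 1]leqNgt b1 orbF => /eqP eb; subst b.
have [l8|l8] := leqP 8 (size L).
  (* Affine E8, whose longest arm has five vertices. *)
  exfalso; apply: (nosubW (fun i => if i <= 2 then i.+1.*2 else 8 - i) 3) => //.
  clear -l8; case=> [|i] li; line_arith.
have : [|| size L == 5, size L == 6 | size L == 7] by clear -b2 l8; lia.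
by case/or3P => /eqP el; [exists typeE6|exists typeE7|exists typeE8]; apply: Ht; rewrite // el.
Qed.

Lemma classify_branch L v b : uniq (rcons L v) -> sorted adj L ->
  (forall x, x \in rcons L v) -> 0 < b -> b.+1 < size L -> adj v (nth v L b) ->
  exists X, has_adet_type G X.
Proof.
move=> uLv sL aL b0 lb ab.
have [h|nh] := boolP ((b.+2 == size L) || (1 < b) && (b.*2 < size L)).
  exact: classify_branch_core uLv sL aL b0 lb ab h.
have := @classify_branch_core (rev L) v (size L - b.+1); rewrite size_rev.
apply; last by clear -nh b0 lb; lia.
- by move: uLv; rewrite !rcons_uniq rev_uniq mem_rev.
- by rewrite rev_sorted (eq_sorted (e' := adj)) // => x y; rewrite /= adjC.
- by move=> x; have := aL x; rewrite !mem_rcons !inE mem_rev.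
- by clear -lb; lia.
- by clear -lb b0; lia.
rewrite nth_rev; last by clear -lb; lia.
by rewrite (_ : size L - _ = b) //; clear -lb; lia.
Qed.

(** A path [L] of maximal length. If it misses a vertex, some [v] outside [L] is
    joined to an inner vertex of [L]. A further vertex [w] would give a
    subadditive function: if it is joined to [v], maximality of [L] leaves room
    for the affine E6, and if it is joined to [L], one gets an affine D. So only
    [L] and [v] remain. *)
Lemma classify_noloop : exists X, has_adet_type G X.
Proof.
have [x0 _] : exists x0, x0 \in vert by apply/card_gt0P; exact: Gconn.1.
have [||L [uL sL] maxL] := @longest (fun L => uniq L /\ sorted adj L) [:: x0] => //.
  by move=> L [].
have lL : 0 < size L by apply: (maxL [:: x0]).
have head_max v : v \notin L -> ~~ adj v (nth x0 L 0).
  move=> vL; apply/negP => av; suff /maxL : uniq (v :: L) /\ sorted adj (v :: L).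
    by rewrite /= ltnn.
  by rewrite /= vL uL; split=> //; case: (L) sL av => //= ? ? -> ->.
have last_max v : v \notin L -> ~~ adj v (nth x0 L (size L).-1).
  move=> vL; apply/negP => av; suff /maxL : uniq (rcons L v) /\ sorted adj (rcons L v).
    by rewrite size_rcons ltnn.
  by rewrite rcons_uniq vL uL; split=> //; apply: (@sorted_rcons L x0) => // _; rewrite adjC.
have inner y v : y \in L -> v \notin L -> adj y v ->
    [/\ 0 < index y L, (index y L).+1 < size L & adj v (nth x0 L (index y L))].
  move=> yL vL yv; have nb := nth_index x0 yL.
  have lb : index y L < size L by rewrite index_mem.
  split; last by rewrite nb adjC.
    by rewrite lt0n; apply: contraNneq (head_max v vL) => e; rewrite -e nb adjC.
  rewrite ltn_neqAle lb andbT; apply: contraNneq (last_max v vL) => e.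
  by rewrite -e nb adjC.
have [aL|[y [v [yL vL yv]]]] := boundary (mem_nth x0 lL).
  exists (typeA (size L)); apply: (@has_adet_type_seq _ L x0) => // i j li lj.
  by rewrite nedgesE line_adjE_noloop.
have [b0 lb ab] := inner y v yL vL yv; move: (index y L) b0 lb ab => b b0 lb ab {y yL yv}.
have uLv : uniq (rcons L v) by rewrite rcons_uniq vL.
have vLv : v \in rcons L v by rewrite mem_rcons mem_head.
have [aL|[y [w [yLv wLv yw]]]] := boundary vLv.
  apply: (@classify_branch L v b) => //.
  by rewrite (set_nth_default x0) // ltnW.
exfalso; move: wLv; rewrite mem_rcons inE negb_or => /andP[wv wL].
have uX : uniq (L ++ [:: v; w]).
  by rewrite cat_uniq uL /= !orbF negb_or vL wL inE eq_sym wv.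
have abi i : (i == b) ==> adj (nth x0 L i) v by apply/implyP => /eqP ->; rewrite adjC.
move: yLv; rewrite mem_rcons inE => /orP[/eqP yv|yL].
  subst y; have b1 : 1 < b.
    (* The path [w], [v], [L_b], [L_(b+1)], ... is not longer than [L]. *)
    have ub : uniq (w :: v :: drop b L).
      rewrite /= inE negb_or wv drop_uniq // (contra (@mem_drop _ _ _ _)) //.
      by rewrite (contra (@mem_drop _ _ _ _)).
    have : sorted adj (w :: v :: drop b L).
      have := drop_sorted b sL; rewrite (drop_nth x0 (ltnW lb)) /= => ->.
      by rewrite ab adjC yw.
    move=> sb; have /maxL : uniq (w :: v :: drop b L) /\ sorted adj (w :: v :: drop b L) by [].
    by rewrite /= size_drop; clear -lb; lia.
  have b2 : b.+2 < size L.
    (* The path [L_0], ..., [L_b], [v], [w] is not longer than [L]. *)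
    have tb x : x \notin L -> x \notin take b.+1 L by apply: contra; exact: mem_take.
    have ub : uniq (rcons (rcons (take b.+1 L) v) w).
      by rewrite !rcons_uniq take_uniq // mem_rcons inE negb_or wv !tb.
    have sb : sorted adj (rcons (rcons (take b.+1 L) v) w).
      apply: (@sorted_rcons _ x0) => [|_].
        apply: (@sorted_rcons _ x0) => [|_]; first exact: take_sorted.
        by rewrite size_takel 1?ltnW //= nth_take // adjC.
      by rewrite size_rcons nth_rcons ltnn eqxx.
    have /maxL : uniq (rcons (rcons (take b.+1 L) v) w) /\ sorted adj (rcons (rcons (take b.+1 L) v) w) by [].
    by rewrite !size_rcons size_takel // ltnW.
  (* Affine E6 with centre [L_b]. *)
  apply: (@line_ext L [:: v; w] x0 (fun i => 3 - (i - b) - (b - i)) (fun x => if x == v then 2 else 1)) => //.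
  - by exists b; rewrite ?subnn // ltnW.
  - move=> x; rewrite !inE => /orP[] /eqP ->; last first.
      by left; rewrite !big_cons big_nil eqxx adjC yw (negPf wv).
    right; exists b; rewrite ab subnn ltnW //; split=> //.
    by rewrite !big_cons big_nil eqxx yw (negPf (noloop v)) (negPf wv).
  move=> i li; rewrite !big_cons big_nil eqxx (negPf (noloop _)) add0n.
  move: (adj _ v) (adj _ w) (abi i) => av aw; clear -li b1 b2.
  by case: i li => [|i] li; line_arith.
have [c0 lc ac] := inner y w yL wL yw; move: (index y L) c0 lc ac => c c0 lc ac {y yL yw}.
have aci i : (i == c) ==> adj (nth x0 L i) w by apply/implyP => /eqP ->; rewrite adjC.
(* Affine D, with weight 2 between the two branching vertices. *)
pose lo := minn b c; pose hi := maxn b c.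
apply: (@line_ext L [:: v; w] x0
  (fun i => if lo <= i <= hi then 2 else (i.+1 == lo) || (i == hi.+1)) (fun=> 1)) => //.
- by exists b; [exact: ltnW | rewrite geq_minl leq_maxl].
- move=> x; rewrite !inE => /orP[] /eqP ->; right.
    by exists b; rewrite ltnW // ab geq_minl leq_maxl; split=> //; exact: leq_addr.
  by exists c; rewrite ltnW // ac geq_minr leq_maxr; split=> //; exact: leq_addr.
move=> i li; rewrite !big_cons big_nil (negPf (noloop _)) add0n.
move: (adj _ v) (adj _ w) (abi i) (aci i) => av aw; rewrite /lo /hi; clear -li b0 lb c0 lc.
by case: i li => [|i] li; line_arith.
Qed.

End Classification.

Lemma classification (G : graph) : connected_graph G ->
  (~ exists X, has_adet_type G X) -> exists d, subadditive (G := G) d.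
Proof.
move=> Gc nX; apply: contrapT => nd; apply: nX.
have nosub d : ~ subadditive (G := G) d by move=> hd; apply: nd; exists d.
have [[u uu]|nu] := pselect (exists u : vert G, adj u u).
  exact: classify_loop uu.
apply: classify_noloop => // x; apply/negP => xx; apply: nu; by exists x.
Qed.

(** * Subadditive functions and the matrices U_n *)

Section Subadditive.
Variable G : graph.
Local Notation A := (adjmx G).
Local Notation U := (cheb A).

(** By induction [U_(m+1) d - U_m d >= d]: the increments do not decrease, since
    [U_(m+1) d - 2 U_m d + U_(m-1) d = U_m (A d - 2 d) >= 0]. *)
Lemma cheb_subadditive (d : vert G -> nat) N : subadditive d ->
  (forall m u v, (m <= N)%N -> 0 <= U m u v) -> U N != 0.
Proof.
move=> [[x dx] hd] U0; pose D : 'cV[int]_#|vert G| := \col_u (d (enum_val u))%:Z.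
have AD u : D u 0 + D u 0 <= (A *m D) u 0.
  rewrite !mxE -PoszD addnn -mul2n; have := hd (enum_val u); rewrite -lez_nat => /le_trans; apply.
  rewrite (big_morph Posz PoszD (erefl _)).
  rewrite -(sum_enum_val (fun l => (nedges (enum_val u) l * d l)%N%:Z)) ler_sum // => v _.
  by rewrite !mxE PoszM.
have D0 u : 0 <= D u 0 by rewrite mxE.
have step m : (m < N)%N -> forall u, (U m *m D) u 0 + D u 0 <= (U m.+1 *m D) u 0.
  elim: m => [|m IH] mN u.
    by rewrite cheb0 cheb1 mul1mx; exact: AD.
  have IHu := IH (ltnW mN) u.
  have : (U m.+1 *m D) u 0 + (U m.+1 *m D) u 0 <= (U m.+1 *m (A *m D)) u 0.
    rewrite [(U m.+1 *m D) _ _]mxE [(_ *m (A *m D)) _ _]mxE -big_split; apply: ler_sum => v _.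
    by rewrite /= -mulrDr ler_wpM2l // U0 // ltnW.
  rewrite chebSS mulmxBl mulmxA [X in _ -> _ <= X]mxE [X in _ -> _ <= _ + X]mxE.
  by rewrite lerBrDr => /(le_trans _); apply; rewrite -addrA lerD2l addrC.
have ge m : (m <= N)%N -> forall u, D u 0 <= (U m *m D) u 0.
  elim: m => [|m IH] mN u; first by rewrite cheb0 mul1mx.
  apply: le_trans (step _ mN u); rewrite lerDr.
  exact: le_trans (D0 u) (IH (ltnW mN) u).
apply/eqP => UN; have := ge N (leqnn N) (enum_rank x).
by rewrite UN mul0mx !mxE enum_rankK lez_nat leqNgt dx.
Qed.

End Subadditive.

(** * The first zero for the ADET types *)

Section Column.
Variables (G : graph) (X : adet).
Hypothesis hX : has_adet_type G X.
Local Notation A := (adjmx G).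
Local Notation U := (cheb A).
Local Notation r := (adet_rank X).

Lemma adet_column (w : nat -> nat -> nat) x0 N : (x0 < r)%N ->
  (forall x, (x < r)%N -> w 0%N x = (x == x0)) ->
  (forall m x, (m < N)%N -> (x < r)%N -> (\sum_(y < r) adet_adj X x y * w m y =
     w m.+1 x + (if m is m'.+1 then w m' x else 0))%N) ->
  exists (f : 'I_r -> 'I_#|vert G|) (j : 'I_#|vert G|), bijective f /\
    forall m x, (m <= N)%N -> U m (f x) j = (w m x)%:Z.
Proof.
move=> x0r w0 wS; have [_ [f fbij fE]] := hX; pose g x := enum_rank (f x).
have gbij : bijective g by apply: bij_comp fbij; apply: enum_rank_bij.
exists g, (g (Ordinal x0r)); split=> //.
have Arec m x : (A *m U m) (g x) (g (Ordinal x0r)) =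
    \sum_(y < r) (adet_adj X x y)%:Z * U m (g y) (g (Ordinal x0r)).
  rewrite mxE (reindex g) /=; last by case: gbij => g' gK g'K; exists g' => ? _.
  by apply: eq_bigr => y _; rewrite mxE !enum_rankK fE.
have E0 x : U 0 (g x) (g (Ordinal x0r)) = (w 0%N x)%:Z.
  by rewrite cheb0 mxE w0 // (inj_eq (bij_inj gbij)) -val_eqE /=; case: eqP.
suff E m : (m <= N)%N -> forall x, U m (g x) (g (Ordinal x0r)) = (w m x)%:Z by move=> m' x mN; exact: E.
have sumE n x : (n < N)%N -> (forall y, U n (g y) (g (Ordinal x0r)) = (w n y)%:Z) ->
    (A *m U n) (g x) (g (Ordinal x0r)) = (w n.+1 x)%:Z + (if n is n'.+1 then w n' x else 0%N)%:Z.
  move=> mN Em; rewrite Arec -PoszD -wS // (big_morph Posz PoszD (erefl _)).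
  by apply: eq_bigr => y _; rewrite Em PoszM.
elim/cheb_step: m => [||m' h1 h2] mN x; first exact: E0.
  by have := sumE 0%N x mN E0; rewrite cheb0 cheb1 mulmx1 addr0.
have h1' := h1 (ltnW (ltnW mN)); have h2' := h2 (ltnW mN).
by rewrite chebSS -chebC [LHS]mxE [X in _ + X]mxE (sumE _ _ mN h2') h1' addrK.
Qed.

Lemma sum_delta_nat (a : nat) (F : nat -> nat) :
  (\sum_(y < r) F y * (y == a :> nat) = if a < r then F a else 0)%N.
Proof.
case: ltnP => [ar|ra]; last first.
  by rewrite big1 // => y _; rewrite ltn_eqF ?muln0 // (leq_trans (ltn_ord y)).
rewrite (bigD1 (Ordinal ar)) //= eqxx muln1 big1 ?addn0 // => y ny.
by rewrite -val_eqE /= in ny; rewrite (negPf ny) muln0.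
Qed.

(** By [weight_dichotomy], one such column determines the first zero of the
    whole sequence of matrices. *)
Definition first_zero_column N : Prop :=
  exists j, (forall u, U N u j = 0) /\ forall m, (m < N)%N -> exists u, U m u j != 0.

Lemma first_zero_of_column (w : nat -> nat -> nat) x0 N : (x0 < r)%N ->
  (forall x, (x < r)%N -> w 0%N x = (x == x0)) ->
  (forall m x, (m < N)%N -> (x < r)%N -> (\sum_(y < r) adet_adj X x y * w m y =
     w m.+1 x + (if m is m'.+1 then w m' x else 0))%N) ->
  (forall x, (x < r)%N -> w N x = 0%N) ->
  (forall m, (m < N)%N -> exists2 x, (x < r)%N & (0 < w m x)%N) -> first_zero_column N.
Proof.
move=> xr w0 wS wN wpos; have [f [j [fbij E]]] := adet_column xr w0 wS.
exists j; split=> [u|m mN].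
  by have [g _ gK] := fbij; rewrite -(gK u) E // wN.
by have [x lx wx] := wpos m mN; exists (f (Ordinal lx)); rewrite E ?(ltnW mN) // eqz_nat -lt0n.
Qed.

End Column.

Ltac solve_bools :=
  rewrite /line_adj; repeat (match goal with
    |- context [if ?b then _ else _] =>
      lazymatch b with
      | context [if _ then _ else _] => fail
      | _ => let E := fresh in case E : b
      end
  end); lia.

Section Types.
Variable G : graph.

(** Starting from an end of the line, the column is a point moving to the other
    end. *)
Lemma first_zero_columnA n : has_adet_type G (typeA n) -> first_zero_column G n.
Proof.
move=> hX; have [n1 _] := hX; rewrite /= in n1.
apply: (first_zero_of_column hX (w := fun m x => nat_of_bool (x == m)) (x0 := 0%N)) => //=.
- move=> m x mn xn; have := sum_delta_nat (typeA n) m (fun y => line_adj x y).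
  move=> /= ->; rewrite mn; clear; by case: m => [|m]; solve_bools.
- by move=> x xn; rewrite ltn_eqF.
by move=> m mn; exists m => //; rewrite eqxx.
Qed.

(** Starting from the end without loop, the point moves to the loop, and is
    reflected after staying there for one more step. *)
Lemma first_zero_columnT n : has_adet_type G (typeT n) -> first_zero_column G (2 * n).
Proof.
move=> hX; have [n1 _] := hX; rewrite /= in n1.
pose a m := (if m < n then n.-1 - m else m - n)%N.
apply: (first_zero_of_column hX (w := fun m x => nat_of_bool (x == a m)) (x0 := n.-1)) => /=.
- by rewrite prednK.
- by move=> x xn; rewrite /a n1 subn0.
- move=> m x mn xn; have := sum_delta_nat (typeT n) (a m)
    (fun y => line_adj x y || (x == 0%N) && (y == 0%N)).
  move=> /= ->; rewrite /a; clear -mn xn; by case: m mn => [|m] mn; solve_bools.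
- by move=> x xn; rewrite /a; clear -n1 xn; solve_bools.
move=> m mn; exists (a m); last by rewrite eqxx.
by rewrite /a; clear -mn n1; solve_bools.
Qed.

Lemma branch_adjD p x y : (x < p.+3)%N -> (y <= p.+1)%N ->
  branch_adj p.+2 p x y =
    ((y <= p) && (x == y.+1) + (x.+1 == y) + (x == p.+2) && (y == p))%N :> nat.
Proof.
move=> xp yp; rewrite /branch_adj /line_adj.
have -> : (y < p.+2)%N by [].
have -> : (y == p.+2) = false by lia.
rewrite andbF orbF; have [->|nx] := eqVneq x p.+2; last by lia.
by rewrite ltnn /=; lia.
Qed.

(** With [n = p + 3], the point moves from the end of the long arm to the
    branching vertex [p], then splits over the two short ends, and moves
    back. *)
Lemma first_zero_columnD n : has_adet_type G (typeD n) -> first_zero_column G (2 * n - 3).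
Proof.
move=> hX; have [n1 _] := hX; rewrite /= in n1.
have [p en] : exists p, n = p.+3 by exists (n - 3)%N; lia.
subst n; have {n1}p0 : (0 < p)%N by [].
pose a m := (if m <= p.+1 then m else p.*2.+2 - m)%N.
pose w m x := (if m <= p.*2.+2 then (x == a m) + (m == p.+1) * (x == p.+2) else 0)%N.
have wE m x : (m <= p.*2.+2)%N -> w m x = ((x == a m) + (m == p.+1) * (x == p.+2))%N.
  by rewrite /w => ->.
have a1 m : (m <= p.+1)%N -> a m = m by rewrite /a => ->.
have a2 m : (p.+1 < m)%N -> a m = (p.*2.+2 - m)%N by rewrite /a ltnNge => /negPf ->.
have sumE := sum_delta_nat (typeD p.+3).
have -> : (2 * p.+3 - 3 = p.*2.+3)%N by clear; lia.
apply: (first_zero_of_column hX (w := w) (x0 := 0%N)) => //=.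
- by move=> x xn; rewrite wE // a1 //; clear; lia.
- have -> : (p.+3 - 3 = p)%N by clear; lia.
  move=> m x mn xn.
  have E (y : 'I_p.+3) : true -> (branch_adj p.+2 p x y * w m y =
      branch_adj p.+2 p x y * (y == a m :> nat) +
      (m == p.+1) * (branch_adj p.+2 p x y * (y == p.+2 :> nat)))%N.
    by move=> _; rewrite wE // mulnDr mulnCA.
  have bp : branch_adj p.+2 p x p.+2 = (x == p).
    by rewrite /branch_adj /line_adj; clear -xn; lia.
  have am : (a m <= p.+1)%N by rewrite /a; clear; case: ifP; lia.
  rewrite (eq_bigr _ E) big_split -big_distrr /=.
  rewrite !(sumE _ (fun y => nat_of_bool (branch_adj p.+2 p x y))) /= ltnSn bp.
  rewrite ltnS (leq_trans am) // branch_adjD // {1}/w.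
  clear E sumE hX bp am; have [mp|mp|mp] := ltngtP m p.+1.
  + rewrite !a1 //; last exact: ltnW.
    case: m mn mp => [|m] mn mp; last rewrite wE ?a1; clear -mn mp xn p0; solve_bools.
  + rewrite !a2 //; last exact: ltnW.
    case: m mn mp => [|m] mn mp //; rewrite wE; last by clear -mn; lia.
    have [e|mp'] := eqVneq m p.+1; first by rewrite e a1 //; clear -mn xn p0; solve_bools.
    by rewrite a2; clear -mn mp mp' xn p0; solve_bools.
  rewrite mp a1 // a2 // wE ?a1 //; clear -xn p0; solve_bools.
- by move=> x xn; rewrite /w ltnn.
move=> m mn; exists (a m); first by rewrite /a; clear -mn; solve_bools.
by rewrite wE // eqxx.
Qed.

(** For the exceptional types the column is computed from the first vertex, as a
    pair of consecutive terms. Subtraction of natural numbers is truncated,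
    which [column_check] controls by testing the recursion in additive form. *)
Definition next_column X (pc : seq nat * seq nat) : seq nat * seq nat :=
  (pc.2, mkseq (fun x => sumn [seq adet_adj X x y * nth 0%N pc.2 y | y <- iota 0 (adet_rank X)]
                 - nth 0%N pc.1 x)%N (adet_rank X)).

Definition column X m : seq nat :=
  (iter m (next_column X) ([::], mkseq (fun x => nat_of_bool (x == 0%N)) (adet_rank X))).2.

Definition column_check X N : bool :=
  let w m x := nth 0%N (column X m) x in
  let r := adet_rank X in
  [&& (0 < r)%N,
      all (fun m => all (fun x =>
        sumn [seq adet_adj X x y * w m y | y <- iota 0 r] ==
        w m.+1 x + (if m is m'.+1 then w m' x else 0)) (iota 0 r)) (iota 0 N),
      all (fun x => w N x == 0) (iota 0 r) &
      all (fun m => has (fun x => 0 < w m x) (iota 0 r)) (iota 0 N)]%N.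

Lemma first_zero_column_check X N : has_adet_type G X -> column_check X N -> first_zero_column G N.
Proof.
move=> hX /and4P[r0 /allP hS /allP hN /allP hp].
apply: (first_zero_of_column hX (w := fun m => nth 0%N (column X m)) r0).
- by move=> x xr; rewrite /column /= nth_mkseq.
- move=> m x mN xr; have hm : m \in iota 0 N by rewrite mem_iota.
  have hx : x \in iota 0 (adet_rank X) by rewrite mem_iota.
  have /eqP <- := allP (hS m hm) x hx.
  rewrite sumnE big_map -[in RHS](subn0 (adet_rank X)).
  by rewrite -/(index_iota 0 (adet_rank X)) big_mkord.
- by move=> x xr; apply/eqP/hN; rewrite mem_iota.
move=> m mN; have hm : m \in iota 0 N by rewrite mem_iota.
by have /hasP[x] := hp m hm; rewrite mem_iota; exists x.
Qed.

Lemma first_zero_column_adet X : has_adet_type G X -> first_zero_column G (coxeter X).-1.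
Proof.
case: X => [n|n||||n] hX.
- exact: first_zero_columnA.
- by rewrite /= -subn1 -subnDA; exact: first_zero_columnD.
- by apply: (first_zero_column_check hX); vm_compute.
- by apply: (first_zero_column_check hX); vm_compute.
- by apply: (first_zero_column_check hX); vm_compute.
by rewrite /= addn1; exact: first_zero_columnT.
Qed.

End Types.

(** * The Hilbert series *)

(** The rows of [P] are integral vectors of norm one. *)
Lemma int_involution_perm n (P : 'M[int]_n) : P^T = P -> P *m P = 1%:M ->
  (forall u v, 0 <= P u v) ->
  exists2 s : 'I_n -> 'I_n, involutive s & forall u v, P u v = (s u == v)%:R.
Proof.
move=> Pt PP P0; have sq u : \sum_v P u v ^+ 2 = 1.
  have := congr1 (fun M : 'M_n => M u u) PP; rewrite !mxE eqxx.
  apply: etrans; apply: eq_bigr => v _.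
  by rewrite expr2 -{2}Pt mxE.
have /choice[s hs] u : exists v, P u v != 0.
  apply: contrapT => nv; have := sq u; rewrite big1 // => v _.
  by apply/eqP; rewrite sqrf_eq0; apply: contrapT => /negP nz; apply: nv; exists v.
have E u v : P u v = (s u == v)%:R.
  have := sq u; rewrite (bigD1 (s u)) //=.
  have p1 : 1 <= P u (s u) by have := hs u; have := P0 u (s u); lia.
  have p2 : 1 <= P u (s u) ^+ 2 by rewrite expr_ge1.
  have r0 : 0 <= \sum_(w | w != s u) P u w ^+ 2.
    by apply: sumr_ge0 => w _; rewrite sqr_ge0.
  move=> e; have r1 : \sum_(w | w != s u) P u w ^+ 2 = 0.
    by move: e p2 r0; move: (_ ^+ 2) (\sum_(_ | _) _) => p S; lia.
  have [<-|nv] := eqVneq (s u) v.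
    have : P u (s u) ^+ 2 = 1 by move: e; rewrite r1 addr0.
    by move/eqP; rewrite sqrp_eq1 // => /eqP ->.
  move/eqP: r1; rewrite psumr_eq0 => [/allP/(_ v)|w _]; last exact: sqr_ge0.
  by rewrite mem_index_enum eq_sym nv /= sqrf_eq0 => /(_ isT)/eqP.
exists s => // u; apply/eqP; have := E u (s u).
rewrite eqxx -Pt mxE E; by case: eqP.
Qed.

Section HilbertSeries.
Variables (k : fieldType) (G : graph).
Hypothesis k0 : [pchar k] =i pred0.
Hypothesis Gconn : connected_graph G.
Local Notation A := (adjmx G).
Local Notation U := (cheb A).
Local Notation weight := (col_weight G).

Lemma weight_pos_of_not_adet : (~ exists X, has_adet_type G X) ->
  forall d u, weight d 0 u != 0.
Proof.
move=> nX; have [//|[N UN wN]] := weight_dichotomy k0 Gconn.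
have [d hd] := classification Gconn nX.
have [] := negP (@cheb_subadditive G d N hd _); last by rewrite UN.
move=> m u v mN.
rewrite -(hilbert_cheb k0) ?hilbert_ge0 // => l w lm; apply: wN.
exact: leq_trans lm mN.
Qed.

Lemma cheb_adet X : has_adet_type G X ->
  U (coxeter X).-1 = 0 /\ forall m u, (m < (coxeter X).-1)%N -> weight m 0 u != 0.
Proof.
move=> hX; have [j [Uj Um]] := first_zero_column_adet hX.
have wj : weight (coxeter X).-1 0 j = 0.
  by rewrite /col_weight mxE big1 // => u _; rewrite Uj mulr0.
have [/(_ (coxeter X).-1 j)|[N UN wN]] := weight_dichotomy k0 Gconn.
  by rewrite wj eqxx.
suff -> : (coxeter X).-1 = N by [].
apply/eqP; rewrite eqn_leq; apply/andP; split; rewrite leqNgt; apply/negP.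
  by move=> /Um[u]; rewrite UN mxE eqxx.
by move=> lt; have := wN _ j lt; rewrite wj eqxx.
Qed.

Lemma sinv_cartan : sinv (cartan_series G) =1 U.
Proof. exact: sinv_cheb. Qed.

Lemma hilbert_not_adet : (~ exists X, has_adet_type G X) ->
  hilbert k G =1 sinv (cartan_series G).
Proof.
move=> nX d; rewrite sinv_cartan hilbert_cheb // => m u _.
exact: weight_pos_of_not_adet.
Qed.

Lemma hilbert_adet X : has_adet_type G X ->
  exists2 s : {perm vert G}, involutive s &
    hilbert k G =1 smul (perm_series s (coxeter X)) (sinv (cartan_series G)).
Proof.
move=> hX; have [UN wN] := cheb_adet hX.
have [N eN] : exists N, coxeter X = N.+2.
  have [vX _] := hX; exists (coxeter X).-2.
  by case: (X) vX => [n|n||||n] //= n1; lia.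
rewrite eN /= in UN wN *.
have hU m : (m <= N.+1)%N -> hilbert k G m = U m.
  move=> mN; rewrite hilbert_cheb // => l u lm; apply: wN.
  exact: leq_trans lm mN.
have PP : U N *m U N = 1%:M.
  case: N {eN wN hU} UN => [|N] UN; first by rewrite cheb0 mulmx1.
  by rewrite -(cheb_sqr A N) UN mul0mx subr0.
have UN0 u v : 0 <= U N u v by rewrite -hU ?hilbert_ge0.
(* The permutation is first obtained on the indices of the matrices. *)
have [t tK tE] := int_involution_perm (cheb_tr N (adjmx_tr G)) PP UN0.
pose f x := enum_val (t (enum_rank x)).
have fK : involutive f by move=> x; rewrite /f enum_valK tK enum_rankK.
exists (perm (inv_inj fK)) => [x|d]; first by rewrite !permE fK.
have Pm : (\matrix_(u, v) (perm (inv_inj fK) (enum_val u) == enum_val v)%:R) = U N.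
  by apply/matrixP => u v; rewrite mxE permE /f enum_valK (inj_eq enum_val_inj) tE.
rewrite /smul /perm_series Pm.
have -> : \sum_(i < d.+1) (smono 1%:M 0%N \+ smono (U N) N.+2) i *m sinv (cartan_series G) (d - i)%N
    = U d + (if (N.+2 <= d)%N then U N *m U (d - N.+2) else 0).
  under eq_bigr => i _ do rewrite /= mulmxDl sinv_cartan.
  rewrite big_split /=; congr (_ + _).
    by rewrite big_ord_recl /= subn0 mul1mx big1 ?addr0 // => i _; rewrite /smono /= mul0mx.
  case: ifP => [le|/negbT]; last rewrite -ltnNge => lt.
    have lt : (N.+2 < d.+1)%N by rewrite ltnS.
    rewrite (bigD1 (Ordinal lt)) //= /smono eqxx big1 ?addr0 // => i ni.
    by rewrite (_ : (i == N.+2 :> nat) = false) ?mul0mx //; apply/negbTE.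
  rewrite big1 // => i _; rewrite /smono ltn_eqF ?mul0mx //.
  exact: leq_trans (ltn_ord i) lt.
have [le|lt] := leqP N.+2 d; last by rewrite addr0 hU.
rewrite -{1 2}(subnKC le); set m := (d - N.+2)%N.
rewrite cheb_antiperiodic // addNr.
elim: m => [|m IH]; last by rewrite addnS hilbert_vanish.
by rewrite addn0 hilbert_vanish // hU.
Qed.

End HilbertSeries.

(** * Graded sums of the modules A e *)

Section Free.
Variables (A : pzRingType) (X : finType) (e : X -> A).

Definition idsum_pred : pred {ffun X -> A^o} :=
  fun v => [forall x, (v x : A) * e x == v x].

Lemma idsum_predP (v : {ffun X -> A^o}) : reflect (forall x, (v x : A) * e x = v x) (v \in idsum_pred).
Proof. by apply: (iffP forallP) => h x; apply/eqP/h. Qed.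

Fact idsum_submod : submod_closed idsum_pred.
Proof.
split=> [|a u v /idsum_predP hu /idsum_predP hv]; apply/idsum_predP => x.
  by rewrite ffunE mul0r.
rewrite !ffunE mulrDl hv; congr (_ + _).
by rewrite -[LHS]mulrA hu.
Qed.
HB.instance Definition _ := GRing.isSubmodClosed.Build A {ffun X -> A^o} idsum_pred idsum_submod.

(** The left module [sum_x A e_x], inside a free module. *)
Record idsum := Idsum { idsum_val :> {ffun X -> A^o}; idsum_valP : idsum_val \in idsum_pred }.
HB.instance Definition _ := [isSub for idsum_val].
HB.instance Definition _ := [Choice of idsum by <:].
HB.instance Definition _ := [SubChoice_isSubLmodule of idsum by <:].

Hypothesis eK : forall x, e x * e x = e x.

Lemma idsum_mul_idem (v : idsum) x : (v x : A) * e x = v x.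
Proof. by apply/idsum_predP/idsum_valP. Qed.

Lemma idsumP (v w : idsum) : (forall x, v x = w x) -> v = w.
Proof. by move=> h; apply/val_inj/ffunP. Qed.

Definition idsum_fun (f : X -> A) : {ffun X -> A^o} := [ffun x => f x * e x : A^o].

Fact idsum_fun_subproof f : idsum_fun f \in idsum_pred.
Proof. by apply/idsum_predP => x; rewrite ffunE -mulrA eK. Qed.

(** The projection of the free module onto the summand. *)
Definition idsum_of f : idsum := Idsum (idsum_fun_subproof f).

Lemma idsum_ofE f x : idsum_of f x = f x * e x.
Proof. by rewrite ffunE. Qed.

Lemma idsum_addE (v w : idsum) x : (v + w) x = v x + w x.
Proof. by rewrite /= ffunE. Qed.

Lemma idsum_scaleE a (v : idsum) x : (a *: v) x = a * (v x : A) :> A.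
Proof. by rewrite /= ffunE. Qed.

Lemma idsum0E x : (0 : idsum) x = 0.
Proof. by rewrite /= ffunE. Qed.

Lemma idsum_sumE (T : Type) (r : seq T) (P : pred T) (F : T -> idsum) x :
  (\sum_(i <- r | P i) F i) x = \sum_(i <- r | P i) F i x.
Proof.
elim/big_rec2: _ => [|i u v _ <-]; first by rewrite /= ffunE.
by rewrite /= ffunE.
Qed.

Section Grading.
Variable g : nat -> A -> Prop.
Hypothesis gg : is_grading g.
Hypothesis ge : forall n a x, g n a -> g n (a * e x).

Definition idsum_deg n (v : idsum) : Prop := forall x, g n (v x).

Lemma idsum_grading : is_grading idsum_deg.
Proof.
have [gsub gdec gind] := gg; split.
- move=> n; split=> [x|u v hu hv x]; first by rewrite /= ffunE; have [] := gsub n.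
  by rewrite /= !ffunE; apply: (gsub n).2.
- move=> v; have /choice[N] : forall x, exists N, exists f : nat -> A,
      (forall n, g n (f n)) /\ v x = \sum_(n < N) f n by move=> x; exact: gdec.
  move=> /choice[f hf]; pose M := \max_x N x.
  pose f' n x := if (n < N x)%N then f x n else 0.
  exists M, (fun n => idsum_of (f' n)); split=> [n x|].
    rewrite idsum_ofE; apply: ge; rewrite /f'; case: ifP => _; first by have [] := hf x.
    by have [] := gsub n.
  apply: idsumP => x; rewrite idsum_sumE -idsum_mul_idem; have [_ ->] := hf x.
  under [RHS]eq_bigr => n _ do rewrite idsum_ofE.
  rewrite -mulr_suml; congr (_ * _).
  rewrite (big_ord_widen_cond M predT (f x)) ?leq_bigmax //= big_mkcond.
  by apply: eq_bigr.
move=> N f hf sf n nN; apply: idsumP => x; rewrite [RHS]/= ffunE.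
apply: (gind N (fun n => f n x)) nN; first by move=> m; exact: hf.
by rewrite -idsum_sumE sf /= ffunE.
Qed.

End Grading.
End Free.

Lemma sum_unit (V : nmodType) (F : unit -> V) : \sum_x F x = F tt.
Proof. by rewrite (bigD1 tt) //= big1 ?addr0 // => -[]. Qed.

Section Components.
Variables (M : zmodType) (g : nat -> M -> Prop).
Hypothesis gg : is_grading g.

Lemma grading_sum n (T : Type) (r : seq T) (P : pred T) (F : T -> M) :
  (forall i, P i -> g n (F i)) -> g n (\sum_(i <- r | P i) F i).
Proof.
have [h _ _] := gg; have [g0 gB] := h n; apply: big_ind => // a b ga gb.
by rewrite -[b]opprK; apply: (gB _ _ ga); rewrite -sub0r; apply: (gB).
Qed.

Lemma grading_decomp d x : exists N (f : nat -> M),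
  [/\ (d < N)%N, forall n, g n (f n) & x = \sum_(n < N) f n].
Proof.
have [gsub gdec _] := gg; have [N [f [hf ->]]] := gdec x.
exists (N + d.+1)%N, (fun n => if (n < N)%N then f n else 0); split.
- by rewrite addnS ltnS leq_addl.
- by move=> n; case: ifP => // _; have [] := gsub n.
rewrite big_split_ord /= [X in _ = _ + X]big1 ?addr0 => [|n _].
  by apply: eq_bigr => n _; rewrite ltn_ord.
by rewrite ltnNge leq_addr.
Qed.

Lemma grading_component d N (f : nat -> M) w : (forall n, g n (f n)) ->
  g d w -> \sum_(n < N) f n = w -> (d < N)%N ->
  forall n, (n < N)%N -> f n = if n == d then w else 0.
Proof.
have [gsub _ gind] := gg; move=> hf gw sf dN n nN; apply/eqP; rewrite -subr_eq0; apply/eqP.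
apply: (gind N (fun m => f m - if m == d then w else 0)) nN.
  move=> m; apply: (gsub m).2 => //; case: eqP => [->|_] //; exact: (gsub m).1.
rewrite sumrB sf (bigD1 (Ordinal dN)) //= eqxx big1 ?addr0 ?subrr // => m.
by rewrite -val_eqE /= => /negPf ->.
Qed.

End Components.

Section Shift.
Variables (A : zmodType) (g : nat -> A -> Prop).

Definition shift_deg d n (a : A) : Prop := if (n < d)%N then a = 0 else g (n - d) a.

Lemma shift_grading d : is_grading g -> is_grading (shift_deg d).
Proof.
move=> [gsub gdec gind]; split.
- move=> n; rewrite /shift_deg; case: ifP => _; last exact: gsub.
  by split=> // x y -> ->; rewrite subr0.
- move=> a; have [N [f [hf ->]]] := gdec a.
  exists (d + N)%N, (fun n => if (n < d)%N then 0 else f (n - d)%N); split=> [n|].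
    by rewrite /shift_deg; case: (n < d)%N.
  rewrite big_split_ord /= [X in _ = X + _]big1 ?add0r => [|n _]; last by rewrite ltn_ord.
  by apply: eq_bigr => n _; rewrite ltnNge leq_addr /= addKn.
move=> N f hf sf n nN; have [nd|dn] := ltnP n d.
  by have := hf n; rewrite /shift_deg nd.
have dN : (d <= N)%N by apply: leq_trans dn (ltnW nN).
have [M eM] : exists M, N = (d + M)%N by exists (N - d)%N; rewrite subnKC.
subst N; rewrite -(subnKC dn); apply: (gind M (fun m => f (d + m)%N)).
- by move=> m; have := hf (d + m)%N; rewrite /shift_deg ltnNge leq_addr /= addKn.
- move: sf; rewrite big_split_ord /= big1 ?add0r // => m _.
  by have := hf m; rewrite /shift_deg ltn_ord.
by rewrite ltn_subLR.
Qed.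

End Shift.

Section GradedModule.
Variables (A : pzRingType) (gr : nat -> A -> Prop).
Hypothesis hgr : graded_ring gr.

Lemma gr0 n : gr n 0.
Proof. by have [[h _ _] _ _] := hgr; have [] := h n. Qed.

Lemma shift0 d n : shift_deg gr d n 0.
Proof. by rewrite /shift_deg; case: ifP => // _; exact: gr0. Qed.

Section Summand.
Variables (X : finType) (e : X -> A) (d : nat).
Hypothesis eK : forall x, e x * e x = e x.
Hypothesis e0 : forall x, gr 0 (e x).

Lemma shift_idem n a x : shift_deg gr d n a -> shift_deg gr d n (a * e x).
Proof.
have [_ _ hM] := hgr; rewrite /shift_deg; case: ifP => [_ ->|_ ha]; first exact: mul0r.
by rewrite -[(n - d)%N]addn0; exact: hM.
Qed.

Let hgrd : is_grading (shift_deg gr d) := shift_grading d (let: And3 h _ _ := hgr in h).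

Definition summand_deg n (v : idsum e) : Prop := idsum_deg (shift_deg gr d) n v.

Lemma summand_grading : is_grading summand_deg.
Proof. exact: (idsum_grading eK hgrd shift_idem). Qed.

Lemma summand_degZ m n a (v : idsum e) :
  gr m a -> summand_deg n v -> summand_deg (m + n) (a *: v).
Proof.
have [_ _ hM] := hgr; move=> ha hv x; rewrite /= ffunE.
have := hv x; rewrite /shift_deg; case: ltnP => [_ ->|dn hx].
  by rewrite [_ *: _]mulr0; exact: shift0.
by rewrite ltnNge (leq_trans dn (leq_addl _ _)) /= -addnBA //; exact: hM.
Qed.

Definition summand : gmod gr := GMod summand_grading summand_degZ.

Definition gen x : idsum e := idsum_of eK (fun y => (x == y)%:R).

Lemma genE x y : gen x y = if x == y then e y else 0.
Proof. by rewrite idsum_ofE; case: eqP; rewrite ?mul1r ?mul0r. Qed.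

Lemma gen_deg x : summand_deg d (gen x).
Proof.
move=> y; rewrite genE; case: eqP => _; last exact: shift0.
by rewrite /shift_deg ltnn subnn.
Qed.

Lemma gen_expand (v : idsum e) : v = \sum_x (v x : A) *: gen x.
Proof.
apply: idsumP => y; rewrite idsum_sumE (bigD1 y) //= ffunE genE eqxx [_ *: _]idsum_mul_idem.
by rewrite big1 ?addr0 // => x /negPf nx; rewrite ffunE genE nx [_ *: _]mulr0.
Qed.

Lemma summand_generated : generated_in_degree summand d.
Proof.
move=> v; exists [seq ((v : idsum e) x : A, gen x : summand) | x <- enum X]; split.
  by move=> u /mapP[x _ ->]; exact: gen_deg.
by rewrite big_map big_enum; exact: gen_expand.
Qed.

(** The image of a generator [gen x] is homogeneous of degree [d], so the
    component of degree [d] of any of its lifts is again a lift, say [y_x]; then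
    [v |-> sum_x v_x y_x] lifts the map. *)
Lemma summand_projective : graded_projective summand.
Proof.
move=> M N g f hg og hf.
have lift x : exists y : M, gdeg d y /\ g y = f (gen x).
  have [z gz] := og (f (gen x)).
  have [K [c [dK hc ez]]] := grading_decomp (gdeg_grading M) d z.
  have fd : gdeg d (f (gen x)) by apply: hf; exact: gen_deg.
  exists (c d); split=> //.
  have := grading_component (gdeg_grading N) (f := fun n => g (c n)) _ fd _ dK dK.
  by rewrite eqxx; apply; [move=> n; exact: hg | rewrite -gz ez linear_sum].
have /choice[y hy] := lift.
pose h (v : idsum e) : M := \sum_x (v x : A) *: y x.
have hlin : linear h.
  move=> a u v; rewrite /h scaler_sumr -big_split; apply: eq_bigr => x _.
  by rewrite /= !ffunE scalerDl scalerA.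
pose hL := GRing.isLinear.Build A (idsum e) M _ h hlin.
pose hh : {linear idsum e -> M} := HB.pack h hL.
exists hh => [n v hv|v].
  apply: (grading_sum (gdeg_grading M)) => x _; have := hv x; have [yd _] := hy x.
  rewrite /shift_deg; case: ltnP => [_ ->|dn hx].
    by rewrite scale0r; have [h0 _ _] := gdeg_grading M; have [] := h0 n.
  by rewrite -(subnK dn); exact: gdegZ.
have -> : hh v = h v by [].
rewrite /h linear_sum [in RHS](gen_expand v) linear_sum; apply: eq_bigr => x _.
by rewrite !linearZ; have [_ ->] := hy x.
Qed.

End Summand.

(** * The module A_0 *)

Lemma positive_gr n a : gr n.+1 a -> positive_part gr a.
Proof.
move=> ha; exists n.+1, (fun m => if m == n then a else 0); split=> [m|].
  by case: eqP => [->|_] //; exact: gr0.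
rewrite (bigD1 ord_max) //= eqxx big1 ?addr0 // => m.
by rewrite -val_eqE /= => /negPf ->.
Qed.

Lemma positive0 : positive_part gr 0.
Proof. by apply: (@positive_gr 0%N); exact: gr0. Qed.

Lemma positiveB a b : positive_part gr a -> positive_part gr b -> positive_part gr (a - b).
Proof.
move=> [N [f [hf ->]]] [M [c [hc ->]]].
exists (maxn N M), (fun n => (if (n < N)%N then f n else 0) - (if (n < M)%N then c n else 0)).
have [[h _ _] _ _] := hgr.
split=> [n|]; first by apply: (h n.+1).2; case: ifP => _ //; exact: gr0.
rewrite sumrB; congr (_ - _).
  by rewrite (big_ord_widen_cond (maxn N M) predT f) ?leq_maxl //= big_mkcond.
by rewrite (big_ord_widen_cond (maxn N M) predT c) ?leq_maxr //= big_mkcond.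
Qed.

Lemma positive_sum (T : Type) (r : seq T) (P : pred T) (F : T -> A) :
  (forall i, P i -> positive_part gr (F i)) -> positive_part gr (\sum_(i <- r | P i) F i).
Proof.
move=> hF; apply: big_ind => //; first exact: positive0.
move=> a b ha hb; rewrite -[b]opprK; apply: positiveB => //.
by rewrite -sub0r; apply: positiveB => //; exact: positive0.
Qed.

Lemma positiveM a b : positive_part gr b -> positive_part gr (a * b).
Proof.
have [hg _ hM] := hgr; move=> [N [f [hf ->]]].
have [K [c [_ hc ->]]] := grading_decomp hg 0%N a.
rewrite mulr_suml; apply: positive_sum => m _; rewrite mulr_sumr.
by apply: positive_sum => n _; apply: (@positive_gr (m + n)); rewrite -addnS; exact: hM.
Qed.

Lemma positiveMr m a b : gr m.+1 a -> positive_part gr (a * b).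
Proof.
have [hg _ hM] := hgr; move=> ha.
have [K [c [_ hc ->]]] := grading_decomp hg 0%N b.
rewrite mulr_sumr; apply: positive_sum => n _; apply: (@positive_gr (m + n)).
by rewrite -addSn; exact: hM.
Qed.

Definition positive_pred : pred A := fun a => `[< positive_part gr a >].

Fact positive_zmod_closed : zmod_closed positive_pred.
Proof.
split; first by apply/asboolP; exact: positive0.
by move=> a b /asboolP ha /asboolP hb; apply/asboolP; exact: positiveB.
Qed.
HB.instance Definition _ :=
  GRing.isZmodClosed.Build A positive_pred positive_zmod_closed.
Definition positive_zmod : zmodClosed A := GRing.ZmodClosed.clone A positive_pred _.

Definition deg0_quot : Type := Quotient.quot positive_zmod.
HB.instance Definition _ := GRing.Zmodule.on deg0_quot.

Definition deg0_proj (a : A) : deg0_quot := (\pi_(Quotient.quot positive_zmod) a)%qT.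
Definition deg0_repr (s : deg0_quot) : A :=
  generic_quotient.repr (s : Quotient.quot positive_zmod).

Lemma deg0_reprK s : deg0_proj (deg0_repr s) = s.
Proof. exact: reprK. Qed.

Lemma deg0_proj_eq a b : deg0_proj a = deg0_proj b <-> positive_part gr (a - b).
Proof.
have E : (a - b \in positive_pred) = (deg0_proj a == deg0_proj b).
  by rewrite /deg0_proj Quotient.idealrBE.
split=> [e|ab]; first by apply/asboolP; move: E; rewrite e eqxx.
by apply/eqP; rewrite -E; apply/asboolP.
Qed.

Lemma deg0_projD : {morph deg0_proj : a b / a + b}.
Proof. by move=> a b; rewrite /deg0_proj raddfD. Qed.

Definition deg0_scale (a : A) (s : deg0_quot) : deg0_quot := deg0_proj (a * deg0_repr s).

Lemma deg0_scaleE a b : deg0_scale a (deg0_proj b) = deg0_proj (a * b).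
Proof.
apply/deg0_proj_eq; rewrite -mulrBr; apply: positiveM.
by apply/deg0_proj_eq; rewrite deg0_reprK.
Qed.

Fact deg0_scaleA a b s : deg0_scale a (deg0_scale b s) = deg0_scale (a * b) s.
Proof. by rewrite -[s]deg0_reprK !deg0_scaleE mulrA. Qed.

Fact deg0_scale1 : left_id 1 deg0_scale.
Proof. by move=> s; rewrite -[s]deg0_reprK deg0_scaleE mul1r. Qed.

Fact deg0_scaleDr : right_distributive deg0_scale +%R.
Proof.
move=> a s t; rewrite -[s]deg0_reprK -[t]deg0_reprK -deg0_projD !deg0_scaleE.
by rewrite mulrDr deg0_projD.
Qed.

Fact deg0_scaleDl s : {morph deg0_scale^~ s : a b / a + b}.
Proof. by move=> a b; rewrite -[s]deg0_reprK !deg0_scaleE mulrDl deg0_projD. Qed.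

HB.instance Definition _ := GRing.Zmodule_isLmodule.Build A deg0_quot
  deg0_scaleA deg0_scale1 deg0_scaleDr deg0_scaleDl.

Lemma deg0_proj0 a : deg0_proj a = 0 <-> positive_part gr a.
Proof.
have <- : deg0_proj 0 = 0 by apply: (addrI (deg0_proj 0)); rewrite -deg0_projD !addr0.
by rewrite -[a in X in _ <-> X]subr0; exact: deg0_proj_eq.
Qed.

Definition deg0_deg n (s : deg0_quot) : Prop := n = 0%N \/ s = 0.

Lemma deg0_grading : is_grading deg0_deg.
Proof.
split.
- move=> n; split=> [|s t [->|->] [e|->]]; [by right|by left|by left| |].
    by rewrite e; left.
  by right; rewrite subr0.
- move=> s; exists 1%N, (fun n => if n == 0%N then s else 0); split=> [n|].
    by case: eqP; [left|right].
  by rewrite big_ord1.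
move=> N f hf; case: N => // N; rewrite big_ord_recl big1 ?addr0 => [f0 n _|m _].
  by have [->|] := hf n.
by have [] := hf (bump 0 m).
Qed.

Lemma deg0_degZ m n a s : gr m a -> deg0_deg n s -> deg0_deg (m + n) (a *: s).
Proof.
move=> ha [->|->]; last by right; rewrite scaler0.
case: m ha => [|m] ha; [by left|right].
by rewrite -[s]deg0_reprK; apply/deg0_proj0; apply: positiveMr ha.
Qed.

Definition deg0_module : gmod gr := GMod deg0_grading deg0_degZ.

Fact deg0_proj_linear : linear (deg0_proj : A^o -> deg0_quot).
Proof.
move=> a b c; rewrite deg0_projD; congr (_ + _).
by symmetry; exact: deg0_scaleE.
Qed.
HB.instance Definition _ := GRing.isLinear.Build A A^o deg0_quot _
  (deg0_proj : A^o -> deg0_quot) deg0_proj_linear.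

Lemma deg0_moduleP : is_degree0_module deg0_module.
Proof.
split; first by move=> s; left.
exists (deg0_proj : {linear A^o -> deg0_quot}); last exact: deg0_proj0.
by move=> s; exists (deg0_repr s); exact: deg0_reprK.
Qed.

(** * The resolution of A_0 *)

Section MatrixMap.
Variables (X Y : finType) (e : X -> A) (e' : Y -> A) (m : X -> Y -> A).
Hypothesis eK' : forall y, e' y * e' y = e' y.

Definition mxmap (v : idsum e) : idsum e' := idsum_of eK' (fun y => \sum_x v x * m x y).

Fact mxmap_linear : linear mxmap.
Proof.
move=> a u v; apply: idsumP => y; rewrite idsum_addE idsum_scaleE !idsum_ofE mulrA -mulrDl.
congr (_ * _); rewrite mulr_sumr -big_split; apply: eq_bigr => x _.
by rewrite idsum_addE idsum_scaleE mulrDl mulrA.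
Qed.
HB.instance Definition _ := GRing.isLinear.Build A (idsum e) (idsum e') _ mxmap mxmap_linear.

Hypothesis mE : forall x y, m x y * e' y = m x y.

Lemma mxmapE v y : mxmap v y = \sum_x (v x : A) * m x y.
Proof. by rewrite idsum_ofE mulr_suml; apply: eq_bigr => x _; rewrite -mulrA mE. Qed.

Lemma mxmap_deg d n v : (forall x y, gr 1 (m x y)) ->
  summand_deg d.+1 n v -> summand_deg d n (mxmap v).
Proof.
move=> m1 hv y; rewrite mxmapE /shift_deg; have [hg _ hM] := hgr; case: ltnP => dn.
  apply: big1 => x _; have := hv x; rewrite /shift_deg ltnS ltnW // => ->.
  exact: mul0r.
apply: (grading_sum hg) => x _; have := hv x; rewrite /shift_deg ltnS.
case: leqP => [_ ->|dn' hx]; first by rewrite mul0r; exact: gr0.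
by rewrite (_ : n - d = n - d.+1 + 1)%N; [exact: hM | rewrite addn1 -subSn].
Qed.

End MatrixMap.

(** The modules [A], [sum_x A e_x], [A], 0, 0, ..., generated in degrees 0, 1,
    2, ..., with maps right multiplication by [alpha] and by [beta]. In the
    application these are the arrows and their opposites. *)
Section Resolution.
Variables (X : finType) (e alpha beta : X -> A).
Hypothesis eK : forall x, e x * e x = e x.
Hypothesis e0 : forall x, gr 0 (e x).
Hypothesis alpha1 : forall x, gr 1 (alpha x).
Hypothesis beta1 : forall x, gr 1 (beta x).
Hypothesis e_alpha : forall x, e x * alpha x = alpha x.
Hypothesis beta_e : forall x, beta x * e x = beta x.
Hypothesis gen_alpha : forall n a, gr n.+1 a -> exists v : X -> A, a = \sum_x v x * alpha x.
Hypothesis beta_alpha : \sum_x beta x * alpha x = 0.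
Hypothesis alpha_exact : forall n (v : X -> A), (forall x, gr n (v x)) ->
  (forall x, v x * e x = v x) -> \sum_x v x * alpha x = 0 ->
  exists a, forall x, v x = a * beta x.
Hypothesis beta_inj : forall n a, gr n a -> (forall x, a * beta x = 0) -> a = 0.

Definition res_index i : finType :=
  match i with 0 => unit : finType | 1 => X | 2 => unit : finType | _ => void : finType end.

Definition res_idem i : res_index i -> A :=
  match i with 0 => fun=> 1 | 1 => e | 2 => fun=> 1 | _ => fun=> 0 end.

Definition res_matrix i : res_index i.+1 -> res_index i -> A :=
  match i with
  | 0 => fun x _ => alpha x | 1 => fun _ x => beta x | _ => fun _ _ => 0
  end.

Lemma res_idemK i x : @res_idem i x * res_idem x = res_idem x.
Proof. by case: i x => [|[|[|i]]] x //=; rewrite ?mul1r ?mul0r. Qed.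

Lemma res_idem_deg i x : gr 0 (@res_idem i x).
Proof. by have [_ g1 _] := hgr; case: i x => [|[|[|i]]] x //=; exact: gr0. Qed.

Lemma res_matrix_idem i x y : @res_matrix i x y * res_idem y = res_matrix x y.
Proof. by case: i x y => [|[|[|i]]] x y //=; rewrite ?mulr1 ?mul0r. Qed.

Lemma res_matrix_deg i x y : gr 1 (@res_matrix i x y).
Proof. by case: i x y => [|[|[|i]]] x y //=; exact: gr0. Qed.

Definition res_module i : gmod gr := summand i (@res_idemK i) (@res_idem_deg i).

Definition res_map i : {linear res_module i.+1 -> res_module i} := mxmap (@res_matrix i) (@res_idemK i).

Definition res_aug (v : res_module 0%N) : deg0_module := deg0_proj ((v : idsum _) tt).

Fact res_aug_linear : linear res_aug.
Proof.
move=> a u v; rewrite /res_aug -deg0_proj_linear; congr deg0_proj.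
by rewrite idsum_addE idsum_scaleE.
Qed.
HB.instance Definition _ := GRing.isLinear.Build A (res_module 0%N) deg0_module _ res_aug res_aug_linear.

Lemma sum_degS_eq0 N (f : nat -> A) : (forall n, gr n.+1 (f n)) ->
  \sum_(n < N) f n = 0 -> forall n, (n < N)%N -> f n = 0.
Proof.
have [[_ _ gind] _ _] := hgr; move=> hf sf n nN.
apply: (gind N.+1 (fun m => if m is m'.+1 then f m' else 0) _ _ n.+1) => // [[|m]|] //.
  exact: gr0.
by rewrite big_ord_recl add0r.
Qed.

Lemma idsum_deg_decomp (v : idsum e) : exists N (c : nat -> idsum e),
  (forall n, idsum_deg gr n (c n)) /\ v = \sum_(n < N) c n.
Proof.
have [hg _ hM] := hgr.
have ge n a x : gr n a -> gr n (a * e x) by move=> ha; rewrite -[n]addn0; exact: hM.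
by have [_ dec _] := idsum_grading eK hg ge; exact: dec.
Qed.

(** The hypothesis concerns homogeneous families, so [v] is split into
    components, whose images vanish separately. *)
Lemma res_exact0 (v : idsum e) : res_map 0 v = 0 <-> exists w, res_map 1 w = v.
Proof.
have [_ _ hM] := hgr; split=> [v0|[w <-]]; last first.
  apply: idsumP => y; rewrite [LHS](mxmapE _ (@res_matrix_idem 0%N)) idsum0E.
  transitivity (((w : idsum _) tt : A) * \sum_x beta x * alpha x); last by rewrite beta_alpha mulr0.
  rewrite mulr_sumr; apply: eq_bigr => x _.
  by rewrite (mxmapE _ (@res_matrix_idem 1%N)) sum_unit /= mulrA.
have {v0} v0 : \sum_x (v x : A) * alpha x = 0.
  by rewrite -(mxmapE (e := e) (@res_idemK 0%N) (@res_matrix_idem 0%N) v tt) [mxmap _ _ _]v0 idsum0E.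
have [N [c [hc ev]]] := idsum_deg_decomp v.
have c0 : forall n, (n < N)%N -> \sum_x (c n x : A) * alpha x = 0.
  apply: sum_degS_eq0 => [n|].
    by apply: (grading_sum (let: And3 h _ _ := hgr in h)) => x _; rewrite -addn1; apply: hM => //; exact: hc.
  rewrite exchange_big -[RHS]v0; apply: eq_bigr => x _.
  by rewrite ev idsum_sumE mulr_suml.
have /choice[a ha] n : exists a, (n < N)%N -> forall x, c n x = a * beta x.
  have [nN|_] := ltnP n N; last by exists 0.
  have [a ha] := alpha_exact (hc n) (idsum_mul_idem (c n)) (c0 n nN).
  by exists a.
exists (idsum_of (@res_idemK 2%N) (fun=> \sum_(n < N) a n)); apply: idsumP => x.
rewrite [LHS](mxmapE _ (@res_matrix_idem 1%N)) sum_unit idsum_ofE mulr1 mulr_suml ev idsum_sumE.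
by apply: eq_bigr => n _; rewrite ha.
Qed.

Lemma res_exact1 (v : res_module 2) : res_map 1 v = 0 <-> exists w, res_map 2 w = v.
Proof.
have [hg _ hM] := hgr; split=> [v0|[w <-]]; last first.
  apply: idsumP => y; rewrite [LHS](mxmapE _ (@res_matrix_idem 1%N)) idsum0E big1 // => x _.
  by rewrite (mxmapE _ (@res_matrix_idem 2%N)) big1 ?mul0r // => z _; rewrite mulr0.
exists 0; rewrite linear0; apply: idsumP => -[]; rewrite idsum0E; symmetry.
have {v0} v0 x : ((v : idsum _) tt : A) * beta x = 0.
  have := mxmapE (@res_idemK 1%N) (@res_matrix_idem 1%N) v x.
  by rewrite sum_unit [mxmap _ _ _]v0 idsum0E.
have [N [c [_ hc ev]]] := grading_decomp hg 0%N ((v : idsum _) tt).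
rewrite ev big1 // => n _; apply: (beta_inj (hc n)) => x.
apply: (@sum_degS_eq0 N (fun n => c n * beta x)) (ltn_ord n) => [m|].
  by rewrite -addn1; exact: hM.
by rewrite -mulr_suml -ev.
Qed.

Lemma koszul_of_exact : semisimple0 gr -> koszul gr.
Proof.
move=> ss; split=> //; exists deg0_module, res_module, res_aug, res_map; split; first exact: deg0_moduleP.
split.
- by move=> i; split; [exact: summand_projective|exact: summand_generated].
- split=> [n v hv|i n v hv].
    have := hv tt; rewrite /shift_deg ltn0 subn0 => hn.
    case: n hn {hv} => [|n] hn; [by left|right].
    by apply/deg0_proj0; exact: positive_gr hn.
  by apply: mxmap_deg => // x y; [exact: res_matrix_idem | exact: res_matrix_deg].
- move=> s; exists (idsum_of (@res_idemK 0%N) (fun=> deg0_repr s)).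
  by rewrite /= /res_aug idsum_ofE mulr1 deg0_reprK.
- move=> v; rewrite /= /res_aug; split=> [/deg0_proj0[N [f [hf ev]]]|[w <-]]; last first.
    apply/deg0_proj0; rewrite (mxmapE _ (@res_matrix_idem 0%N)); apply: positive_sum => x _.
    apply: positiveM; apply: (@positive_gr 0%N); exact: alpha1.
  have /choice[c hc] : forall n, exists c : X -> A, f n = \sum_x c x * alpha x.
    by move=> n; apply: gen_alpha (hf n).
  exists (idsum_of (@res_idemK 1%N) (fun x => \sum_(n < N) c n x)); apply: idsumP => -[].
  rewrite [LHS](mxmapE _ (@res_matrix_idem 0%N)) ev.
  under eq_bigr => x _ do rewrite idsum_ofE /= -mulrA e_alpha mulr_suml.
  by rewrite exchange_big; apply: eq_bigr => n _; rewrite hc.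
- case=> [|[|i]] v; [exact: res_exact0 | exact: res_exact1 |].
  have v0 : v = 0 by apply: idsumP => -[].
  by rewrite v0 linear0; split=> // _; exists 0; rewrite linear0.
Qed.

End Resolution.
End GradedModule.

(** * Koszulness of the preprojective algebra *)

Section KoszulQuotient.
Variables (k : fieldType) (G : graph) (b : nat -> vert G -> k).
Local Notation kG := (path_alg k G).
Local Notation arrow := (vert G * edge G * vert G)%type.
Local Notation e := (@pidem k G).
Local Notation arr := (@arr k G).
Variables (B : pzRingType) (pi : kG -> B) (scal : k -> B).
Hypothesis scal0 : scal 0 = 0.
Hypothesis scal1 : scal 1 = 1.
Hypothesis scalD : {morph scal : c d / c + d}.
Hypothesis scalM : {morph scal : c d / c * d}.
Hypothesis piD : {morph pi : u v / u + v}.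
Hypothesis piM : {morph pi : u v / u * v}.
Hypothesis piZ : forall c u, pi (c *' u) = scal c * pi u.
Hypothesis pi_eq0P : forall u, pi u = 0 <-> u \in @theta_ideal k G.
Hypothesis pi_surj : forall a, exists u, a = pi u.
Hypothesis b_rec : forall n j,
  \sum_(y : arrow | is_arrow y && (y.2 == j)) b n y.1.1 = b n.+1 j + bpred b n j.
Hypothesis b_neq0 : forall n j, b n j != 0.

Local Notation pi0 := (pi0 scal0 piZ).
Local Notation pi_sum := (pi_sum scal0 piD piZ).
Local Notation gr := (qdeg pi).

Lemma pi1 : pi 1 = 1.
Proof.
have [u hu] := pi_surj 1; rewrite -[pi 1]mulr1 hu -piM mul1r.
by rewrite -hu.
Qed.

Lemma qdeg_grading : is_grading gr.
Proof.
split.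
- move=> n; split=> [|_ _ [u hu ->] [v hv ->]]; first exact: (qdeg0 scal0 piZ).
  exists (u - v); last by rewrite (piB scal0 piD piZ).
  by apply: phomogD => //; exact: phomogN.
- move=> a; have [u ->] := pi_surj a; have [N hN] := hpart_decomp u.
  exists N, (fun n => pi (hpart n u)); split=> [n|].
    by exists (hpart n u) => //; exact: phomog_hpart.
  by rewrite {1}(hN N (leqnn N)) pi_sum.
move=> N f hf sf n nN.
have /choice[u hu] m : exists u, phomog m u /\ f m = pi u by have [u] := hf m; exists u.
have : pi (\sum_(m < N) u m) = 0.
  by rewrite pi_sum -[RHS]sf; apply: eq_bigr => m _; have [_ ->] := hu m.
move=> /(pi_hpart pi_eq0P n); rewrite hpart_sum (bigD1 (Ordinal nN)) //=.
have [hn ->] := hu n; rewrite (hpart_homog _ hn) eqxx big1 ?addr0 // => m.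
by rewrite -val_eqE /= => /negPf nm; have [hm _] := hu m; rewrite (hpart_homog _ hm) nm.
Qed.

Lemma qdeg_graded_ring : graded_ring gr.
Proof.
split; [exact: qdeg_grading| |by move=> m n a c; exact: (qdegM piM)].
exists 1; last by rewrite pi1.
by rewrite -(sum_idem k G); apply: phomog_sum => i _; exact: phomog_idem.
Qed.

Lemma qdeg0_scalar a : gr 0 a -> forall i, exists c, pi (e i) * a = scal c * pi (e i).
Proof.
move=> [u /phomog0P[c ->] ->] i; exists (c i); rewrite -piM mulr_sumr (bigD1 i) //=.
rewrite kscale_mulr idem_mul eqxx big1 ?addr0 ?piZ // => l nl.
by rewrite kscale_mulr idem_mul eq_sym (negPf nl) kscaler0.
Qed.

Lemma sum_idem_pi a : \sum_i pi (e i) * a = a.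
Proof. by rewrite -mulr_suml -pi_sum sum_idem pi1 mul1r. Qed.

Lemma scal_idem_deg c i : gr 0 (scal c * pi (e i)).
Proof. by exists (c *' e i); [apply/phomogZ/phomog_idem|rewrite piZ]. Qed.

(** An element of degree zero acts on each [e_i] by a scalar. A left ideal [J]
    is hence spanned by the [e_i] it contains, and the other ones span a
    complement. *)
Lemma qdeg_semisimple0 : semisimple0 gr.
Proof.
have [hg _ hM] := qdeg_graded_ring; have [hgs _ _] := hg.
move=> J [Jgr J0 JB JM]; have [g0 gB] := hgs 0%N.
have eJ a i : gr 0 a -> J (pi (e i)) -> J (pi (e i) * a).
  move=> ha Ji; have [c ->] := qdeg0_scalar ha i.
  rewrite -(pi_idemK piM i) mulrA; apply: JM => //; exact: scal_idem_deg.
exists (fun a => gr 0 a /\ forall i, J (pi (e i)) -> pi (e i) * a = 0); split.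
- split=> [a []||a c [ha a0] [hc c0]|a c ha [hc c0]] //.
  + by split=> // i _; rewrite mulr0.
  + by split=> [|i Ji]; [exact: gB | rewrite mulrBr a0 // c0 // subrr].
  split=> [|i Ji]; first exact: (hM 0%N 0%N).
  have [d ed] := qdeg0_scalar ha i.
  by rewrite mulrA ed -mulrA c0 // mulr0.
- move=> a Ja [ha a0]; rewrite -(sum_idem_pi a); apply: big1 => i _.
  have [c ec] := qdeg0_scalar ha i; have [c0|nc] := eqVneq c 0.
    by rewrite ec c0 scal0 mul0r.
  apply: a0; have -> : pi (e i) = (scal c^-1 * pi (e i)) * a.
    by rewrite -mulrA ec mulrA -scalM mulVf // scal1 mul1r.
  by apply: JM => //; exact: scal_idem_deg.
move=> a ha; exists (\sum_(i | `[< J (pi (e i)) >]) pi (e i) * a).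
exists (\sum_(i | ~~ `[< J (pi (e i)) >]) pi (e i) * a).
have hea i : gr 0 (pi (e i) * a).
  by apply: (hM 0%N 0%N) => //; exists (e i) => //; exact: phomog_idem.
split; last by rewrite -[LHS]sum_idem_pi (bigID (fun i => `[< J (pi (e i)) >])).
  have JD c d : J c -> J d -> J (c + d).
    by move=> Jc Jd; rewrite -[d]opprK; apply: (JB _ _ Jc); rewrite -sub0r; apply: (JB).
  by apply: big_ind => // i /asboolP; exact: eJ.
split; first exact: (grading_sum hg).
move=> i Ji; rewrite mulr_sumr big1 // => j nj.
rewrite mulrA -piM idem_mul; case: eqP => [eij|_]; last by rewrite pi0 mul0r.
by move: nj; rewrite -eij => /asboolP.
Qed.

(** Triples that are not arrows contribute a zero summand. *)
Definition arrow_idem (x : arrow) : B := if is_arrow x then pi (e x.1.1) else 0.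

Lemma koszul_quotient : koszul gr.
Proof.
have kI c : c != 0 -> forall d : B, scal c * d = 0 -> d = 0.
  by move=> nc d cd; rewrite -[d]mul1r -scal1 -(mulVf nc) scalM -mulrA cd mulr0.
apply: (@koszul_of_exact B gr qdeg_graded_ring _ arrow_idem
  (fun x => pi (arr x)) (fun x => pi (arr (opp_arrow x)))).
- by move=> x; rewrite /arrow_idem; case: ifP; rewrite ?mul0r // (pi_idemK piM).
- move=> x; rewrite /arrow_idem; case: ifP => _; last exact: (qdeg0 scal0 piZ).
  exact: qdeg_idem.
- by move=> x; exact: qdeg_arr.
- by move=> x; exact: qdeg_arr.
- move=> x; rewrite /arrow_idem; case: ifP => [_|/negbT nx]; first exact: pi_idem_arr.
  by rewrite (pi_arr_nonarrow scal0 piZ nx) mulr0.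
- move=> x; rewrite /arrow_idem; case: ifP => [_|/negbT nx].
    exact: (pi_arr_idem piM (opp_arrow x)).
  by rewrite (pi_arr_nonarrow scal0 piZ (x := opp_arrow x)) ?is_arrow_opp // mul0r.
- by move=> n a ha; have [v _ ->] := degS_decomp scal0 piD piM piZ ha; exists v.
- have := mul_arr_complex scal0 piD piM piZ pi_eq0P 1.
  by under eq_bigr => x _ do rewrite mul1r.
- move=> n v hv ve sv.
  have [|x|x nx|a _ va] := mul_arr_exact scal0 scal1 scalD scalM piD piM piZ pi_eq0P b_rec _ hv _ _ sv.
  + by move=> m j _; exact: b_neq0.
  + have := ve x; rewrite /arrow_idem; case: ifP => // _; rewrite mulr0 => <-.
    exact: mul0r.
  + by rewrite -(ve x) /arrow_idem (negPf nx) mulr0.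
  by exists a.
- move=> n a ha a0; rewrite -(sum_pi_idem scal0 piD piM piZ (pi_surj a)).
  apply: big1 => j _; apply: (kI _ (b_neq0 n.+1 j)).
  apply: (mul_arr_inj scal0 scal1 scalD scalM piD piM piZ pi_eq0P b_rec) => //.
  by move=> x; rewrite -(opp_arrowK x).
exact: qdeg_semisimple0.
Qed.

End KoszulQuotient.

Section Final.
Variables (k : fieldType) (G : graph).
Hypothesis k0 : [pchar k] =i pred0.
Hypothesis Gconn : connected_graph G.

Lemma koszul_preproj : (~ exists X, has_adet_type G X) -> koszul (@preproj_deg k G).
Proof.
move=> nX.
apply: (@koszul_quotient k G (@kweight k G) (preproj k G) (@pproj k G) (@pscalar k G)).
- exact: pscalar0.
- exact: pscalar1.
- exact: pscalarD.
- exact: pscalarM.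
- exact: pprojD.
- exact: pproj_mul.
- exact: pscalar_pproj.
- exact: pproj_eq0.
- by move=> a; exists (prepr a); rewrite preprK.
- exact: kweight_rec.
by move=> n j; apply: (intr_pchar0 k0); exact: (weight_pos_of_not_adet k0 Gconn nX).
Qed.

End Final.

Theorem theorem1p3 (k : fieldType) (G : graph) :
  [pchar k]%R =i pred0 ->
  connected_graph G ->
  ((~ exists X, has_adet_type G X) ->
     hilbert k G =1 sinv (cartan_series G) /\ koszul (@preproj_deg k G)) /\
  (forall X, has_adet_type G X ->
     exists2 s : {perm vert G}, involutive s &
       hilbert k G =1 smul (perm_series s (coxeter X)) (sinv (cartan_series G))).
Proof.
move=> k0 Gconn; split=> [nX|X hX]; last exact: hilbert_adet.
by split; [exact: hilbert_not_adet | exact: koszul_preproj].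
Qed.
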